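(* The function $J=J(Q,\eta)$ is $C^1$ on $\{(Q,\eta)\in\mathcal{Q}\times\mathbb{R}:|Q|^2>\eta\}$, with derivatives $$\frac{\partial J}{\partial Q}=\Lambda(Q,\eta)-\int_{E_Q}\frac{f_Q(p)}{Qp\cdot p-\eta}\left(p\otimes p-\tfrac13 I\right)dp,\qquad \frac{\partial J}{\partial\eta}=\int_{E_Q}\frac{f_Q(p)}{Qp\cdot p-\eta}\,dp,$$ where $f_Q$ is the optimal energy distribution for $(Q,\eta)$.
   Context: $\mathbb{S}^2\subset\mathbb{R}^3$ is the unit sphere and $dp$ is the 2-dimensional Hausdorff measure on it. $\mathrm{Sym}_0(3)$ is the space of traceless symmetric real $3\times3$ matrices with $A\cdot B=\mathrm{Tr}(AB)$, $|A|^2=A\cdot A$; $v_{\min}(Q)$ is the smallest eigenvalue of $Q$; $\mathcal{Q}=\{Q\in\mathrm{Sym}_0(3):v_{\min}(Q)>-\frac13\}$. $\mathcal{P}(\mathbb{S}^2)=\{f\in L^1(\mathbb{S}^2): f\ge 0 \text{ a.e.},\ \int_{\mathbb{S}^2}f\,dp=1\}$. For $Q\in\mathcal{Q}$, $A(Q)=\{f\in\mathcal{P}(\mathbb{S}^2):\int_{\mathbb{S}^2}(p\otimes p-\frac13I)f(p)\,dp=Q\}$. For $\eta\in\mathbb{R}$ and $f\in A(Q)$, $\mathcal{F}(f,\eta)=\int_{\mathbb{S}^2}f(p)\ln f(p)-f(p)\ln(Qp\cdot p-\eta)\,dp$, where $-\ln$ is extended by $+\infty$ for non-positive arguments and $0\times(+\infty)=0$,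 $0\ln0=0$. Define $J(Q,\eta)=\inf_{f\in A(Q)}\mathcal{F}(f,\eta)\in\mathbb{R}\cup\{+\infty\}$ and $E_Q=\{p\in\mathbb{S}^2:Qp\cdot p>\eta\}$. The domain of $J$ (where $J<+\infty$) is $\{(Q,\eta)\in\mathcal{Q}\times\mathbb{R}:|Q|^2>\eta\}$. On it, the infimum is attained at a unique $f_Q\in A(Q)$ (the optimal energy distribution), which has the form $f_Q(p)=\frac1Z\exp(\Lambda p\cdot p)\max(Qp\cdot p-\eta,0)$ with $Z>0$ a normalising constant and $\Lambda=\Lambda(Q,\eta)$ the unique maximiser over $\lambda\in\mathrm{Sym}_0(3)$ of $\lambda\cdot Q-\ln\left(\int_{\mathbb{S}^2}\exp(\lambda p\cdot p)\max(Qp\cdot p-\eta,0)\,dp\right)$. *)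

(* Defs.v *)
From HB Require Import structures.
From mathcomp Require Import all_boot all_order all_algebra.
From mathcomp Require Import ring.
From mathcomp Require Import all_classical all_reals all_analysis.
Set Implicit Arguments.
Unset Strict Implicit.
Unset Printing Implicit Defensive.
Import Order.TTheory GRing.Theory Num.Def Num.Theory.
Import numFieldNormedType.Exports.
Local Open Scope classical_set_scope.
Local Open Scope ring_scope.

(* Points of R^3 are column vectors.  The norm that MathComp-Analysis puts on
   matrices is the maximum norm, so the Euclidean one is defined here. *)
Section euclidean.
Variable R : realType.
Implicit Types p q : 'cV[R]_3.

Definition dotv p q : R := \sum_i p i 0 * q i 0.

Definition enorm p : R := Num.sqrt (dotv p p).

Definition sphere : set 'cV[R]_3 := [set p | enorm p = 1].

(* quad A p is A p . p *)
Definition quad (A : 'M[R]_3) p : R := dotv (A *m p) p.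

(* p (x) p - I/3 *)
Definition qtensor p : 'M[R]_3 := p *m p^T - (3%:R^-1)%:M.

End euclidean.

(* The two-dimensional Hausdorff measure on R^3, normalised by
   pi/4 = (area of the unit disc) / 2^2.  It is an outer measure, and the
   measurable sets are its Caratheodory-measurable ones. *)
Section hausdorff2.
Variable R : realType.
Local Notation R3 := 'cV[R]_3.
Implicit Types (A B U : set R3) (d : R).
Local Open Scope ereal_scope.

(* The maximum with 0 only matters for the empty set. *)
Definition diam U : \bar R :=
  maxe 0 (ereal_sup [set (enorm (p - q)%R)%:E | p in U & q in U]).

Definition hcover d A : set (set R3)^nat :=
  [set U | A `<=` \bigcup_k U k /\ forall k, diam (U k) <= d%:E].

Definition hgauge U : \bar R := (pi / 4)%:E * diam U ^+ 2.

Definition hausdorff2_pre d A : \bar R :=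
  ereal_inf [set \sum_(k <oo) hgauge (U k) | U in hcover d A].

Definition hausdorff2 A : \bar R :=
  ereal_sup [set hausdorff2_pre d A | d in [set d | (0 < d)%R]].

Lemma diam_ge0 U : 0 <= diam U.
Proof. by rewrite /diam le_max lexx. Qed.

Lemma diam_set0 : diam set0 = 0.
Proof.
rewrite /diam (_ : [set _ | _ in _ & _ in _] = set0).
  by rewrite ereal_sup0 max_l ?leNye.
by rewrite predeqE => t; split => // -[? []].
Qed.

Lemma hgauge_ge0 U : 0 <= hgauge U.
Proof.
apply: mule_ge0; first by rewrite lee_fin divr_ge0 ?pi_ge0.
by rewrite expe2 mule_ge0 ?diam_ge0.
Qed.

Lemma hgauge0 : hgauge set0 = 0.
Proof. by rewrite /hgauge diam_set0 expe2 !mule0. Qed.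

Lemma hausdorff2_pre_ge0 d A : 0 <= hausdorff2_pre d A.
Proof.
apply/le_ereal_inf_tmp => _ [U _ <-].
by apply: nneseries_ge0 => k _ _; exact: hgauge_ge0.
Qed.

Lemma hausdorff2_pre_set0 d : (0 < d)%R -> hausdorff2_pre d set0 = 0.
Proof.
move=> d0; apply/eqP; rewrite eq_le hausdorff2_pre_ge0 andbT.
apply: ereal_inf_lbound; exists (fun=> set0).
  by split => // k; rewrite diam_set0 lee_fin ltW.
by rewrite eseries0// => k _ _; rewrite hgauge0.
Qed.

Lemma le_hausdorff2_pre d A B : A `<=` B ->
  hausdorff2_pre d A <= hausdorff2_pre d B.
Proof.
move=> AB; apply: ereal_inf_le_tmp => _ [U [BU Ud] <-].
by exists U => //; split => //; exact: subset_trans BU.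
Qed.

Lemma hausdorff2_pre_sigma_subadditive d : sigma_subadditive (hausdorff2_pre d).
Proof.
move=> A; have [[i ioo]|] := pselect (exists i, hausdorff2_pre d (A i) = +oo).
  rewrite (eseries_pinfty _ _ ioo) ?leey// => n _.
  by rewrite -ltNye (lt_le_trans _ (hausdorff2_pre_ge0 _ _)).
rewrite -forallNE => Aoo.
suff add2e (e : {posnum R}) : hausdorff2_pre d (\bigcup_n A n) <=
    \sum_(i <oo) hausdorff2_pre d (A i) + e%:num%:E.
  by apply/lee_addgt0Pr => _/posnumP[].
rewrite (le_trans _ (epsilon_trick _ _ _))//; last first.
  by move=> n; exact: hausdorff2_pre_ge0.
pose P n (B : (set R3)^nat) := hcover d (A n) B /\
  \sum_(k <oo) hgauge (B k) <=
    hausdorff2_pre d (A n) + (e%:num / (2 ^ n.+1)%:R)%:E.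
have [G PG] : {G : ((set R3)^nat)^nat & forall n, P n (G n)}.
  apply: (@choice _ _ P) => n; rewrite /P /hausdorff2_pre.
  set S := (X in ereal_inf X); move infS : (ereal_inf S) => iS.
  case: iS infS => [r Sr|Soo|Soo].
  - have en1 : (0 < e%:num / (2 ^ n.+1)%:R)%R by [].
    have /(lb_ereal_inf_adherent en1) : ereal_inf S \is a fin_num by rewrite Sr.
    move=> [x [B cB muBx] xS].
    by exists B; split => //; rewrite muBx -Sr; exact/ltW.
  - by have := Aoo n; rewrite /hausdorff2_pre Soo.
  - by have := hausdorff2_pre_ge0 d (A n); rewrite /hausdorff2_pre Soo.
have muG_ge0 x : 0 <= (hgauge \o uncurry G) x by exact: hgauge_ge0.
apply: (@le_trans _ _ (\esum_(i in setT) (hgauge \o uncurry G) i)).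
  rewrite /hausdorff2_pre; apply: ereal_inf_lbound => /=.
  have /card_esym/ppcard_eqP[f] := card_nat2.
  exists (uncurry G \o f).
    split => [|i]; last first.
      by rewrite /=; case: (f i) => a b; have [[_ Gd] _] := PG a; exact: Gd.
    apply: (@subset_trans _  (\bigcup_n \bigcup_k G n k)) => [t [i _]|].
      by have [[AG _] _] := PG i; move=> /AG [j _ ?]; exists i => //; exists j.
    move=> t [i _ [j _ Bijt]]; exists (f^-1%FUN (i, j)) => //=.
    by rewrite invK ?inE.
  rewrite -(esum_pred_image (hgauge \o uncurry G) _ xpredT) ?[fun=> _]set_true//.
  by rewrite image_eq.
rewrite (_ : esum _ _ = \sum_(i <oo) \sum_(j <oo ) hgauge (G i j)); last first.
  pose J : nat -> set (nat * nat) := fun i => [set (i, j) | j in setT].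
  rewrite (_ : setT = \bigcup_k J k); last first.
    by rewrite predeqE => -[a b]; split => // _; exists a => //; exists b.
  rewrite esum_bigcupT /=; last 2 first.
    - apply/trivIsetP => i j _ _ ij.
      rewrite predeqE => -[n m] /=; split => //= -[] [_] _ [<-{n} _].
      by move=> [m' _] [] /esym/eqP; rewrite (negbTE ij).
    - by move=> /= [n m]; exact: hgauge_ge0.
  rewrite -(image_id [set: nat]) -fun_true esum_pred_image//; last first.
    by move=> *; apply: esum_ge0 => *; exact: muG_ge0.
  apply: eq_eseriesr => /= j _.
  rewrite -(esum_pred_image (hgauge \o uncurry G) (pair j) predT)//=; last 2 first.
  - by move=> n _; exact: hgauge_ge0.
  - by move=> ? ? _ _; exact: (@can_inj _ _ _ snd).
  by congr esum; rewrite predeqE => -[a b]; split; move=> [i _ <-]; exists i.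
apply: lee_lim.
- apply: is_cvg_nneseries => n *.
  by apply: nneseries_ge0 => m *; exact: (muG_ge0 (n, m)).
- apply: is_cvg_nneseries => n *; apply: adde_ge0 => //.
  exact: hausdorff2_pre_ge0.
- by near=> n; apply: lee_sum => i _; exact: (PG i).2.
Unshelve. all: by end_near. Qed.

Lemma hausdorff2_set0 : hausdorff2 set0 = 0.
Proof.
apply/eqP; rewrite eq_le; apply/andP; split.
  by apply/ge_ereal_sup => _ [d d0 <-]; rewrite hausdorff2_pre_set0.
by apply: ereal_sup_ubound; exists 1%R; rewrite ?hausdorff2_pre_set0/=.
Qed.

Lemma le_hausdorff2_pre_hausdorff2 d A : (0 < d)%R ->
  hausdorff2_pre d A <= hausdorff2 A.
Proof. by move=> d0; apply: ereal_sup_ubound; exists d. Qed.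

Lemma hausdorff2_ge0 A : 0 <= hausdorff2 A.
Proof.
exact: le_trans (hausdorff2_pre_ge0 1 A) (le_hausdorff2_pre_hausdorff2 _ _).
Qed.

Lemma le_hausdorff2 : {homo hausdorff2 : A B / A `<=` B >-> A <= B}.
Proof.
move=> A B AB; apply/ge_ereal_sup => _ [d d0 <-].
exact: le_trans (le_hausdorff2_pre d AB) (le_hausdorff2_pre_hausdorff2 _ _).
Qed.

Lemma hausdorff2_sigma_subadditive : sigma_subadditive hausdorff2.
Proof.
move=> A; apply/ge_ereal_sup => _ [d d0 <-].
apply: le_trans (hausdorff2_pre_sigma_subadditive d A) _.
apply: lee_nneseries => [i _ _|i _]; first exact: hausdorff2_pre_ge0.
exact: (le_hausdorff2_pre_hausdorff2 _ d0).
Qed.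

HB.instance Definition _ := isOuterMeasure.Build R R3 hausdorff2
  hausdorff2_set0 hausdorff2_ge0 le_hausdorff2 hausdorff2_sigma_subadditive.

Definition hausdorff2_outer : {outer_measure set R3 -> \bar R} := hausdorff2.

End hausdorff2.

(* R^3 as a measurable space. *)
Definition R3 (R : realType) : measurableType (hausdorff2_outer R).-cara :=
  caratheodory_type (hausdorff2_outer R).

(* dp *)
Definition H2 (R : realType) : {measure set (R3 R) -> \bar R} :=
  hausdorff2_outer R.

Section dotm.
Variables (R : realType) (n : nat).
Implicit Types A B : 'M[R]_n.

Definition dotm A B : R := \tr (A *m B).

End dotm.

(* Sym_0(3), normed by |A|^2 = A . A *)
Section sym0.
Variable R : realType.

Definition is_sym0 : {pred 'M[R]_3} := fun A => (A^T == A) && (\tr A == 0).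

Lemma is_sym0_submod : submod_closed is_sym0.
Proof.
split; first by rewrite unfold_in/= trmx0 mxtrace0 !eqxx.
move=> a A B /andP[/eqP tA /eqP rA] /andP[/eqP tB /eqP rB].
by rewrite unfold_in/= linearP/= tA tB linearP/= rA rB mulr0 addr0 !eqxx.
Qed.

HB.instance Definition _ :=
  GRing.isSubmodClosed.Build R 'M[R]_3 is_sym0 is_sym0_submod.

Record sym0 := Sym0 { sym0_val :> 'M[R]_3; _ : sym0_val \in is_sym0 }.

HB.instance Definition _ := [isSub for sym0_val].
HB.instance Definition _ := [Choice of sym0 by <:].
HB.instance Definition _ := [SubChoice_isSubLmodule of sym0 by <:].

Implicit Types A B : sym0.

Definition sym0_norm A : R := Num.sqrt (dotm A A).

Lemma dotm_sym0 A B : dotm A B = \sum_i \sum_j A i j * B i j.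
Proof.
have /andP[/eqP tB _] := valP B.
apply: eq_bigr => i _; rewrite mxE; apply: eq_bigr => j _.
by rewrite -[in LHS](tB : (B : 'M[R]_3)^T = B) mxE.
Qed.

Lemma dotm_sym0_ge0 A : 0 <= dotm A A.
Proof.
by rewrite dotm_sym0; apply: sumr_ge0 => i _; apply: sumr_ge0 => j _;
  rewrite -expr2 sqr_ge0.
Qed.

Lemma dotm_sym0_eq0 A : dotm A A = 0 -> A = 0.
Proof.
rewrite dotm_sym0 => /eqP; rewrite psumr_eq0 => [/allP h|i _]; last first.
  by apply: sumr_ge0 => j _; rewrite -expr2 sqr_ge0.
apply: val_inj; apply/matrixP => i j.
have := h i; rewrite mem_index_enum => /(_ isT)/=.
rewrite psumr_eq0 => [/allP/(_ j)|k _]; last by rewrite -expr2 sqr_ge0.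
rewrite mem_index_enum => /(_ isT)/=.
by rewrite mulf_eq0 orbb => /eqP; rewrite mxE.
Qed.

Lemma dotmZZ a b A B : dotm (a *: A) (b *: B) = a * b * dotm A B.
Proof. by rewrite /dotm/= -scalemxAl -scalemxAr !linearZ/= mulrA. Qed.

Lemma sym0_normZ a A : sym0_norm (a *: A) = `|a| * sym0_norm A.
Proof.
rewrite /sym0_norm dotmZZ -expr2.
by rewrite sqrtrM ?sqr_ge0// sqrtr_sqr.
Qed.

Lemma dotmDD A B : dotm (A + B) (A + B) =
  dotm A A + dotm A B *+ 2 + dotm B B.
Proof.
rewrite /dotm/= mulmxDl !mulmxDr !raddfD/= (mxtrace_mulC B A).
by rewrite mulr2n !addrA.
Qed.

(* Cauchy-Schwarz *)
Lemma dotm_sym0_le A B : dotm A B <= sym0_norm A * sym0_norm B.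
Proof.
have [B0|B0] := eqVneq (dotm B B) 0.
  by rewrite (dotm_sym0_eq0 B0) /dotm/= mulmx0 linear0 mulr_ge0 ?sqrtr_ge0.
have Bp : 0 < dotm B B by rewrite lt_def B0 dotm_sym0_ge0.
have := dotm_sym0_ge0 (dotm B B *: A + (- dotm A B) *: B).
rewrite dotmDD !dotmZZ.
set a := dotm A A; set b := dotm A B; set c := dotm B B => h.
have : 0 <= c * (a * c - b ^+ 2).
  apply: le_trans h _; rewrite le_eqVlt; apply/orP; left; apply/eqP.
  by ring.
rewrite pmulr_rge0// subr_ge0 => bac.
rewrite -sqrtrM ?dotm_sym0_ge0//; apply: le_trans (ler_norm _) _.
by rewrite -sqrtr_sqr ler_wsqrtr.
Qed.

Lemma sym0_normD A B : sym0_norm (A + B) <= sym0_norm A + sym0_norm B.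
Proof.
rewrite -(@ler_pXn2r _ 2) ?nnegrE ?addr_ge0 ?sqrtr_ge0//.
rewrite sqrrD !sqr_sqrtr ?dotm_sym0_ge0// dotmDD.
by rewrite lerD2r lerD2l lerMn2r/= dotm_sym0_le.
Qed.

Lemma sym0_norm0 A : sym0_norm A = 0 -> A = 0.
Proof.
move=> /eqP; rewrite sqrtr_eq0 => A0; apply: dotm_sym0_eq0.
by apply/eqP; rewrite eq_le A0 dotm_sym0_ge0.
Qed.

HB.instance Definition _ :=
  @Lmodule_isNormed.Build R sym0 sym0_norm sym0_normD sym0_normZ sym0_norm0.

End sym0.

Section C1.
Variables (K : numFieldType) (V W : normedModType K).

(* Continuity of the differential is in the operator norm. *)
Definition C1_on (U : set V) (f : V -> W) : Prop :=
  (forall x, U x -> differentiable f x) /\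
  forall x, U x -> forall e : K, 0 < e ->
    \forall y \near within U (nbhs x),
      forall v, `|'d f y v - 'd f x v| <= e * `|v|.

End C1.

Section energy.
Variable R : realType.
Implicit Types (Q L : sym0 R) (eta : R) (f : R3 R -> R) (A : 'M[R]_3).

(* The gradient of g : Sym_0(3) -> R at Q for the inner product A . B *)
Definition is_gradient (g : sym0 R -> R) Q A : Prop :=
  A \in @is_sym0 R /\ is_diff Q g (fun B : sym0 R => dotm A B).

(* The smallest eigenvalue; the infimum is over a finite nonempty set when A is
   symmetric. *)
Definition vmin A : R := inf [set a : R | eigenvalue A a].

Definition physical : set (sym0 R) := [set Q | - 3%:R^-1 < vmin Q].

(* Densities are honest functions; their values outside the sphere are
   irrelevant. *)
Definition density : set (R3 R -> R) := [set f : R3 R -> R |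
  [/\ (H2 R).-integrable (@sphere R) (EFin \o f),
      {ae H2 R, forall p, sphere p -> 0 <= f p} &
      \int[H2 R]_(p in @sphere R) f p = 1]].

(* Matrix-valued integrals are taken entrywise. *)
Definition mxintegral (D : set (R3 R)) (F : R3 R -> 'M[R]_3) : 'M[R]_3 :=
  \matrix_(i, j) \int[H2 R]_(p in D) F p i j.

(* A(Q) *)
Definition admissible Q : set (R3 R -> R) := [set f : R3 R -> R |
  density f /\ mxintegral (@sphere R) (fun p => f p *: qtensor p) = Q].

(* lne is -oo on nonpositive reals, and 0 * -oo = 0 in \bar R. *)
Definition free_energy Q eta f : \bar R :=
  (\int[H2 R]_(p in @sphere R)
     ((f p)%:E * lne (f p)%:E - (f p)%:E * lne (quad Q p - eta)%:E))%E.

Definition J Q eta : \bar R :=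
  ereal_inf [set free_energy Q eta f | f in admissible Q].

Definition dom : set (sym0 R * R)%type :=
  [set x | physical x.1 /\ x.2 < `|x.1| ^+ 2].

Definition E_ Q eta : set (R3 R) := [set p | sphere p /\ eta < quad Q p].

Definition is_optimal Q eta f : Prop :=
  admissible Q f /\ free_energy Q eta f = J Q eta.

Definition dual_energy Q eta L : R :=
  dotm L Q - ln (\int[H2 R]_(p in @sphere R)
    (expR (quad L p) * maxr (quad Q p - eta) 0)).

Definition is_dual_maximiser Q eta L : Prop :=
  forall L', dual_energy Q eta L' <= dual_energy Q eta L.

(* Both are well defined on dom, f_opt up to a set of measure zero. *)
Definition f_opt Q eta : R3 R -> R := get (is_optimal Q eta).

Definition Lambda Q eta : sym0 R := get (is_dual_maximiser Q eta).

End energy.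

(* Main.v *)
(* With w_x(p) = max(Qp.p - eta, 0) for x = (Q, eta) and
   Z(l, x) = int exp(lp.p) w_x, the dual energy is -ln Psi(l, x), where
   Psi(l, x) = exp(-l.Q) Z(l, x) is strictly convex and coercive in l.  Its
   minimiser L exists, the first-order condition puts the Gibbs density
   exp(Lp.p) w_x / Z(L, x) in A(Q), and Gibbs' inequality then gives
   J(x) = max_l (l.Q - ln Z(l, x)), attained by that density only.

   Coercivity needs, for every u <> 0, a point of the sphere with Qp.p > eta and
   up.p > u.Q: a probability vector of second moments Q + I/3, tilted slightly
   along u, has an average with both properties.

   Z(l, x) is convex in x, with subgradient v |-> int_{w_x > 0} exp(lp.p) (v applied
   to p); this is jointly continuous in (l, x) because {p : Qp.p = eta} is a null
   set when eta < |Q|^2.  By compactness the minimiser depends continuously on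
   x, so J, a maximum over l, is squeezed between two linear maps
   whose coefficients converge, which is Danskin's theorem.

   That level sets are null is proved without surface coordinates: rotations
   about an axis preserve the Hausdorff measure and a point has at most four
   images in the level set, so infinitely many rotated copies with bounded
   overlap would exceed the finite measure of the sphere. *)
Require Import Defs.
From HB Require Import structures.
From mathcomp Require Import all_boot all_order all_algebra.
From mathcomp Require Import ring lra.
From mathcomp Require Import all_classical all_reals all_analysis.
From mathcomp Require Import measurable_realfun.
Import Order.TTheory GRing.Theory Num.Def Num.Theory.
Import numFieldNormedType.Exports.
Local Open Scope classical_set_scope.
Local Open Scope ring_scope.
Set Implicit Arguments.
Unset Strict Implicit.
Unset Printing Implicit Defensive.

(** * Hausdorff measure of subsets of the sphere *)

(** The Hausdorff measure comes from an outer measure, so each fact used about it (half spaces are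
    measurable, the sphere has finite measure, its nonempty relatively open subsets have positive
    measure) is extracted from covers.

    Passing from ln Z to [Psi] turns the dual problem into the minimisation of a plain exponential
    integral. Its convexity, strict convexity and first-order condition are then pointwise facts
    about exp (a midpoint identity, tangent lines, a quadratic upper bound) integrated against w_x,
    and no derivative is taken under the integral sign.

    The one integrand that need not be integrable is that of the free energy. Gibbs' inequality
    bounds it below by an integrable function, which excludes an indeterminate integral.

    The quotient f_Q / (Qp.p - eta) is not singular: the weight cancels and leaves exp(Lp.p) / Z on
    E_Q, a bounded function. Both formulas of the theorem are therefore the partial derivatives in x
    of l.Q - ln Z(l, x), taken at l = L. *)

Section hausdorff_lemmas.
Variable R : realType.
Implicit Types (A B U V : set 'cV[R]_3) (p q : 'cV[R]_3).

Lemma dotv_ge0 p : 0 <= dotv p p.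
Proof. by apply: sumr_ge0 => i _; rewrite -expr2 sqr_ge0. Qed.

Lemma sqr_enorm p : enorm p ^+ 2 = dotv p p.
Proof. by rewrite sqr_sqrtr// dotv_ge0. Qed.

Lemma enorm_ge0 p : 0 <= enorm p.
Proof. exact: sqrtr_ge0. Qed.

Lemma coord_le_enorm p i : `|p i 0| <= enorm p.
Proof.
rewrite -(@ler_pXn2r _ 2) ?nnegrE ?enorm_ge0// sqr_enorm.
rewrite real_normK ?num_real// /dotv (bigD1 i)//= -expr2 lerDl.
by apply: sumr_ge0 => j _; rewrite -expr2 sqr_ge0.
Qed.

Lemma coord_sphere p i : sphere p -> `|p i 0| <= 1.
Proof. by move=> <-; exact: coord_le_enorm. Qed.

Local Open Scope ereal_scope.

Lemma le_diam U V : U `<=` V -> diam U <= diam V.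
Proof.
move=> UV; rewrite /diam ge_max le_max lexx/= le_max; apply/orP; right.
by apply: ereal_sup_le => _ [p Up [q Uq <-]]; exists p; [exact: UV|exists q; [exact: UV|]].
Qed.

Lemma diam_ub U p q : U p -> U q -> (enorm (p - q)%R)%:E <= diam U.
Proof.
move=> Up Uq; rewrite /diam le_max; apply/orP; right.
by apply: ereal_sup_ubound; exists p => //; exists q.
Qed.

Lemma diam_le U (d : R) : (0 <= d)%R ->
  (forall p q, U p -> U q -> enorm (p - q)%R <= d)%R -> diam U <= d%:E.
Proof.
move=> d0 h; rewrite /diam ge_max lee_fin d0/=.
by apply: ge_ereal_sup => _ [p Up [q Uq <-]]; rewrite lee_fin h.
Qed.

Lemma le_hausdorff2_pre_d (d e : R) A : (d <= e)%R ->
  hausdorff2_pre e A <= hausdorff2_pre d A.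
Proof.
move=> de; apply: ereal_inf_le_tmp => _ [U [AU Ud] <-]; exists U => //.
by split=> // k; apply: le_trans (Ud k) _; rewrite lee_fin.
Qed.

(** A set of diameter at most d < t - s cannot meet both [A] and [B]. Every cover of the union thus
    splits into a cover of [A] and one of [B] that share no nonempty member. *)
Lemma hausdorff2_pre_separated i (s t d : R) A B :
  (forall p, A p -> p i 0 <= s)%R -> (forall p, B p -> t <= p i 0)%R ->
  (d < t - s)%R ->
  hausdorff2_pre d A + hausdorff2_pre d B <= hausdorff2_pre d (A `|` B).
Proof.
move=> As Bt dts; apply: le_ereal_inf_tmp => _ [U [ABU Ud] <-].
pose UA k := if pselect (U k `&` A !=set0) then U k else set0.
pose UB k := if pselect (U k `&` B !=set0) then U k else set0.
have UAd k : diam (UA k) <= d%:E.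
  by apply: le_trans (Ud k); apply: le_diam; rewrite /UA; case: pselect => /= _ p.
have UBd k : diam (UB k) <= d%:E.
  by apply: le_trans (Ud k); apply: le_diam; rewrite /UB; case: pselect => /= _ p.
apply: (@le_trans _ _ (\sum_(k <oo) hgauge (UA k) + \sum_(k <oo) hgauge (UB k))).
  apply: leeD; apply: ereal_inf_lbound.
    exists UA => //; split=> // p Ap; have [k _ Ukp] := ABU p (or_introl Ap).
    exists k => //; rewrite /UA; case: pselect => //= -[].
    by exists p.
  exists UB => //; split=> // p Ap; have [k _ Ukp] := ABU p (or_intror Ap).
  exists k => //; rewrite /UB; case: pselect => //= -[].
  by exists p.
rewrite -nneseriesD; [|by move=> *; exact: hgauge_ge0|by move=> *; exact: hgauge_ge0].
apply: lee_nneseries => [k _ _|k _].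
  by rewrite adde_ge0 ?hgauge_ge0.
rewrite /UA /UB; case: pselect => /= [[p [Up Ap]]|_]; last first.
  by rewrite hgauge0 add0e; case: pselect => /= _ //; rewrite hgauge0 hgauge_ge0.
case: pselect => /= [[q [Uq Bq]]|_]; last by rewrite hgauge0 adde0.
have := le_trans (diam_ub Uq Up) (Ud k); rewrite lee_fin => h.
have := le_trans (coord_le_enorm (q - p)%R i) h; rewrite !mxE => h'.
have := le_trans (ler_norm _) h'.
have := As p Ap; have := Bt q Bq => h1 h2 h3.
by exfalso; lra.
Qed.

Lemma hausdorff2_separated i (s t : R) A B :
  (forall p, A p -> p i 0 <= s)%R -> (forall p, B p -> t <= p i 0)%R ->
  (s < t)%R -> hausdorff2 A + hausdorff2 B <= hausdorff2 (A `|` B).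
Proof.
move=> As Bt st; have [->|Xoo] := eqVneq (hausdorff2 (A `|` B)) +oo.
  by rewrite leey.
have Xfin : hausdorff2 (A `|` B) \is a fin_num.
  by rewrite ge0_fin_numE ?hausdorff2_ge0// ltey.
have fin D : D `<=` A `|` B -> hausdorff2 D \is a fin_num.
  move=> DAB; rewrite ge0_fin_numE ?hausdorff2_ge0//.
  by apply: le_lt_trans (le_hausdorff2 DAB) _; rewrite ltey.
have finA := fin A (@subsetUl _ _ _); have finB := fin B (@subsetUr _ _ _).
(* The two suprema run over independent scales. A common scale [c], smaller than the gap, serves
   both because [hausdorff2_pre] grows as the scale shrinks. *)
have key (d e : R) : (0 < d)%R -> (0 < e)%R ->
    hausdorff2_pre d A + hausdorff2_pre e B <= hausdorff2 (A `|` B).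
  move=> d0 e0; pose c := minr (minr d e) ((t - s) / 2)%R.
  have c0 : (0 < c)%R by rewrite !lt_min d0 e0/=; lra.
  apply: le_trans (le_hausdorff2_pre_hausdorff2 _ c0).
  apply: le_trans (hausdorff2_pre_separated As Bt _).
    apply: leeD; apply: le_hausdorff2_pre_d; rewrite /c !ge_min lexx ?orbT//.
  have : (c <= (t - s) / 2)%R by rewrite /c ge_min lexx orbT.
  by move=> h; lra.
rewrite -leeBrDr//; apply: ge_ereal_sup => _ [d d0 <-].
rewrite leeBrDr// addeC -leeBrDr; last first.
  rewrite ge0_fin_numE ?hausdorff2_pre_ge0//.
  by apply: le_lt_trans (le_hausdorff2_pre_hausdorff2 _ d0) _; rewrite ltey_eq finA.
apply: ge_ereal_sup => _ [e e0 <-].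
rewrite leeBrDr; first by rewrite addeC; exact: key.
rewrite ge0_fin_numE ?hausdorff2_pre_ge0//.
by apply: le_lt_trans (le_hausdorff2_pre_hausdorff2 _ d0) _; rewrite ltey_eq finA.
Qed.

Lemma hausdorff2_subadditive A B :
  hausdorff2 (A `|` B) <= hausdorff2 A + hausdorff2 B.
Proof. exact: (outer_measureU2 (hausdorff2_outer R)). Qed.

(* Caratheodory's criterion for a half space: the slabs between consecutive
   levels c + 1/(k+1) have summable measure because the measure is additive on
   sets at positive distance. *)
Lemma measurable_halfspace i (c : R) :
  measurable ([set p | (p i 0 <= c)%R] : set (R3 R)).
Proof.
apply: (@le_caratheodory_measurable _ _ (hausdorff2_outer R)) => X.
rewrite /hausdorff2_outer/=.
set lo := X `&` _; set hi := X `&` _.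
have [->|Xoo] := eqVneq (hausdorff2 X) +oo; first by rewrite leey.
pose e n : R := (c + n.+1%:R^-1)%R.
have eS n : (e n.+1 < e n)%R.
  by rewrite /e ltrD2l ltf_pV2 ?posrE// ltr_nat.
have ec n : (c < e n)%R by rewrite /e ltrDl invr_gt0.
pose E n := X `&` [set p | (e n < p i 0)%R].
pose D n := X `&` [set p | (e n.+1 < p i 0 <= e n)%R].
have leEX n : hausdorff2 (E n) <= hausdorff2 X.
  by apply: le_hausdorff2; exact: subIsetl.
(* Between [D n.+1] and [E n] lies the slab [D n], which keeps them at positive distance. Skipping
   one slab at each step is why two consecutive [E] appear in the bound [sums]. *)
have step n : hausdorff2 (D n.+1) + hausdorff2 (E n) <= hausdorff2 (E n.+2).
  apply: le_trans (hausdorff2_separated (i := i) (s := e n.+1) (t := e n) _ _ _) _ => //.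
  - by move=> p [_ /andP[]].
  - by move=> p [_ /ltW].
  - apply: le_hausdorff2 => p -[[Xp /andP[h1 h2]]|[Xp h]]; split => //=.
    by apply: lt_trans h; exact: lt_trans (eS _) (eS _).
have sums n : \sum_(0 <= k < n) hausdorff2 (D k.+1) <= hausdorff2 (E n) + hausdorff2 (E n.+1).
  elim: n => [|n ih]; first by rewrite big_geq// adde_ge0 ?hausdorff2_ge0.
  rewrite big_nat_recr//=; apply: le_trans (leeD2r _ ih) _.
  by rewrite (addeC (hausdorff2 (E n))) -addeA (addeC (hausdorff2 (E n))) leeD.
have sumoo : \sum_(0 <= k <oo) hausdorff2 (D k.+1) < +oo.
  apply: (@le_lt_trans _ _ (hausdorff2 X + hausdorff2 X)).
    apply: lime_le; first by apply: is_cvg_nneseries => *; exact: hausdorff2_ge0.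
    by apply: nearW => n; apply: le_trans (sums n) _; exact: leeD.
  by rewrite lte_add_pinfty// ltey.
have hiE n : hausdorff2 hi <= hausdorff2 (E n) + \sum_(n <= k <oo) hausdorff2 (D k).
  apply: le_trans (_ : _ <= hausdorff2 (E n `|` \bigcup_(k in ~` `I_n) D k)) _.
    apply: le_hausdorff2 => p [Xp /= /negP]; rewrite -ltNge => cp.
    have [enp|enp] := ltP (e n) (p i 0%R); first by left.
    right.
    have [N [_ NP]] : exists N, (n <= N)%N /\ (e N < p i 0)%R.
      pose N := Num.truncn ((p i 0 - c)^-1)%R.
      exists (maxn n N); split; first exact: leq_maxl.
      rewrite /e -ltrBrDl invf_plt ?posrE ?subr_gt0//.
      apply: lt_le_trans (real_truncnS_gt (num_real _)) _.
      by rewrite ler_nat ltnS leq_maxr.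
    (* The least index m with [e m] below the coordinate places p in the slab [D m.-1]. *)
    have exP : exists N, (e N < p i 0)%R by exists N.
    have := ex_minnP exP; case=> m em mmin.
    have nm : (n < m)%N.
      rewrite ltnNge; apply/negP => mn.
      suff : (e n <= e m)%R by move=> h; have := lt_le_trans em (le_trans enp h); rewrite ltxx.
      by rewrite /e lerD2l lef_pV2 ?posrE// ler_nat ltnS.
    case: m em mmin nm => // m em mmin nm.
    exists m; first by apply/negP; rewrite -leqNgt.
    split=> //=; rewrite em/= leNgt; apply/negP => /mmin.
    by rewrite ltnn.
  apply: le_trans (hausdorff2_subadditive _ _) _; rewrite leeD2l//.
  exact: (outer_measure_sigma_subadditive_tail (hausdorff2_outer R)).
apply/lee_addgt0Pr => eps eps0.
have := nneseries_tail_cvg sumoo (fun k _ => hausdorff2_ge0 (D k.+1)).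
move/fine_cvgP => [finN cvN].
have [N _ /(_ N (leqnn _)) [fN lN]] : \forall n \near \oo,
    (\sum_(n <= k <oo) hausdorff2 (D k.+1) \is a fin_num /\
     `|0 - fine (\sum_(n <= k <oo) hausdorff2 (D k.+1))| < eps)%R.
  near=> n; split; near: n; first exact: finN.
  by move/cvgrPdist_lt : cvN; apply.
have tail : \sum_(N.+1 <= k <oo) hausdorff2 (D k) <= eps%:E.
  have -> : \sum_(N.+1 <= k <oo) hausdorff2 (D k) = \sum_(N <= k <oo) hausdorff2 (D k.+1).
    rewrite -nneseries_addn => [|k]; last exact: hausdorff2_ge0.
    rewrite -(nneseries_addn (f := fun k => hausdorff2 (D k.+1))) => [|k]; last exact: hausdorff2_ge0.
    by apply: eq_eseriesr => k _; rewrite addnS.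
  rewrite -(fineK fN) lee_fin; apply: le_trans (ler_norm _) _.
  by move: lN; rewrite sub0r normrN => /ltW.
apply: le_trans (leeD2l _ (hiE N.+1)) _.
rewrite addeA leeD//.
apply: le_trans (hausdorff2_separated (i := i) (s := c) (t := e N.+1) _ _ _) _ => //.
- by move=> p [].
- by move=> p [_ /ltW].
- by apply: le_hausdorff2 => p -[] [].
Unshelve. all: by end_near. Qed.

End hausdorff_lemmas.

(** * Coordinates on R^3, measurability of quadratic forms, finite covers *)

Section sphere_measure.
Variable R : realType.
Implicit Types (U V : set 'cV[R]_3) (p q : 'cV[R]_3).

(** Addition in ['I_3] is modulo 3, so i, i + 1, i + 1 + 1 enumerate the indices from any starting
    axis; this lets one coordinate be singled out without loss of generality. *)
Lemma sum3 (V : nmodType) (F : 'I_3 -> V) i :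
  \sum_j F j = F i + F (i + 1) + F (i + 1 + 1).
Proof.
rewrite !big_ord_recl big_ord0 addr0.
have [E0 E1 E2] : [/\ ord0 = inord 0 :> 'I_3, lift ord0 ord0 = inord 1 :> 'I_3 &
    lift ord0 (lift ord0 ord0) = inord 2 :> 'I_3].
  by split; apply: val_inj; rewrite /= inordK.
rewrite E2 E1 E0; case: i => [[|[|[|//]]] hi].
- have -> : Ordinal hi = inord 0 by apply: val_inj; rewrite /= inordK.
  have -> : inord 0 + 1 = inord 1 :> 'I_3 by apply: val_inj; rewrite /= !inordK.
  have -> : inord 1 + 1 = inord 2 :> 'I_3 by apply: val_inj; rewrite /= !inordK.
  by rewrite addrA.
- have -> : Ordinal hi = inord 1 by apply: val_inj; rewrite /= inordK.
  have -> : inord 1 + 1 = inord 2 :> 'I_3 by apply: val_inj; rewrite /= !inordK.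
  have -> : inord 2 + 1 = inord 0 :> 'I_3 by apply: val_inj; rewrite /= !inordK.
  by rewrite [RHS]addrC.
- have -> : Ordinal hi = inord 2 by apply: val_inj; rewrite /= inordK.
  have -> : inord 2 + 1 = inord 0 :> 'I_3 by apply: val_inj; rewrite /= !inordK.
  have -> : inord 0 + 1 = inord 1 :> 'I_3 by apply: val_inj; rewrite /= !inordK.
  by rewrite -[RHS]addrA [RHS]addrC -addrA.
Qed.

Lemma dotv3 p q i : dotv p q =
  p i 0 * q i 0 + p (i + 1) 0 * q (i + 1) 0 + p (i + 1 + 1) 0 * q (i + 1 + 1) 0.
Proof. exact: sum3. Qed.

Lemma sphereP p : sphere p <-> dotv p p = 1.
Proof.
rewrite -sqr_enorm; split => [->|/eqP]; first by rewrite expr1n.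
rewrite sqrf_eq1 => /orP[/eqP//|/eqP h].
by have := enorm_ge0 p; rewrite h ler0N1.
Qed.

Lemma quadE (A : 'M[R]_3) p : quad A p = \sum_i \sum_j A i j * (p i 0 * p j 0).
Proof.
apply: eq_bigr => i _; rewrite mxE mulr_suml; apply: eq_bigr => j _.
by rewrite -mulrA (mulrC (p j 0)).
Qed.

Lemma measurable_coord i : measurable_fun setT (fun p : R3 R => (p : 'cV[R]_3) i 0).
Proof.
apply: (measurability _ (measurable_realfun.RGenOInfty.measurableE R)) => _ [_ [x ->] <-].
rewrite setTI (_ : _ @^-1` _ = ~` [set p : R3 R | (p : 'cV[R]_3) i 0 <= x]).
  by apply: measurableC; exact: measurable_halfspace.
apply/seteqP; split=> p /=; rewrite in_itv/= andbT ltNge => /negP//.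
Qed.

Lemma measurable_quad (A : 'M[R]_3) : measurable_fun setT (fun p : R3 R => quad A p).
Proof.
under eq_fun do rewrite quadE.
apply: measurable_sum => i; apply: measurable_sum => j.
apply: (measurable_funM (f := fun=> A i j) (measurable_cst _)).
exact: (measurable_funM (measurable_coord i) (measurable_coord j)).
Qed.

Lemma measurable_sphere : measurable (@sphere R : set (R3 R)).
Proof.
have mf : measurable_fun setT (fun p : R3 R => quad 1%:M p) := measurable_quad _.
rewrite (_ : (@sphere R : set (R3 R)) = (fun p : R3 R => quad 1%:M p) @^-1` [set 1]).
  by rewrite -[_ @^-1` _]setTI; apply: mf => //; exact: measurable_set1.
apply/seteqP; split=> p; first by move/sphereP; rewrite /= /quad mul1mx.
by rewrite /= /quad mul1mx => h; apply/sphereP.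
Qed.

Local Open Scope ereal_scope.

Lemma hausdorff2_pre_le_hgauge (d : R) U : (0 < d)%R -> diam U <= d%:E ->
  hausdorff2_pre d U <= hgauge U.
Proof.
move=> d0 Ud; apply: ereal_inf_lbound.
exists (fun n : nat => if n is 0%N return set ('cV[R]_3) then U else set0).
  split=> [p Up|[|n]//]; first by exists 0%N.
  by rewrite diam_set0 lee_fin ltW.
rewrite nneseries_recl//; last by move=> *; exact: hgauge_ge0.
by rewrite eseries0 ?adde0// => -[|n]// _ _; rewrite hgauge0.
Qed.

Lemma hausdorff2_pre_bigsetU (d : R) I (s : seq I) (F : I -> set 'cV[R]_3) :
  (0 < d)%R -> (forall i, diam (F i) <= d%:E) ->
  hausdorff2_pre d (\big[setU/set0]_(i <- s) F i) <= \sum_(i <- s) hgauge (F i).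
Proof.
move=> d0 Fd; elim: s => [|i s ih]; first by rewrite !big_nil hausdorff2_pre_set0.
rewrite !big_cons; set W := \big[_/_]_(_ <- _) _ in ih *.
apply: le_trans (leeD (hausdorff2_pre_le_hgauge d0 (Fd i)) ih).
have := @hausdorff2_pre_sigma_subadditive R d (bigcup2 (F i) W).
rewrite bigcup2E => /le_trans; apply.
rewrite (nneseries_split 0 2); last by move=> *; exact: hausdorff2_pre_ge0.
rewrite add0n eseries0 => [|[|[|n]]// _ _]; last exact: hausdorff2_pre_set0.
by rewrite adde0 big_nat_recr//= big_nat1.
Qed.

End sphere_measure.

(** * The sphere has finite measure, its relatively open subsets positive measure *)

Section sphere_finite.
Variable R : realType.
Implicit Types (U V : set 'cV[R]_3) (p q : 'cV[R]_3).

Lemma enorm_le p (c : R) : 0 <= c -> dotv p p <= c ^+ 2 -> enorm p <= c.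
Proof.
by move=> c0 pc; rewrite -(@ler_pXn2r _ 2) ?nnegrE ?enorm_ge0// sqr_enorm.
Qed.

(* Where |p i| >= 1/2 the sphere is a Lipschitz graph over the other two
   coordinates, so a square cell of side 2/N has diameter at most 10/N. *)
Definition sphere_cell (N : nat) (x : bool * 'I_3 * ('I_N.+1 * 'I_N.+1)) : set 'cV[R]_3 :=
  let: (b, i, (a, c)) := x in
  [set p | [/\ sphere p, 1 / 2 <= (-1) ^+ b * p i 0,
    a%:R * (2 / N%:R) <= p (i + 1) 0 + 1 <= a%:R * (2 / N%:R) + 2 / N%:R &
    c%:R * (2 / N%:R) <= p (i + 1 + 1) 0 + 1 <= c%:R * (2 / N%:R) + 2 / N%:R]].

(** With h = 2/N, the two free coordinates vary by at most h, so the square of the remaining one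
    varies by at most 4h. In a cell that coordinate has constant sign and modulus at least 1/2, so
    |x + x'| >= 1 and |x - x'| <= 4h. The squared distance is then at most 18 h^2 <= (5h)^2. *)
Lemma diam_sphere_cell N x : (0 < N)%N ->
  (diam (@sphere_cell N x) <= (10 / N%:R)%:E)%E.
Proof.
move=> N0; have Np : 0 < N%:R :> R by rewrite ltr0n.
set h : R := 2 / N%:R.
have -> : 10 / N%:R = 5 * h :> R by rewrite /h; field; lra.
have h0 : 0 < h by rewrite divr_gt0.
apply: diam_le; first by rewrite mulr_ge0// ltW.
case: x => -[b i] [a c] p q /= [Sp bp ap cp] [Sq bq aq cq].
have {ap cp aq cq} : [/\ `|p (i + 1) 0 - q (i + 1) 0| <= h &
    `|p (i + 1 + 1) 0 - q (i + 1 + 1) 0| <= h].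
  rewrite -!/h in ap cp aq cq.
  by rewrite !ler_norml; split; lra.
have := coord_sphere (i + 1) Sp; have := coord_sphere (i + 1) Sq.
have := coord_sphere (i + 1 + 1) Sp; have := coord_sphere (i + 1 + 1) Sq.
move/sphereP : Sp; move/sphereP : Sq; rewrite !(dotv3 _ _ i).
move=> Sq Sp z'1 z1 y'1 y1 yz; apply: enorm_le; first by lra.
rewrite (dotv3 _ _ i) !mxE.
move: Sp Sq bp bq z'1 z1 y'1 y1 yz.
set x := p i 0; set x' := q i 0; set y := p (i + 1) 0; set y' := q (i + 1) 0.
set z := p (i + 1 + 1) 0; set z' := q (i + 1 + 1) 0.
move=> Sp Sq bp bq; rewrite !ler_norml => z'1 z1 y'1 y1 [yy zz].
have E : (x - x') * (x + x') = (y' - y) * (y' + y) + (z' - z) * (z' + z).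
  by apply/eqP; rewrite -subr_eq0 -(subrr (1 : R)) -{1}Sp -Sq; apply/eqP; ring.
have xx : `|x - x'| <= 4 * h.
  have s1 : 1 <= `|x + x'|.
    by move: bp bq; case: b; rewrite /= ?expr0 ?expr1 => bp bq; rewrite ler_normr; lra.
  apply: (@le_trans _ _ (`|x - x'| * `|x + x'|)).
    by rewrite ler_peMr.
  rewrite -normrM E; apply: le_trans (ler_normD _ _) _.
  have e1 : `|(y' - y) * (y' + y)| <= h * 2.
    by rewrite normrM ler_pM// ler_norml; lra.
  have e2 : `|(z' - z) * (z' + z)| <= h * 2.
    by rewrite normrM ler_pM// ler_norml; lra.
  lra.
have sq (u v : R) : `|u| <= v -> u * u <= v * v.
  by move=> uv; rewrite -!expr2 -(real_normK (num_real u)) ler_pXn2r ?nnegrE// (le_trans _ uv).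
have := sq _ _ xx.
have := sq (y - y') h; rewrite ler_norml => /(_ yy).
have := sq (z - z') h; rewrite ler_norml => /(_ zz).
nra.
Qed.

Lemma sphere_cover N : (0 < N)%N ->
  @sphere R `<=` \big[setU/set0]_(x <- index_enum [the finType of (bool * 'I_3 * ('I_N.+1 * 'I_N.+1))%type]) @sphere_cell N x.
Proof.
move=> N0 p Sp; have Np : 0 < N%:R :> R by rewrite ltr0n.
have h0 : 0 < 2 / N%:R :> R by rewrite divr_gt0.
(* Otherwise all three squares are below 1/4 and cannot add up to 1. *)
have [i [b hb]] : exists i, exists b : bool, 1 / 2 <= (-1) ^+ b * p i 0.
  apply: contrapT => /forallNP h.
  have c i : p i 0 * p i 0 < 1 / 4.
    have := h i => /forallNP hi; have := hi true; have := hi false.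
    rewrite expr0 expr1 => /negP; rewrite -ltNge => h1 /negP; rewrite -ltNge => h2.
    by nra.
  move/sphereP : Sp; rewrite (dotv3 _ _ 0).
  by have := c 0; have := c (0 + 1); have := c (0 + 1 + 1); lra.
have ex j : exists a : 'I_N.+1,
    a%:R * (2 / N%:R) <= p j 0 + 1 <= a%:R * (2 / N%:R) + 2 / N%:R.
  have := coord_sphere j Sp; rewrite ler_norml => /andP[p1 p2].
  have t0 : 0 <= (p j 0 + 1) / (2 / N%:R) by rewrite divr_ge0//; lra.
  have /andP[t1 t2] := truncn_itv t0; set a := Num.truncn _ in t1 t2.
  (* The endpoint [p j 0 = 1] gives a = N, which is why cells are indexed by ['I_N.+1]. *)
  have aN : (a < N.+1)%N.
    rewrite ltnS -(ler_nat R); apply: le_trans t1 _.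
    rewrite ler_pdivrMr//; have -> : N%:R * (2 / N%:R) = 2 :> R by field; lra.
    lra.
  exists (Ordinal aN) => /=; move: t1 t2; rewrite ler_pdivlMr// ltr_pdivrMr// => -> /=.
  by rewrite -natr1 mulrDl mul1r => /ltW.
have [a ha] := ex (i + 1); have [c hc] := ex (i + 1 + 1).
rewrite -bigcup_seq; exists (b, i, (a, c)); first by rewrite /= mem_index_enum.
by split.
Qed.

Local Open Scope ereal_scope.

Lemma hausdorff2_sphere_lty : hausdorff2 (@sphere R) < +oo.
Proof.
(* There are 6 (N + 1)^2 cells of gauge at most (pi/4) (10/N)^2. The total is 150 pi ((N + 1)/N)^2,
   and (N + 1)/N <= 2. *)
apply: (@le_lt_trans _ _ (600 * pi)%:E); last by rewrite ltry.
apply: ge_ereal_sup => _ [d d0 <-].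
pose n := Num.truncn (10 / d)%R; pose N := n.+1.
have Np : (0 < N%:R :> R)%R by rewrite ltr0n.
have dN : (10 / N%:R <= d)%R.
  rewrite ler_pdivrMr// mulrC -ler_pdivrMr//; apply: ltW.
  by rewrite /N; exact: real_truncnS_gt (num_real _).
have N0 : (0 < N)%N by [].
apply: le_trans (le_hausdorff2_pre d (sphere_cover N0)) _.
have cd x : diam (@sphere_cell N x) <= d%:E.
  by apply: le_trans (diam_sphere_cell x N0) _; rewrite lee_fin.
apply: le_trans (hausdorff2_pre_bigsetU _ d0 cd) _.
apply: (@le_trans _ _ (\sum_(x : bool * 'I_3 * ('I_N.+1 * 'I_N.+1)) (pi / 4 * (10 / N%:R) ^+ 2)%R%:E)).
  apply: lee_sum => x _; rewrite /hgauge [leRHS]EFinM.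
  apply: lee_wpmul2l; first by rewrite lee_fin divr_ge0 ?pi_ge0.
  by rewrite expe2 expr2 EFinM lee_pmul ?diam_ge0 ?diam_sphere_cell.
rewrite sumEFin lee_fin sumr_const !card_prod card_bool !card_ord.
rewrite -(mulr_natr _ (_ * _)%N) !natrM -(natr1 N).
have pi0 := @pi_ge0 R.
have -> : ((pi : R) / 4 * (10 / N%:R) ^+ 2 * (2 * 3 * ((N%:R + 1) * (N%:R + 1))) =
   pi * (150 * ((N%:R + 1) / N%:R) ^+ 2))%R by field; lra.
rewrite mulrC ler_wpM2r//.
have h1 : ((N%:R + 1) / N%:R <= 2 :> R)%R.
  rewrite ler_pdivrMr//; suff : (1 <= N%:R :> R)%R by lra.
  by rewrite ler1n.
have h2 : (0 <= (N%:R + 1) / N%:R :> R)%R by rewrite divr_ge0 ?addr_ge0.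
by nra.
Qed.

(** Projection to the coordinates j and k does not increase distances. A covering set of diameter d
    projects into a square of side 2d centred at the projection of one of its points, whose area 4
    d^2 is 16/pi times the gauge. Countable subadditivity of the plane Lebesgue measure then bounds
    the sum of the gauges below by the area of the box, up to that factor. *)
Lemma hausdorff2_gt0_proj (j k : 'I_3) V (a b r : R) : (0 < r)%R ->
  (forall x y, `|x - a| <= r -> `|y - b| <= r ->
     exists p, [/\ V p, p j 0 = x & p k 0 = y])%R ->
  0 < hausdorff2 V.
Proof.
move=> r0 ex.
have pi0 := pi_gt0 R.
apply: (@lt_le_trans _ _ (pi / 16 * (4 * r ^+ 2))%:E).
  by rewrite lte_fin; apply: mulr_gt0; [lra|rewrite mulr_gt0// exprn_gt0].
apply: le_trans (le_hausdorff2_pre_hausdorff2 _ (@ltr01 R)).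
apply: le_ereal_inf_tmp => _ [U [VU U1] <-].
have dfin n : diam (U n) = (fine (diam (U n)))%:E.
  by rewrite fineK// ge0_fin_numE ?diam_ge0//; apply: le_lt_trans (U1 n) _; rewrite ltry.
pose d n := fine (diam (U n)).
have d0 n : (0 <= d n)%R by rewrite fine_ge0 ?diam_ge0.
pose I (c e : R) : set (measurableTypeR R) := [set` `[(c - e)%R, (c + e)%R]].
have lI c e : (0 <= e)%R -> lebesgue_measure (I c e) = (2 * e)%R%:E.
  move=> e0; rewrite /I lebesgue_measure_itv/= lte_fin.
  case: ltP => h; first by rewrite -EFinB; congr EFin; ring.
  by congr EFin; lra.
pose c n := get (U n).
pose B n : set (measurableTypeR R * measurableTypeR R) :=
  if pselect (U n !=set0) then I (c n j 0%R) (d n) `*` I (c n k 0%R) (d n) else set0.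
pose l2 : {measure set _ -> \bar R} := (@lebesgue_measure R \x @lebesgue_measure R).
have mI c' e : measurable (I c' e) by exact: measurable_itv.
have l2I c1 c2 e : (0 <= e)%R -> l2 (I c1 e `*` I c2 e) = (2 * e * (2 * e))%R%:E.
  move=> e0; rewrite EFinM -{1}(lI c1 _ e0) -(lI c2 _ e0).
  exact: (product_measure1E lebesgue_measure lebesgue_measure (mI c1 e) (mI c2 e)).
have mB n : measurable (B n).
  rewrite /B; case: pselect => /= _ //; exact: measurableX.
have lB n : l2 (B n) <= (16 / pi)%:E * hgauge (U n).
  rewrite /hgauge muleA -EFinM (_ : 16 / pi * (pi / 4) = 4)%R; last by field; lra.
  rewrite /B; case: pselect => /= _; last first.
    by rewrite measure0 !mule_ge0 ?diam_ge0 ?lee_fin.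
  rewrite l2I// dfin -/(d n) -!EFinM lee_fin.
  by rewrite le_eqVlt; apply/orP; left; apply/eqP; ring.
have mbox : measurable (I a r `*` I b r) by exact: measurableX.
have : l2 (I a r `*` I b r) <= \sum_(n <oo) l2 (B n).
  apply: measure_sigma_subadditive => //.
  move=> [x y] [/=]; rewrite /I /= !in_itv/= => /andP[x1 x2] /andP[y1 y2].
  have [||p [Vp px py]] := ex x y; try by rewrite ler_norml; lra.
  have [n _ Up] := VU p Vp; exists n => //.
  rewrite /B; case: pselect => /= [Un0|[]]; last by exists p.
  have Uc : U n (c n) := getPex Un0.
  have pc i : (`|p i 0 - c n i 0| <= d n)%R.
    have := diam_ub Up Uc; rewrite dfin lee_fin; apply: le_trans.
    by have := coord_le_enorm (p - c n)%R i; rewrite !mxE.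
  have := pc j; have := pc k; rewrite px py !ler_norml => /andP[? ?] /andP[? ?].
  by split; rewrite /I /= in_itv/=; apply/andP; split; lra.
rewrite l2I; last exact: ltW.
move=> h.
have {}h : (4 * r ^+ 2)%:E <= (16 / pi)%:E * \sum_(n <oo) hgauge (U n).
  rewrite -nneseriesZl; last by move=> *; exact: hgauge_ge0.
  apply: le_trans (_ : \sum_(n <oo) l2 (B n) <= _).
    apply: le_trans h; rewrite lee_fin le_eqVlt; apply/orP; left.
    by apply/eqP; ring.
  by apply: lee_nneseries => n _ //; exact: lB.
rewrite EFinM.
have -> : \sum_(n <oo) hgauge (U n) =
    (pi / 16)%:E * ((16 / pi)%:E * \sum_(n <oo) hgauge (U n)).
  by rewrite muleA -EFinM (_ : pi / 16 * (16 / pi) = 1)%R ?mul1e//; field; lra.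
by apply: lee_wpmul2l => //; rewrite lee_fin; lra.
Qed.

Local Close Scope ereal_scope.

Lemma hausdorff2_gt0_sphere_ball p V (e : R) : sphere p -> (0 < e)%R ->
  (forall q, sphere q -> (forall i, `|q i 0 - p i 0| <= e)%R -> V q) ->
  (0 < hausdorff2 (@sphere R `&` V))%E.
Proof.
move=> Sp e0 hV.
have [i pi0] : exists i, p i 0 != 0%R.
  apply: contrapT => /forallNP h; move/sphereP : Sp.
  have z i : p i 0 = 0%R by apply: contrapT => /eqP; exact: h.
  by rewrite (dotv3 _ _ 0) !z !mul0r !addr0 => /esym/eqP; rewrite oner_eq0.
set x := `|p i 0|%R; have x0 : (0 < x)%R by rewrite normr_gt0.
(* Over a box of half-side r <= 1, the value s = 1 - a^2 - b^2 differs from x^2 by at most 6r. The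
   bound r <= x^2/12 keeps s positive, and r <= e x/6 keeps sqrt s within e of x. *)
pose r := minr (minr 1 e) (minr (e * x / 6) (x ^+ 2 / 12))%R.
have r0 : (0 < r)%R.
  by rewrite !lt_min ltr01 e0/= !divr_gt0// ?mulr_gt0// exprn_gt0.
have [r1 re rx rxx] : [/\ r <= 1, r <= e, r <= e * x / 6 & r <= x ^+ 2 / 12]%R.
  by rewrite /r; split; rewrite !ge_min lexx ?orbT.
apply: (@hausdorff2_gt0_proj (i + 1)%R (i + 1 + 1)%R _ (p (i + 1)%R 0%R) (p (i + 1 + 1)%R 0%R) r) => //.
move=> a b ar br.
have := coord_sphere (i + 1) Sp; have := coord_sphere (i + 1 + 1) Sp.
have := Sp => /sphereP; rewrite (dotv3 _ _ i).
have xE : (p i 0 * p i 0 = x ^+ 2)%R by rewrite /x real_normK ?num_real.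
rewrite xE; set y := p (i + 1) 0; set z := p (i + 1 + 1) 0 => Sxyz z1 y1.
have ya : (`|y * y - a * a| <= r * 3)%R.
  have -> : (y * y - a * a = (a - y) * (- (a - y) - 2 * y))%R by ring.
  rewrite normrM ler_pM//; apply: le_trans (ler_normD _ _) _.
  by rewrite !normrN normrM [in `|2|%R]ger0_norm//; lra.
have zb : (`|z * z - b * b| <= r * 3)%R.
  have -> : (z * z - b * b = (b - z) * (- (b - z) - 2 * z))%R by ring.
  rewrite normrM ler_pM//; apply: le_trans (ler_normD _ _) _.
  by rewrite !normrN normrM [in `|2|%R]ger0_norm//; lra.
set s := (1 - a * a - b * b)%R.
have sx : (`|s - x ^+ 2| <= 6 * r)%R.
  have -> : (s - x ^+ 2 = (y * y - a * a) + (z * z - b * b))%R by rewrite /s; lra.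
  by apply: le_trans (ler_normD _ _) _; lra.
have s0 : (0 < s)%R.
  have : (0 < x ^+ 2)%R by rewrite exprn_gt0.
  by move: sx; rewrite ler_norml => /andP[h1 h2]; lra.
pose t := Num.sqrt s; have t0 : (0 < t)%R by rewrite sqrtr_gt0.
have tt : (t * t = s)%R by rewrite -expr2 sqr_sqrtr ?ltW.
have tx : (`|t - x| <= e)%R.
  rewrite -(@ler_pM2r _ x)//; apply: (@le_trans _ _ (`|t - x| * `|t + x|)%R).
    by rewrite ler_wpM2l// ler_normr; apply/orP; left; lra.
  rewrite -normrM (_ : (t - x) * (t + x) = s - x ^+ 2)%R; last by rewrite -tt; ring.
  by apply: le_trans sx _; lra.
have i1i : (i + 1 == i :> 'I_3) = false.
  by rewrite -subr_eq0 (addrC i) addrK.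
have i2i : (i + 1 + 1 == i :> 'I_3) = false.
  by rewrite -subr_eq0 -(addrA i) (addrC i) addrK.
have i2i1 : (i + 1 + 1 == i + 1 :> 'I_3) = false.
  by rewrite -subr_eq0 (addrC (i + 1)) addrK.
pose q : 'cV[R]_3 := (\col_l if l == i then Num.sg (p i 0) * t else if l == (i + 1) then a else b)%R.
have qi : q i 0%R = (Num.sg (p i 0%R) * t)%R by rewrite mxE eqxx.
have qj : q (i + 1)%R 0%R = a by rewrite mxE i1i eqxx.
have qk : q (i + 1 + 1)%R 0%R = b by rewrite mxE i2i i2i1.
have Sq : sphere q.
  apply/sphereP; rewrite (dotv3 _ _ i) qi qj qk mulrACA tt -expr2 sqr_sg pi0 mul1r.
  by rewrite /s; ring.
exists q; split=> //; split=> //; apply: hV => // l.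
(* The indicators of l at the three indices add up to 1, so l is one of them. *)
have := @sum3 (GRing.Nmodule.clone _ nat) (fun j => (j == l)%:R) i.
rewrite (bigD1 l)//= eqxx big1 => [|m /negbTE ->//].
have [<- _|] := eqVneq i l.
  rewrite qi [in X in (_ - X)%R](numEsg (p i 0%R)) -mulrBr normrM.
  by rewrite normr_sg pi0 mul1r.
have [<- _ _|] := eqVneq (i + 1)%R l; first by rewrite qj; apply: le_trans ar _.
have [<- _ _ _|//] := eqVneq (i + 1 + 1)%R l; first by rewrite qk; apply: le_trans br _.
Qed.

End sphere_finite.

(** * Level sets of quadratic forms on the sphere *)

Section level_sets.
Variable R : realType.
Implicit Types (U V : set 'cV[R]_3) (p q : 'cV[R]_3) (A Q : 'M[R]_3) (i : 'I_3).

Lemma hausdorff2_image_le (g : 'cV[R]_3 -> 'cV[R]_3) V :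
  (forall p q, enorm (g p - g q) <= enorm (p - q)) ->
  (hausdorff2 (g @` V) <= hausdorff2 V)%E.
Proof.
move=> g1; apply: ge_ereal_sup => _ [d d0 <-].
apply: le_trans (le_hausdorff2_pre_hausdorff2 _ d0).
apply: le_ereal_inf_tmp => _ [U [VU Ud] <-].
have gd k : (diam (g @` U k) <= diam (U k))%E.
  rewrite {1}/diam ge_max diam_ge0/=; apply: ge_ereal_sup => _ [_ [p Up <-] [_ [q Uq <-] <-]].
  by apply: le_trans (diam_ub Up Uq); rewrite lee_fin.
apply: (@le_trans _ _ (\sum_(k <oo) hgauge (g @` U k))%E).
  apply: ereal_inf_lbound; exists (fun k => g @` U k) => //; split.
    by move=> _ [p /VU[k _ Up] <-]; exists k => //; exists p.
  by move=> k; exact: le_trans (gd k) (Ud k).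
apply: lee_nneseries => [k _ _|k _]; first exact: hgauge_ge0.
apply: lee_wpmul2l; first by rewrite lee_fin divr_ge0 ?pi_ge0.
by rewrite !expe2 lee_pmul ?diam_ge0.
Qed.

Lemma ord3_neq i : [/\ (i + 1 == i) = false, (i + 1 + 1 == i) = false &
  (i + 1 + 1 == i + 1) = false].
Proof.
split.
- by rewrite -subr_eq0 (addrC i) addrK.
- by rewrite -subr_eq0 -(addrA i) (addrC i) addrK.
- by rewrite -subr_eq0 (addrC (i + 1)) addrK.
Qed.

Lemma ord3_add3 (i : 'I_3) : i + 1 + 1 + 1 = i.
Proof.
have i0 : 1 + (1 + 1) = 0 :> 'I_3 by apply: val_inj.
by rewrite -!addrA i0 addr0.
Qed.

Lemma ord3_cases i j : [\/ j = i, j = i + 1 | j = i + 1 + 1].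
Proof.
have := @sum3 nat (fun l => nat_of_bool (l == j)) i.
rewrite (bigD1 j)//= eqxx big1 => [|m /negbTE ->//].
have [->|_] := eqVneq i j; first by constructor 1.
have [->|_] := eqVneq (i + 1) j; first by constructor 2.
by have [->|//] := eqVneq (i + 1 + 1) j; constructor 3.
Qed.

Lemma col3P i p q : p i 0 = q i 0 -> p (i + 1) 0 = q (i + 1) 0 ->
  p (i + 1 + 1) 0 = q (i + 1 + 1) 0 -> p = q.
Proof.
by move=> h0 h1 h2; apply/colP => j; case: (ord3_cases i j) => ->.
Qed.

Definition rot i (c s : R) : 'M[R]_3 := \matrix_(a, b)
  if a == i then (b == i)%:R
  else if a == i + 1 then (if b == i then 0 else if b == i + 1 then c else - s)
  else (if b == i then 0 else if b == i + 1 then s else c).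

Lemma rotE i c s p : [/\ (rot i c s *m p) i 0 = p i 0,
  (rot i c s *m p) (i + 1) 0 = c * p (i + 1) 0 - s * p (i + 1 + 1) 0 &
  (rot i c s *m p) (i + 1 + 1) 0 = s * p (i + 1) 0 + c * p (i + 1 + 1) 0].
Proof.
have [i1 i2 i3] := ord3_neq i.
split; rewrite mxE (sum3 _ i) !mxE !eqxx ?i1 ?i2 ?i3 /= ?mulr1n ?mulr0n; ring.
Qed.

Lemma rotK i (c s : R) p : c ^+ 2 + s ^+ 2 = 1 ->
  rot i c s *m (rot i c (- s) *m p) = p.
Proof.
move=> cs; have [e0 e1 e2] := rotE i c s (rot i c (- s) *m p).
have [f0 f1 f2] := rotE i c (- s) p.
apply: (@col3P i); rewrite ?e0 ?e1 ?e2 ?f0 ?f1 ?f2 //.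
- transitivity ((c ^+ 2 + s ^+ 2) * p (i + 1) 0); first by ring.
  by rewrite cs mul1r.
- transitivity ((c ^+ 2 + s ^+ 2) * p (i + 1 + 1) 0); first by ring.
  by rewrite cs mul1r.
Qed.

Lemma dotv_rot i (c s : R) p : c ^+ 2 + s ^+ 2 = 1 ->
  dotv (rot i c s *m p) (rot i c s *m p) = dotv p p.
Proof.
move=> cs; have [e0 e1 e2] := rotE i c s p.
rewrite !(dotv3 _ _ i) e0 e1 e2.
transitivity (p i 0 * p i 0 + (c ^+ 2 + s ^+ 2) * (p (i + 1) 0 * p (i + 1) 0 +
  p (i + 1 + 1) 0 * p (i + 1 + 1) 0)); first by ring.
by rewrite cs mul1r addrA.
Qed.

Lemma hausdorff2_rot i (c s : R) V : c ^+ 2 + s ^+ 2 = 1 ->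
  hausdorff2 [set p | V (rot i c s *m p)] = hausdorff2 V.
Proof.
move=> cs; have cs' : c ^+ 2 + (- s) ^+ 2 = 1 by rewrite sqrrN.
have iso (t : R) : c ^+ 2 + t ^+ 2 = 1 ->
    forall p q, enorm (rot i c t *m p - rot i c t *m q) <= enorm (p - q).
  by move=> ct p q; rewrite -mulmxBr /enorm dotv_rot.
apply/eqP; rewrite eq_le; apply/andP; split.
  rewrite (_ : [set p | _] = (fun p => rot i c (- s) *m p) @` V).
    by apply: hausdorff2_image_le; exact: iso.
  apply/seteqP; split=> [p /= Vp|_ [p Vp <-]]; last by rewrite /= rotK.
  by exists (rot i c s *m p) => //; rewrite -{2}[s]opprK rotK.
rewrite [in leLHS](_ : V = (fun p => rot i c s *m p) @` [set p | V (rot i c s *m p)]).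
  by apply: hausdorff2_image_le; exact: iso.
apply/seteqP; split=> [p Vp|_ [p Vp <-]//].
by exists (rot i c (- s) *m p); rewrite /= rotK.
Qed.

Lemma quadM (A P : 'M[R]_3) p : quad A (P *m p) = quad (P^T *m A *m P) p.
Proof.
have dE (u v : 'cV[R]_3) : dotv u v = (u^T *m v) 0 0.
  by rewrite mxE; apply: eq_bigr => j _; rewrite mxE.
by rewrite /quad !dE !trmx_mul !mulmxA trmxK.
Qed.

Lemma quad3 A p i : quad A p =
  A i i * p i 0 ^+ 2 + A (i + 1) (i + 1) * p (i + 1) 0 ^+ 2 +
  A (i + 1 + 1) (i + 1 + 1) * p (i + 1 + 1) 0 ^+ 2 +
  (A i (i + 1) + A (i + 1) i) * (p i 0 * p (i + 1) 0) +
  (A i (i + 1 + 1) + A (i + 1 + 1) i) * (p i 0 * p (i + 1 + 1) 0) +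
  (A (i + 1) (i + 1 + 1) + A (i + 1 + 1) (i + 1)) * (p (i + 1) 0 * p (i + 1 + 1) 0).
Proof. by rewrite quadE !(sum3 _ i); ring. Qed.

(** Half-angle parametrisation of the circle: trigonometric polynomials in the angle become rational
    functions of t, to which root counting applies. *)
Definition rcos (t : R) : R := (1 - t ^+ 2) / (1 + t ^+ 2).
Definition rsin (t : R) : R := 2 * t / (1 + t ^+ 2).

Lemma rcos2Drsin2 t : rcos t ^+ 2 + rsin t ^+ 2 = 1.
Proof.
by rewrite /rcos /rsin; field; have := sqr_ge0 t; rewrite expr2; lra.
Qed.

(* Along the orbit of p under rotations about the axis i, quad A - eta is the
   quotient of a quartic polynomial in t = tan(angle/2). *)
Lemma rot_level_le4 A (eta : R) i p (ts : seq R) :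
  (A (i + 1) (i + 1) != A (i + 1 + 1) (i + 1 + 1)) ||
  (A (i + 1) (i + 1 + 1) + A (i + 1 + 1) (i + 1) != 0) ->
  (p (i + 1) 0 != 0) || (p (i + 1 + 1) 0 != 0) ->
  uniq ts -> (forall t, t \in ts -> quad A (rot i (rcos t) (rsin t) *m p) = eta) ->
  (size ts <= 4)%N.
Proof.
set x := p i 0; set y := p (i + 1) 0; set z := p (i + 1 + 1) 0.
set jj := A (i + 1) (i + 1); set kk := A (i + 1 + 1) (i + 1 + 1).
set E := A _ _ + A _ _ => hA hp uts hts.
set m := A i (i + 1) + A (i + 1) i.
set n := A i (i + 1 + 1) + A (i + 1 + 1) i.
(* With c = [rcos t] and s = [rsin t], the rotated form minus eta equals K + al c + be s + a c^2 + b
   c s + e s^2. The polynomial [P] is this expression times (1 + t^2)^2. *)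
pose K := A i i * x ^+ 2 - eta.
pose al := x * (m * y + n * z); pose be := x * (n * y - m * z).
pose a := jj * y ^+ 2 + E * (y * z) + kk * z ^+ 2.
pose b := - 2 * jj * (y * z) + E * (y ^+ 2 - z ^+ 2) + 2 * kk * (y * z).
pose e := jj * z ^+ 2 - E * (y * z) + kk * y ^+ 2.
pose P : {poly R} := Poly [:: K + al + a; 2 * be + 2 * b; 2 * K - 2 * a + 4 * e;
  2 * be - 2 * b; K - al + a].
have PE t : P.[t] = (1 + t ^+ 2) ^+ 2 * (quad A (rot i (rcos t) (rsin t) *m p) - eta).
  have [e0 e1 e2] := rotE i (rcos t) (rsin t) p.
  rewrite horner_Poly (quad3 _ _ i) e0 e1 e2 -/x -/y -/z -/jj -/kk -/E -/m -/n /=.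
  rewrite /K /al /be /a /b /e /rcos /rsin; field.
  by have := sqr_ge0 t; rewrite expr2; lra.
have P0 : P != 0.
  apply/eqP => P0.
  have c k : [:: K + al + a; 2 * be + 2 * b; 2 * K - 2 * a + 4 * e;
      2 * be - 2 * b; K - al + a]`_k = 0 by rewrite -coef_Poly -/P P0 coef0.
  have /= c0 := c 0%N; have /= c1 := c 1%N; have /= c2 := c 2%N.
  have /= c3 := c 3%N; have /= c4 := c 4%N.
  have b0 : b = 0 by lra.
  have ae : a - e = 0 by lra.
  have E1 : (jj - kk) * (y ^+ 2 - z ^+ 2) + E * (2 * (y * z)) = 0.
    by rewrite -ae /a /e; ring.
  have E2 : - (jj - kk) * (2 * (y * z)) + E * (y ^+ 2 - z ^+ 2) = 0.
    by rewrite -b0 /b; ring.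
  (* In complex terms a - e + ib = (jj - kk + iE)(y - iz)^2, and this is its squared modulus. *)
  have : ((jj - kk) ^+ 2 + E ^+ 2) * (y ^+ 2 + z ^+ 2) ^+ 2 = 0.
    transitivity (((jj - kk) * (y ^+ 2 - z ^+ 2) + E * (2 * (y * z))) ^+ 2 +
      (- (jj - kk) * (2 * (y * z)) + E * (y ^+ 2 - z ^+ 2)) ^+ 2); first by ring.
    by rewrite E1 E2 !expr0n addr0.
  move/eqP; rewrite mulf_eq0 expf_eq0/= !paddr_eq0 ?sqr_ge0// !sqrf_eq0 subr_eq0.
  by case/orP => /andP[/negPn h1 /negPn h2]; [move: hA|move: hp];
    rewrite (negbTE h1) (negbTE h2).
have := max_poly_roots P0 _ uts.
have -> : all (root P) ts.
  by apply/allP => t /hts ht; rewrite /root PE ht subrr mulr0.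
move=> /(_ isT) h; rewrite -ltnS; apply: leq_trans h _.
exact: size_Poly.
Qed.

Lemma measurable_quad_eq A (eta : R) :
  measurable ([set p | quad A p = eta] : set (R3 R)).
Proof.
rewrite (_ : [set p | _] = (fun p : R3 R => quad A p) @^-1` [set eta])//.
by rewrite -[_ @^-1` _]setTI; apply: measurable_quad => //; exact: measurable_set1.
Qed.

Lemma measurable_coord_eq0 i : measurable ([set p | p i 0 = 0] : set (R3 R)).
Proof.
rewrite -[X in measurable X]setTI.
exact: (measurable_coord i measurableT (measurable_set1 0)).
Qed.

Lemma hausdorff2_set1 p : hausdorff2 [set p] = 0%E.
Proof.
have d0 : diam [set p] = 0%E.
  apply/eqP; rewrite eq_le diam_ge0 andbT; apply: diam_le => // _ _ -> ->.
  by rewrite subrr /enorm /dotv big1 ?sqrtr0// => i _; rewrite mxE mul0r.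
apply/eqP; rewrite eq_le hausdorff2_ge0 andbT.
apply: ge_ereal_sup => _ [d dp <-].
apply: le_trans (hausdorff2_pre_le_hgauge dp _) _.
  by rewrite d0 lee_fin ltW.
by rewrite /hgauge d0 expe2 !mule0.
Qed.

Lemma hausdorff2_level0 A (eta : R) i :
  (A (i + 1) (i + 1) != A (i + 1 + 1) (i + 1 + 1)) ||
  (A (i + 1) (i + 1 + 1) + A (i + 1 + 1) (i + 1) != 0) ->
  hausdorff2 (@sphere R `&` [set p | quad A p = eta]) = 0%E.
Proof.
move=> hA.
(* The axis is fixed pointwise by the rotations, so no point of it can satisfy a bound on the number
   of returns. It is cut out here; it meets the sphere only in [e] and [- e], which are null. *)
pose Z : set (R3 R) := [set p | p (i + 1) 0 = 0] `&` [set p | p (i + 1 + 1) 0 = 0].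
have mZ : measurable Z by apply: measurableI; exact: measurable_coord_eq0.
pose M (k : nat) := rot i (rcos k%:R) (rsin k%:R).
pose N (k : nat) : set (R3 R) := @sphere R `&` [set p | quad ((M k)^T *m A *m M k) p = eta] `\` Z.
have mN k : measurable (N k).
  apply: measurableD => //; apply: measurableI; first exact: measurable_sphere.
  exact: measurable_quad_eq.
pose N0 : set 'cV[R]_3 := @sphere R `&` [set p | quad A p = eta] `\` Z.
have NE k : hausdorff2 (N k) = hausdorff2 N0.
  rewrite -(hausdorff2_rot i N0 (rcos2Drsin2 k%:R)); congr hausdorff2.
  have cs := rcos2Drsin2 (k%:R : R).
  have ZM p : Z (M k *m p) <-> Z p.
    have [_ e1 e2] := rotE i (rcos (k%:R : R)) (rsin k%:R) p.
    rewrite /Z /= e1 e2; split => -[z1 z2]; last by rewrite z1 z2; split; ring.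
    set c := rcos _ in cs z1 z2; set s := rsin _ in cs z1 z2.
    set y := p (i + 1) 0 in z1 z2 *; set z := p (i + 1 + 1) 0 in z1 z2 *.
    split.
      have : (c ^+ 2 + s ^+ 2) * y = c * (c * y - s * z) + s * (s * y + c * z) by ring.
      by rewrite cs z1 z2 mul1r !mulr0 addr0.
    have : (c ^+ 2 + s ^+ 2) * z = c * (s * y + c * z) - s * (c * y - s * z) by ring.
    by rewrite cs z1 z2 mul1r !mulr0 subr0.
  have SM p : sphere (M k *m p) <-> sphere p.
    by rewrite !sphereP dotv_rot.
  apply/seteqP; split=> p [[/= Sp qp] nZ].
    split; last by move/ZM.
    by split; [exact/SM|rewrite /= quadM].
  split; last by move/ZM.
  by split; [exact/SM|rewrite /= -quadM].
have mS : measurable (@sphere R : set (R3 R)) := @measurable_sphere R.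
have mi k : measurable_fun setT (fun p : R3 R => (\1_(N k) p : R)%:E).
  by apply/measurable_EFinP; exact: measurable_indic.
have mi' : measurable_fun setT (fun p : R3 R => (\1_(@sphere R) p : R)%:E).
  by apply/measurable_EFinP; exact: measurable_indic.
have i0 (B : set (R3 R)) p : (0 <= (\1_B p : R)%:E)%E by rewrite lee_fin.
(* The n rotated copies have equal measure and no point lies in more than four of them; integrating
   the sum of their indicators compares n times that measure with four times the measure of the
   sphere. *)
have cnt n : (n%:R%:E * hausdorff2 N0 <= 4%:R%:E * hausdorff2 (@sphere R))%E.
  have -> : (n%:R%:E * hausdorff2 N0 = \int[H2 R]_p (\sum_(k <- iota 0 n) (\1_(N k) p)%:E))%E.
    rewrite (ge0_integral_sum (H2 R) measurableT mi (fun k p _ => i0 (N k) p)).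
    rewrite (eq_bigr (fun=> hausdorff2 N0)); last first.
      by move=> k _; rewrite integral_indic// setIT; exact: NE.
    rewrite -[in LHS](size_iota 0 n); elim: (iota 0 n) => [|k s ih].
      by rewrite big_nil mul0e.
    by rewrite big_cons -ih /= -nat1r EFinD ge0_muleDl ?lee_fin// mul1e.
  have -> : (4%:R%:E * hausdorff2 (@sphere R) = \int[H2 R]_p (4%:R%:E * (\1_(@sphere R) p)%:E))%E.
    rewrite (ge0_integralZl (H2 R) measurableT mi' (fun p _ => i0 _ p)) ?lee_fin//.
    by rewrite integral_indic ?setIT.
  apply: ge0_le_integral.
  - exact: measurableT.
  - by move=> p _; apply: sume_ge0 => k _; exact: i0.
  - by apply: emeasurable_sum => k; exact: mi.
  - by apply: measurable_funeM; exact: mi'.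
  move=> p _; rewrite sumEFin -EFinM lee_fin.
  have [Sp|nSp] := pselect (sphere p); last first.
    rewrite big1 ?mulr_ge0// => k _; rewrite indicE memNset// => -[[]].
    by [].
  rewrite [in leRHS]indicE mem_set// mulr1.
  have -> : \sum_(k <- iota 0 n) (\1_(N k) p : R) = (\sum_(k <- iota 0 n | p \in N k) 1)%N%:R.
    by rewrite natr_sum [RHS]big_mkcond; apply: eq_bigr => k _; rewrite indicE; case: ifP.
  rewrite ler_nat sum1_count -size_filter.
  have [->//|] := eqVneq [seq x <- iota 0 n | p \in N x] [::].
  case E : [seq _ <- _ | _] => [//|k0 ks] _; rewrite -E.
  rewrite -(size_map (fun k => k%:R : R)).
  apply: (@rot_level_le4 A eta i p) => //.
  + have : k0 \in [seq x <- iota 0 n | p \in N x] by rewrite E mem_head.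
    rewrite mem_filter => /andP[/set_mem[_ nZ] _].
    rewrite -negb_and; apply/negP => /andP[/eqP z1 /eqP z2]; exact: nZ.
  + rewrite map_inj_uniq ?filter_uniq ?iota_uniq// => k k' /eqP.
    by rewrite eqr_nat => /eqP.
  + move=> _ /mapP[k + ->]; rewrite mem_filter => /andP[/set_mem[[_ qk] _] _].
    by rewrite quadM.
have Sfin : hausdorff2 (@sphere R) \is a fin_num.
  by rewrite ge0_fin_numE ?hausdorff2_ge0// hausdorff2_sphere_lty.
have Nfin : hausdorff2 N0 \is a fin_num.
  rewrite ge0_fin_numE ?hausdorff2_ge0//; apply: le_lt_trans (hausdorff2_sphere_lty R).
  by apply: le_hausdorff2 => p [[]].
have N00 : hausdorff2 N0 = 0%E.
  apply/eqP; rewrite eq_le hausdorff2_ge0 andbT.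
  rewrite -(fineK Nfin) lee_fin leNgt; apply/negP => x0.
  set x := fine _ in x0; set m := fine (hausdorff2 (@sphere R)).
  have := cnt (Num.truncn (4%:R * m / x)).+1.
  rewrite -(fineK Nfin) -(fineK Sfin) -!EFinM lee_fin -/x -/m leNgt => /negP; apply.
  by rewrite -ltr_pdivrMr//; exact: real_truncnS_gt (num_real _).
pose e := (\col_l (l == i)%:R : 'cV[R]_3).
apply/eqP; rewrite eq_le hausdorff2_ge0 andbT.
apply: (@le_trans _ _ (hausdorff2 (N0 `|` ([set e] `|` [set - e])))).
  apply: le_hausdorff2 => p [Sp qp].
  have [[z1 z2]|nZ] := pselect (Z p); last by left.
  have [i1 i2 _] := ord3_neq i.
  right; move/sphereP : Sp; rewrite (dotv3 _ _ i) z1 z2 !mul0r !addr0 => /eqP.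
  rewrite -expr2 sqrf_eq1 => /orP[] /eqP h; [left|right]; apply: (@col3P i);
    by rewrite !mxE ?eqxx ?i1 ?i2/= ?oppr0.
apply: le_trans (hausdorff2_subadditive _ _) _; rewrite N00 add0e.
by apply: le_trans (hausdorff2_subadditive _ _) _; rewrite !hausdorff2_set1 adde0.
Qed.

(** An axis is usable as soon as the form is not a multiple of the identity on the orthogonal plane.
    If no coordinate axis were usable, Q would be a multiple of the identity, hence 0 by its trace.
    For Q = 0 the hypothesis reads eta < 0 and the level set is empty. *)
Lemma hausdorff2_level_eq0 (Q : sym0 R) (eta : R) : eta < `|Q| ^+ 2 ->
  hausdorff2 (@sphere R `&` [set p | quad Q p = eta]) = 0%E.
Proof.
move=> Qeta; have [Q0|Q0] := eqVneq Q 0.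
  rewrite (_ : _ `&` _ = set0) ?hausdorff2_set0//; apply/seteqP; split=> // p [_ /=].
  move: Qeta; rewrite Q0 normr0 expr0n/= {Q0} => eta0.
  by rewrite /quad/= mul0mx /dotv big1 => [e0|j _]; [lra|rewrite mxE mul0r].
have [i hi] : exists i, (Q (i + 1) (i + 1) != Q (i + 1 + 1) (i + 1 + 1)) ||
  (Q (i + 1) (i + 1 + 1) + Q (i + 1 + 1) (i + 1) != 0).
  apply: contrapT => /forallNP h; move/negP : Q0; apply; apply/eqP.
  have /andP[/eqP sQ /eqP tQ] := valP Q.
  have QC a b : Q a b = Q b a by have /matrixP/(_ b a) := sQ; rewrite mxE.
  clear sQ.
  have {}h i : Q (i + 1) (i + 1) = Q (i + 1 + 1) (i + 1 + 1) /\
     Q (i + 1) (i + 1 + 1) = 0.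
    have /negP := h i; rewrite negb_or !negbK => /andP[/eqP -> /eqP].
    by rewrite (QC (i + 1 + 1)) => q; split=> //; lra.
  have Qd i : Q i (i + 1) = 0 by have [_] := h (i + 1 + 1); rewrite ord3_add3.
  have Qdd i : Q i i = 0.
    move: tQ; rewrite /mxtrace (sum3 _ i).
    have [h1 _] := h i; have [h2 _] := h (i + 1 + 1); rewrite ord3_add3 in h2.
    by rewrite -h1 -h2; lra.
  apply: val_inj; apply/matrixP => a b; rewrite [RHS]mxE.
  case: (ord3_cases a b) => ->; [exact: Qdd|exact: Qd|].
  by rewrite QC; have := Qd (a + 1 + 1); rewrite ord3_add3.
exact: hausdorff2_level0 hi.
Qed.

End level_sets.

(** * Diagonalisation and physical tensors *)

Section symmetric_matrices.
Variable R : realType.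
Implicit Types (p q v : 'cV[R]_3) (A B P U D : 'M[R]_3) (i j : 'I_3).

Lemma dotvE p q : dotv p q = (p^T *m q) 0 0.
Proof. by rewrite mxE; apply: eq_bigr => j _; rewrite mxE. Qed.

Lemma dotvC p q : dotv p q = dotv q p.
Proof. by apply: eq_bigr => i _; rewrite mulrC. Qed.

Lemma dotvDl p q v : dotv (p + q) v = dotv p v + dotv q v.
Proof. by rewrite -big_split; apply: eq_bigr => i _; rewrite mxE mulrDl. Qed.

Lemma dotvZl (t : R) p v : dotv (t *: p) v = t * dotv p v.
Proof. by rewrite mulr_sumr; apply: eq_bigr => i _; rewrite mxE mulrA. Qed.

Lemma dotvDr p q v : dotv v (p + q) = dotv v p + dotv v q.
Proof. by rewrite dotvC dotvDl !(dotvC v). Qed.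

Lemma dotvZr (t : R) p v : dotv v (t *: p) = t * dotv v p.
Proof. by rewrite dotvC dotvZl dotvC. Qed.

Lemma dotv_eq0 p : dotv p p = 0 -> p = 0.
Proof.
move=> /eqP; rewrite psumr_eq0 => [/allP h|i _]; last by rewrite -expr2 sqr_ge0.
apply/colP => i; have := h i; rewrite mem_index_enum => /(_ isT)/=.
by rewrite mulf_eq0 orbb mxE => /eqP.
Qed.

Lemma dotv_mul_sym A p q : A^T = A -> dotv (A *m p) q = dotv p (A *m q).
Proof. by move=> sA; rewrite !dotvE trmx_mul sA mulmxA. Qed.

Lemma quad_min A : exists2 p, sphere p & forall q, sphere q -> quad A p <= quad A q.
Proof.
have sc (B : 'M[R]_3) : continuous (fun w : 'rV[R]_3 => quad B w^T).
  have -> : (fun w : 'rV[R]_3 => quad B w^T) =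
      (fun w => \sum_i \sum_j B i j * (w 0 i * w 0 j)).
    apply/funext => w; rewrite quadE; apply: eq_bigr => i _; apply: eq_bigr => j _.
    by rewrite !mxE.
  apply: continuous_big => [|i _]; first exact: add_continuous.
  apply: continuous_big => [|j _ w]; first exact: add_continuous.
  exact: (cvgM (cvg_cst _) (cvgM (@coord_continuous R _ _ 0 i w) (@coord_continuous R _ _ 0 j w))).
pose K := [set w : 'rV[R]_3 | quad 1%:M w^T = 1].
have KS w : K w <-> sphere w^T by rewrite /K /= /quad mul1mx sphereP.
have cK : compact K.
  apply: bounded_closed_compact.
    exists 1; split; first exact: num_real.
    move=> M M1 w /KS Sw; apply: le_trans (ltW M1).
    rewrite [leLHS]/normr/= mx_normrE; apply: bigmax_le => // -[a b] _ /=.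
    by rewrite (ord1 a); have := coord_sphere b Sw; rewrite mxE.
  rewrite (_ : K = (fun w => quad 1%:M w^T) @^-1` [set 1])//.
  by apply: closed_comp => [w _|]; [exact: sc|exact: closed_eq].
have K0 : K !=set0.
  exists (\row_j (j == 0)%:R); apply/KS/sphereP.
  by rewrite (dotv3 _ _ 0) !mxE /= mulr1 !mulr0 !addr0.
have [w wK wmin] := compact_EVT_min K0 cK (continuous_subspaceT (sc A)).
exists w^T => [|q Sq]; first by apply/KS; exact: set_mem.
have := wmin q^T; rewrite trmxK; apply.
by apply/mem_set/KS; rewrite trmxK.
Qed.

Lemma quad_ge A (m : R) : (forall p, sphere p -> m <= quad A p) ->
  forall v, m * dotv v v <= quad A v.
Proof.
move=> hm v; have [v0|v0] := eqVneq (dotv v v) 0.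
  by rewrite v0 mulr0 (dotv_eq0 v0) /quad mulmx0 /dotv big1// => i _; rewrite mxE mul0r.
have vp : 0 < dotv v v by rewrite lt_neqAle eq_sym v0 dotv_ge0.
have ev : enorm v != 0 by rewrite sqrtr_eq0 -ltNge.
have := hm ((enorm v)^-1 *: v).
have -> : quad A ((enorm v)^-1 *: v) = (dotv v v)^-1 * quad A v.
  by rewrite /quad -scalemxAr dotvZl dotvZr mulrA -expr2 exprVn sqr_enorm.
rewrite mulrC ler_pdivlMr//; apply; apply/sphereP.
by rewrite dotvZl dotvZr mulrA -expr2 exprVn sqr_enorm mulVf.
Qed.

(** Perturb p along the residual v = Ap - mp. The nonnegative form quad A - m |.|^2 takes the value
    2t|v|^2 + t^2 k at p + tv. At t = -|v|^2/(k + 1) this is -|v|^4 (k + 2)/(k + 1)^2, which forces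
    v = 0. *)
Lemma quad_min_eigen A p : A^T = A -> sphere p ->
  (forall q, sphere q -> quad A p <= quad A q) -> A *m p = quad A p *: p.
Proof.
move=> sA Sp /quad_ge; set m := quad A p => hm.
set v := A *m p - m *: p; apply/eqP; rewrite -subr_eq0 -/v; apply/eqP.
have vE : dotv v v = dotv (A *m p) v - m * dotv p v.
  by rewrite {1}/v -scaleN1r dotvDl dotvZl dotvZl mulN1r.
clearbody v; pose k := quad A v - m * dotv v v.
have k0 : 0 <= k by rewrite subr_ge0.
have pos t : 0 <= 2 * t * dotv v v + t ^+ 2 * k.
  have := hm (p + t *: v); rewrite -subr_ge0; congr (_ <= _).
  have pp : dotv p p = 1 by apply/sphereP.
  rewrite /quad mulmxDr -scalemxAr !dotvDl !dotvDr !dotvZl !dotvZr.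
  rewrite (dotv_mul_sym v p sA) (dotvC v (A *m p)) (dotvC v p) pp -[dotv (A *m p) p]/m.
  by rewrite /k -[dotv (A *m v) v]/(quad A v) vE; ring.
apply: dotv_eq0; have := pos (- dotv v v / (k + 1)).
set c := dotv v v => h.
have c0 : 0 <= c by exact: dotv_ge0.
clear sA.
have k1 : 0 < k + 1 by lra.
have : 0 <= c ^+ 2 * (- (k + 2)).
  have : 0 <= (2 * (- c / (k + 1)) * c + (- c / (k + 1)) ^+ 2 * k) * (k + 1) ^+ 2.
    by rewrite mulr_ge0 ?exprn_ge0// ltW.
  congr (_ <= _); field; lra.
move=> h'; apply/eqP; rewrite -sqrf_eq0 eq_le sqr_ge0 andbT.
by have := sqr_ge0 c; have := mulr_ge0 (sqr_ge0 c) k0; nra.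
Qed.

Definition cross p q : 'cV[R]_3 :=
  \col_l (p (l + 1) 0 * q (l + 1 + 1) 0 - p (l + 1 + 1) 0 * q (l + 1) 0).

Lemma dotv_crossl p q : dotv p (cross p q) = 0.
Proof. by rewrite (dotv3 _ _ 0) !mxE !ord3_add3; ring. Qed.

Lemma dotv_crossr p q : dotv q (cross p q) = 0.
Proof. by rewrite (dotv3 _ _ 0) !mxE !ord3_add3; ring. Qed.

Lemma dotv_cross p q :
  dotv (cross p q) (cross p q) = dotv p p * dotv q q - dotv p q ^+ 2.
Proof. by rewrite !(dotv3 _ _ 0) !mxE !ord3_add3; ring. Qed.

Definition mxcols (c : 'I_3 -> 'cV[R]_3) : 'M[R]_3 := \matrix_(a, b) c b a 0.

Lemma mxcolsE c A i j : ((mxcols c)^T *m A *m mxcols c) i j = dotv (c i) (A *m c j).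
Proof.
rewrite -mulmxA dotvE !mxE; apply: eq_bigr => a _; rewrite !mxE; congr (_ * _).
by apply: eq_bigr => b _; rewrite !mxE.
Qed.

(** A minimiser and a maximiser of the form on the sphere are eigenvectors. If the extreme values
    agree, every unit vector is an eigenvector and the standard basis works. Otherwise the two are
    orthogonal and their cross product completes the frame; each off-diagonal entry involves one of
    the two eigenvectors, so nothing has to be known about the third. *)
Lemma sym_diagonalizable A : A^T = A -> exists2 P : 'M[R]_3,
  P^T *m P = 1%:M & forall i j, i != j -> (P^T *m A *m P) i j = 0.
Proof.
move=> sA.
have [e1 S1 min1] := quad_min A; have E1 := quad_min_eigen sA S1 min1.
have [e3 S3 min3] := quad_min (- A).
have sNA : (- A)^T = - A by rewrite linearN/= sA.
have E3 : A *m e3 = quad A e3 *: e3.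
  have := quad_min_eigen sNA S3 min3; rewrite /quad !mulNmx -scaleN1r dotvZl mulN1r.
  by rewrite scaleN1r scaleNr => /oppr_inj.
have max3 q : sphere q -> quad A q <= quad A e3.
  by move=> /min3; rewrite /quad !mulNmx -!(scaleN1r (A *m _)) !dotvZl !mulN1r lerN2.
have [m13|m13] := eqVneq (quad A e1) (quad A e3).
  exists 1%:M => [|i j ij]; first by rewrite trmx1 mulmx1.
  rewrite trmx1 mul1mx mulmx1.
  pose v : 'cV[R]_3 := \col_l (l == j)%:R.
  have Sv : sphere v.
    apply/sphereP; rewrite /dotv (bigD1 j)//= big1 => [|k /negbTE kj].
      by rewrite mxE eqxx addr0 mulr1.
    by rewrite mxE kj mul0r.
  have : A *m v = quad A v *: v.
    apply: quad_min_eigen => // q Sq; apply: le_trans (min1 q Sq).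
    by rewrite m13; exact: max3.
  move/colP => /(_ i); rewrite !mxE (negbTE ij) mulr0 (bigD1 j)//= big1 => [|k /negbTE kj].
    by rewrite mxE eqxx mulr1 addr0.
  by rewrite mxE kj mulr0.
have e13 : dotv e1 e3 = 0.
  have : quad A e1 * dotv e1 e3 = quad A e3 * dotv e1 e3.
    by rewrite -dotvZl -E1 dotv_mul_sym// E3 dotvZr.
  by move/eqP; rewrite -subr_eq0 -mulrBl mulf_eq0 subr_eq0 (negbTE m13) => /eqP.
pose e2 := cross e1 e3.
have e12 : dotv e1 e2 = 0 by exact: dotv_crossl.
have e32 : dotv e3 e2 = 0 by exact: dotv_crossr.
have e22 : dotv e2 e2 = 1.
  by rewrite dotv_cross e13 (sphereP _).1// (sphereP _).1// mulr1 expr0n subr0.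
pose c (b : 'I_3) := if b == 0 then e1 else if b == 0 + 1 then e2 else e3.
have [n1 n2 n3] := ord3_neq (0 : 'I_3).
have c0 : c 0 = e1 by rewrite /c eqxx.
have c1 : c (0 + 1) = e2 by rewrite /c n1 eqxx.
have c2 : c (0 + 1 + 1) = e3 by rewrite /c n2 n3.
have s1 : dotv e1 e1 = 1 by apply/sphereP.
have s3 : dotv e3 e3 = 1 by apply/sphereP.
exists (mxcols c).
  apply/matrixP => i j.
  have -> : ((mxcols c)^T *m mxcols c) i j = dotv (c i) (c j).
    by have := mxcolsE c 1%:M i j; rewrite mulmx1 mul1mx.
  rewrite mxE; have e21 : dotv e2 e1 = 0 by rewrite dotvC.
  have e23 : dotv e2 e3 = 0 by rewrite dotvC.
  have e31 : dotv e3 e1 = 0 by rewrite dotvC.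
  case: (ord3_cases 0 i) => ->; case: (ord3_cases 0 j) => ->;
    by rewrite ?c0 ?c1 ?c2 ?s1 ?s3 ?e22 ?e12 ?e32 ?e13 ?e21 ?e23 ?e31.
move=> i j; rewrite mxcolsE.
have a1 v : dotv v e1 = 0 -> dotv e1 (A *m v) = 0.
  by move=> h; rewrite -dotv_mul_sym// E1 dotvZl dotvC h mulr0.
have a3 v : dotv v e3 = 0 -> dotv e3 (A *m v) = 0.
  by move=> h; rewrite -dotv_mul_sym// E3 dotvZl dotvC h mulr0.
have e21 : dotv e2 e1 = 0 by rewrite dotvC.
have e23 : dotv e2 e3 = 0 by rewrite dotvC.
case: (ord3_cases 0 i) => ->; case: (ord3_cases 0 j) => ->;
  rewrite ?c0 ?c1 ?c2 ?eqxx// => _.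
- exact: a1.
- by rewrite a1// dotvC.
- by rewrite E1 dotvZr e21 mulr0.
- by rewrite E3 dotvZr e23 mulr0.
- by rewrite E1 dotvZr dotvC e13 mulr0.
- exact: a3.
Qed.

End symmetric_matrices.

(** * Physical tensors and points that separate a multiplier *)

Section physical_tensors.
Variable R : realType.
Implicit Types (p q v : 'cV[R]_3) (A B P U D : 'M[R]_3) (i j : 'I_3).

Lemma sym0_tr (Q : sym0 R) : (Q : 'M[R]_3)^T = Q.
Proof. by have /andP[/eqP]:= valP Q. Qed.

Lemma sym0_tr0 (Q : sym0 R) : \tr (Q : 'M[R]_3) = 0.
Proof. by have /andP[_ /eqP]:= valP Q. Qed.

Lemma sym0_normE (Q : sym0 R) : `|Q| ^+ 2 = dotm Q Q.
Proof. by rewrite sqr_sqrtr// dotm_sym0_ge0. Qed.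

(** The minimum of the form on the sphere is an eigenvalue, and any lower bound of the form there
    bounds all eigenvalues. The right-hand side is the usable version: it is visibly stable under
    small changes of Q. *)
Lemma physicalP (Q : sym0 R) : physical Q <->
  exists2 c, - 3%:R^-1 < c & forall p, sphere p -> c <= quad Q p.
Proof.
have [p Sp pmin] := quad_min Q.
have E := quad_min_eigen (sym0_tr Q) Sp pmin.
have p0 : p != 0.
  apply/eqP => p0; move/sphereP : Sp; rewrite p0 /dotv big1 => [|i _].
    by move/esym/eqP; rewrite oner_eq0.
  by rewrite mxE mul0r.
have eigp : eigenvalue (Q : 'M[R]_3) (quad Q p).
  apply/eigenvalueP; exists p^T; last by rewrite -trmx_eq0 trmxK.
  by rewrite -[X in _ *m X]sym0_tr -trmx_mul E linearZ.
have lb c : (forall q, sphere q -> c <= quad Q q) ->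
    lbound [set a : R | eigenvalue (Q : 'M[R]_3) a] c.
  move=> hc a /eigenvalueP[v vQ v0].
  have := quad_ge hc v^T; rewrite /quad -[X in X *m _]sym0_tr -trmx_mul vQ linearZ/=.
  rewrite dotvZl ler_pM2r// lt_neqAle dotv_ge0 andbT eq_sym.
  apply/eqP => /dotv_eq0 vT; move: v0.
  by rewrite -[v]trmxK vT trmx0 eqxx.
split=> [|[c c3 hc]].
  move=> ph; exists (vmin Q) => // q Sq; apply: le_trans (pmin _ Sq).
  apply: ge_inf => //; exists (quad Q p); exact: lb.
apply: lt_le_trans c3 _; apply: lb_le_inf; last exact: lb.
by exists (quad Q p).
Qed.

Lemma affine_gt0 (a b : R) : 0 < a ->
  exists2 e0, 0 < e0 & forall e, 0 <= e -> e <= e0 -> 0 < a + e * b.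
Proof.
move=> a0; have b1 : 0 < 1 + `|b| by rewrite ltr_pwDl.
exists (a / (2 * (1 + `|b|))); first by rewrite divr_gt0// mulr_gt0.
move=> e e0; rewrite ler_pdivlMr ?mulr_gt0// => h.
have := ler_norm (- b); rewrite normrN => hb.
have : e * (- b) <= e * (1 + `|b|) by rewrite ler_wpM2l//; lra.
by have : 0 <= e * (1 + `|b|) by [rewrite mulr_ge0// ltW]; lra.
Qed.

(** The four expressions add up to 0, so if none is positive all vanish. They are the combinations
    of a, b, c with coefficients t0 t1, t0 t2, t1 t2 for signs t0, t1, t2. *)
Lemma sign_choice (a b c : R) :
  [\/ 0 < a + b + c, 0 < - a - b + c, 0 < - a + b - c | 0 < a - b - c] \/
  [/\ a = 0, b = 0 & c = 0].
Proof.
have [?|g1] := ltP 0 (a + b + c); first by left; constructor 1.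
have [?|g2] := ltP 0 (- a - b + c); first by left; constructor 2.
have [?|g3] := ltP 0 (- a + b - c); first by left; constructor 3.
have [?|g4] := ltP 0 (a - b - c); first by left; constructor 4.
by right; split; lra.
Qed.

(* With positive weights r i = D i i + 1/3 + e U i i, averaging over the signs
   of the coordinates of p = (+-sqrt (r i)) makes the second moments diagonal,
   whence the mean of quad U is U . D + e sum_i (U i i)^2. *)
Lemma diag_separation D U (eta : R) :
  (forall i j, i != j -> D i j = 0) -> \tr D = 0 ->
  (forall i, - 3%:R^-1 < D i i) -> U^T = U -> \tr U = 0 ->
  eta < dotm D D ->
  exists p, [/\ sphere p, eta < quad D p & (U != 0 -> dotm U D < quad U p)].
Proof.
move=> D0 tD Dpos sU tU heta.
have [n1 n2 n3] := ord3_neq (0 : 'I_3).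
have dotD B : dotm B D = B 0 0 * D 0 0 + B (0 + 1) (0 + 1) * D (0 + 1) (0 + 1) +
    B (0 + 1 + 1) (0 + 1 + 1) * D (0 + 1 + 1) (0 + 1 + 1).
  rewrite /dotm /mxtrace (sum3 _ 0) !mxE !(sum3 _ 0).
  rewrite (D0 0 (0 + 1)) ?(eq_sym 0) ?n1// (D0 0 (0 + 1 + 1)) ?(eq_sym 0) ?n2//.
  rewrite (D0 (0 + 1) 0) ?n1// (D0 (0 + 1 + 1) 0) ?n2//.
  rewrite (D0 (0 + 1 + 1) (0 + 1)) ?n3// (D0 (0 + 1) (0 + 1 + 1)) ?(eq_sym (0 + 1)) ?n3//.
  by rewrite !mulr0 !addr0 !add0r.
have US i j : U i j = U j i by move/matrixP : sU => /(_ j i); rewrite mxE.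
have U0 : U != 0 -> U 0 (0 + 1) = 0 -> U 0 (0 + 1 + 1) = 0 ->
    U (0 + 1) (0 + 1 + 1) = 0 -> 0 < U 0 0 ^+ 2 + U (0 + 1) (0 + 1) ^+ 2 +
    U (0 + 1 + 1) (0 + 1 + 1) ^+ 2.
  move=> Un u01 u02 u12; rewrite lt_neqAle !addr_ge0 ?sqr_ge0// andbT eq_sym.
  apply: contra_neq Un => /eqP.
  rewrite !paddr_eq0 ?addr_ge0 ?sqr_ge0// !sqrf_eq0 => /andP[/andP[/eqP z0 /eqP z1] /eqP z2].
  apply/matrixP => a b; rewrite [RHS]mxE.
  by case: (ord3_cases 0 a) => ->; case: (ord3_cases 0 b) => -> //; rewrite US.
move: tD tU; rewrite /mxtrace !(sum3 _ 0).
rewrite !dotD in heta *; move: heta.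
have D03 := Dpos 0; have D13 := Dpos (0 + 1); have D23 := Dpos (0 + 1 + 1).
have quadD v : quad D v = D 0 0 * v 0 0 ^+ 2 + D (0 + 1) (0 + 1) * v (0 + 1) 0 ^+ 2 +
    D (0 + 1 + 1) (0 + 1 + 1) * v (0 + 1 + 1) 0 ^+ 2.
  rewrite (quad3 _ _ 0).
  rewrite (D0 0 (0 + 1)) ?(eq_sym 0) ?n1// (D0 0 (0 + 1 + 1)) ?(eq_sym 0) ?n2//.
  rewrite (D0 (0 + 1) 0) ?n1// (D0 (0 + 1 + 1) 0) ?n2//.
  rewrite (D0 (0 + 1 + 1) (0 + 1)) ?n3// (D0 (0 + 1) (0 + 1 + 1)) ?(eq_sym (0 + 1)) ?n3//.
  by rewrite !add0r !mul0r !addr0.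
have quadU v : quad U v = U 0 0 * v 0 0 ^+ 2 + U (0 + 1) (0 + 1) * v (0 + 1) 0 ^+ 2 +
    U (0 + 1 + 1) (0 + 1 + 1) * v (0 + 1 + 1) 0 ^+ 2 +
    2 * (U 0 (0 + 1) * (v 0 0 * v (0 + 1) 0) +
      U 0 (0 + 1 + 1) * (v 0 0 * v (0 + 1 + 1) 0) +
      U (0 + 1) (0 + 1 + 1) * (v (0 + 1) 0 * v (0 + 1 + 1) 0)).
  rewrite (quad3 _ _ 0) (US (0 + 1) 0) (US (0 + 1 + 1) 0) (US (0 + 1 + 1) (0 + 1)).
  by ring.
move: U0 quadD quadU D03 D13 D23.
set d0 := D 0 0; set d1 := D (0 + 1) (0 + 1); set d2 := D (0 + 1 + 1) (0 + 1 + 1).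
set u0 := U 0 0; set u1 := U (0 + 1) (0 + 1); set u2 := U (0 + 1 + 1) (0 + 1 + 1).
set a := U 0 (0 + 1); set b := U 0 (0 + 1 + 1); set c := U (0 + 1) (0 + 1 + 1).
move=> U0 quadD quadU D03 D13 D23 heta tD tU.
(* How small e must be: the first three bounds keep the weights r i positive, the fourth keeps the
   mean of quad D, which is D . (D + e U), above eta. *)
have [f0 f00 h0] := @affine_gt0 (d0 + 3%:R^-1) u0 ltac:(lra).
have [f1 f10 h1] := @affine_gt0 (d1 + 3%:R^-1) u1 ltac:(lra).
have [f2 f20 h2] := @affine_gt0 (d2 + 3%:R^-1) u2 ltac:(lra).
have [f3 f30 h3] := @affine_gt0 (d0 * d0 + d1 * d1 + d2 * d2 - eta)
  (d0 * u0 + d1 * u1 + d2 * u2) ltac:(lra).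
pose e := minr (minr f0 f1) (minr f2 f3).
have e0 : 0 < e by rewrite !lt_min f00 f10 f20 f30.
have [/h0 r0 /h1 r1 /h2 r2 /h3 r3] : [/\ e <= f0, e <= f1, e <= f2 & e <= f3].
  by rewrite /e; split; rewrite !ge_min lexx ?orbT.
have {}r0 := r0 (ltW e0); have {}r1 := r1 (ltW e0).
have {}r2 := r2 (ltW e0); have {}r3 := r3 (ltW e0).
have sq (x : R) : 0 < x -> exists2 y, 0 < y & y ^+ 2 = x.
  by move=> x0; exists (Num.sqrt x); rewrite ?sqrtr_gt0// sqr_sqrtr// ltW.
have [y0 y00 y0E] := sq _ r0.
have [y1 y10 y1E] := sq _ r1.
have [y2 y20 y2E] := sq _ r2.
pose al := a * (y0 * y1); pose be := b * (y0 * y2); pose ga := c * (y1 * y2).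
have main (t0 t1 t2 : R) : t0 ^+ 2 = 1 -> t1 ^+ 2 = 1 -> t2 ^+ 2 = 1 ->
    (U != 0 -> 0 < e * (u0 ^+ 2 + u1 ^+ 2 + u2 ^+ 2) +
      2 * (t0 * t1 * al + t0 * t2 * be + t1 * t2 * ga)) ->
    exists p, [/\ sphere p, eta < quad D p &
      U != 0 -> u0 * d0 + u1 * d1 + u2 * d2 < quad U p].
  move=> t01 t11 t21 hU.
  pose p : 'cV[R]_3 := \col_l if l == 0 then t0 * y0 else
     if l == 0 + 1 then t1 * y1 else t2 * y2.
  have p0 : p 0 0 = t0 * y0 by rewrite mxE eqxx.
  have p1 : p (0 + 1) 0 = t1 * y1 by rewrite mxE n1 eqxx.
  have p2 : p (0 + 1 + 1) 0 = t2 * y2 by rewrite mxE n2 n3.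
  exists p; split.
  - apply/sphereP; rewrite (dotv3 _ _ 0) p0 p1 p2 -!expr2 !exprMn t01 t11 t21.
    rewrite y0E y1E y2E !mul1r.
    transitivity (d0 + d1 + d2 + e * (u0 + u1 + u2) + 3 * 3%:R^-1); first by ring.
    by rewrite tD tU; lra.
  - rewrite quadD p0 p1 p2 !exprMn t01 t11 t21 y0E y1E y2E !mul1r.
    rewrite -subr_gt0 (_ : _ - eta = d0 * d0 + d1 * d1 + d2 * d2 - eta +
      e * (d0 * u0 + d1 * u1 + d2 * u2) + 3%:R^-1 * (d0 + d1 + d2)); last by ring.
    by rewrite tD mulr0 addr0; exact: r3.
  - move=> /hU {}hU.
    rewrite quadU p0 p1 p2 !exprMn t01 t11 t21 y0E y1E y2E !mul1r.
    rewrite -subr_gt0; congr (_ < _): hU; rewrite /al /be /ga.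
    transitivity (e * (u0 ^+ 2 + u1 ^+ 2 + u2 ^+ 2) + 2 * (t0 * t1 * (a * (y0 * y1)) +
      t0 * t2 * (b * (y0 * y2)) + t1 * t2 * (c * (y1 * y2))) + 3%:R^-1 * (u0 + u1 + u2)).
      by rewrite tU mulr0 addr0.
    by ring.
have s0 : 0 <= e * (u0 ^+ 2 + u1 ^+ 2 + u2 ^+ 2).
  by apply: mulr_ge0; [exact: ltW|rewrite !addr_ge0 ?sqr_ge0].
have one : (1 : R) ^+ 2 = 1 by rewrite expr1n.
have mone : (- 1 : R) ^+ 2 = 1 by rewrite sqrrN expr1n.
have pos g : 0 < g -> 0 < e * (u0 ^+ 2 + u1 ^+ 2 + u2 ^+ 2) + 2 * g.
  by move=> g0; apply: ltr_wpDl => //; exact: mulr_gt0.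
(* Either some choice of signs makes the off-diagonal contribution positive, or U is diagonal and
   the term e sum_i (U i i)^2 is positive by itself when U is nonzero. *)
have [[g|g|g|g]|[al0 be0 ga0]] := sign_choice al be ga.
- by apply: (main 1 1 1) => // _; rewrite !(mul1r, mulr1); exact: pos.
- by apply: (main (- 1) 1 1) => // _; rewrite !(mul1r, mulr1, mulN1r); exact: pos.
- by apply: (main 1 (- 1) 1) => // _; rewrite !(mul1r, mulr1, mulN1r); exact: pos.
- by apply: (main 1 1 (- 1)) => // _; rewrite !(mul1r, mulr1, mulN1r); exact: pos.
have z (x u v : R) : 0 < u -> 0 < v -> x * (u * v) = 0 -> x = 0.
  by move=> u0' v0' /eqP; rewrite mulf_eq0 (gt_eqF (mulr_gt0 u0' v0')) orbF => /eqP.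
have a0 : a = 0 by exact: (z _ y0 y1).
have b0 : b = 0 by exact: (z _ y0 y2).
have c0 : c = 0 by exact: (z _ y1 y2).
apply: (main 1 1 1) => // Un; rewrite al0 be0 ga0 !mulr0 !addr0 mulr0 addr0.
exact: mulr_gt0 e0 (U0 Un a0 b0 c0).
Qed.

(** Sphere, trace and pairing are invariant under orthogonal conjugation, so Q may be taken
    diagonal. Its diagonal entries are then values of the form on the sphere, hence above -1/3. *)
Lemma dom_separation (Q u : sym0 R) (eta : R) : dom (Q, eta) ->
  exists p, [/\ sphere p, eta < quad Q p & (u != 0 -> dotm u Q < quad u p)].
Proof.
move=> [/= /physicalP[c c3 hc] heta].
have [P PP PQ] := sym_diagonalizable (sym0_tr Q).
have PP' : P *m P^T = 1%:M by apply: mulmx1C.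
have conj_dot (A B : 'M[R]_3) : dotm (P^T *m A *m P) (P^T *m B *m P) = dotm A B.
  rewrite /dotm -!mulmxA (mulmxA P (P^T)) PP' mul1mx.
  by rewrite mxtrace_mulC -!mulmxA PP' mulmx1.
have conj_tr (A : 'M[R]_3) : \tr (P^T *m A *m P) = \tr A.
  by rewrite -mulmxA mxtrace_mulC -mulmxA PP' mulmx1.
have conj_sym (A : 'M[R]_3) : A^T = A -> (P^T *m A *m P)^T = P^T *m A *m P.
  by move=> sA; rewrite !trmx_mul sA trmxK mulmxA.
have conj0 (A : 'M[R]_3) : P^T *m A *m P = 0 -> A = 0.
  move=> h; have : P *m (P^T *m A *m P) *m P^T = A.
    by rewrite !mulmxA PP' mul1mx -mulmxA PP' mulmx1.
  by rewrite h mulmx0 mul0mx.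
have SP q : sphere q -> sphere (P *m q).
  move=> /sphereP Sq; apply/sphereP; rewrite dotvE trmx_mul -mulmxA (mulmxA P^T) PP mul1mx.
  by rewrite -dotvE.
have [||||||q [Sq Qq uq]] := @diag_separation (P^T *m Q *m P) (P^T *m u *m P) eta.
- exact: PQ.
- by rewrite conj_tr sym0_tr0.
- move=> i; apply: lt_le_trans c3 _.
  pose v : 'cV[R]_3 := \col_l (l == i)%:R.
  have Sv : sphere v.
    apply/sphereP; rewrite /dotv (bigD1 i)//= big1 => [|k /negbTE kj].
      by rewrite mxE eqxx addr0 mulr1.
    by rewrite mxE kj mul0r.
  have -> : (P^T *m Q *m P) i i = quad (P^T *m Q *m P) v.
    rewrite /quad /dotv (bigD1 i)//= big1 => [|k /negbTE kj].
      rewrite addr0 [X in X * _]mxE (bigD1 i)//= big1 => [|k /negbTE kj].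
        by rewrite [v _ _]mxE eqxx !mulr1 addr0.
      by rewrite [v _ _]mxE kj mulr0.
    by rewrite [v _ _]mxE kj mulr0.
  by rewrite -quadM; apply: hc; exact: SP.
- by apply: conj_sym; exact: sym0_tr.
- by rewrite conj_tr sym0_tr0.
- by rewrite conj_dot -sym0_normE.
exists (P *m q); split; [exact: SP|by rewrite quadM|move=> u0].
rewrite quadM -conj_dot; apply: uq; apply: contra_neq u0 => /conj0 u0.
exact: val_inj.
Qed.

End physical_tensors.

(** * The partition function *)

Section bounded_measurable.
Context d (T : measurableType d) (R : realType).
Variables (mu : {measure set T -> \bar R}) (D : set T).
Hypotheses (mD : measurable D) (Dfin : (mu D < +oo)%E).
Implicit Types (f g h : T -> R) (C : R).

(** On a set of finite measure this class consists of integrable functions and is stable under the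
    operations needed, so integrability follows from the shape of the integrand. *)
Definition bounded_mfun g :=
  measurable_fun D g /\ exists C, forall p, D p -> `|g p| <= C.

Lemma bounded_mfun_cst (c : R) : bounded_mfun (fun=> c).
Proof. by split; [exact: measurable_cst|exists `|c|]. Qed.

Lemma bounded_mfunD f g : bounded_mfun f -> bounded_mfun g ->
  bounded_mfun (fun p => f p + g p).
Proof.
move=> [mf [C fC]] [mg [E gE]]; split; first exact: measurable_funD.
exists (C + E) => p Dp; apply: le_trans (ler_normD _ _) _.
by rewrite lerD ?fC ?gE.
Qed.

Lemma bounded_mfunM f g : bounded_mfun f -> bounded_mfun g ->
  bounded_mfun (fun p => f p * g p).
Proof.
move=> [mf [C fC]] [mg [E gE]]; split; first exact: measurable_funM.
by exists (C * E) => p Dp; rewrite normrM ler_pM ?fC ?gE.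
Qed.

Lemma bounded_mfunN f : bounded_mfun f -> bounded_mfun (fun p => - f p).
Proof.
move=> [mf [C fC]]; split; first exact: measurable_funN.
by exists C => p Dp; rewrite normrN fC.
Qed.

Lemma bounded_mfunB f g : bounded_mfun f -> bounded_mfun g ->
  bounded_mfun (fun p => f p - g p).
Proof. by move=> bf bg; exact: bounded_mfunD bf (bounded_mfunN bg). Qed.

Lemma bounded_mfun_norm f : bounded_mfun f -> bounded_mfun (fun p => `|f p|).
Proof.
move=> [mf [C fC]]; split; first exact: measurableT_comp (@normr_measurable _ _) mf.
by exists C => p Dp; rewrite normr_id fC.
Qed.

Lemma bounded_mfun_max f g : bounded_mfun f -> bounded_mfun g ->
  bounded_mfun (fun p => maxr (f p) (g p)).
Proof.
move=> [mf [C fC]] [mg [E gE]]; split; first exact: measurable_maxr.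
exists (maxr C E) => p Dp; rewrite le_max.
by have [_|_] := leP (f p) (g p); rewrite ?fC ?gE ?orbT.
Qed.

Lemma bounded_mfun_expR f : bounded_mfun f -> bounded_mfun (fun p => expR (f p)).
Proof.
move=> [mf [C fC]]; split; first exact: measurableT_comp (@measurable_expR _) mf.
exists (expR C) => p Dp; rewrite ger0_norm ?expR_ge0// ler_expR.
by apply: le_trans (fC p Dp); exact: ler_norm.
Qed.

Lemma bounded_mfun_indic (A : set T) : measurable A -> bounded_mfun \1_A.
Proof.
move=> mA; split; first exact: measurable_indic.
by exists 1 => p _; rewrite indicE; case: (p \in A); rewrite ?normr0 ?normr1.
Qed.

Lemma bounded_mfun_int f : bounded_mfun f -> mu.-integrable D (EFin \o f).
Proof.
move=> [mf [C fC]]; apply: measurable_bounded_integrable => //.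
exists C; split; first exact: num_real.
by move=> M /ltW CM p Dp; exact: le_trans (fC p Dp) CM.
Qed.

Local Notation I f := (\int[mu]_(p in D) f p).

Lemma bounded_le f g : bounded_mfun f -> bounded_mfun g ->
  (forall p, D p -> f p <= g p) -> I f <= I g.
Proof. by move=> /bounded_mfun_int ? /bounded_mfun_int ?; exact: le_Rintegral. Qed.

Lemma bounded_intD f g : bounded_mfun f -> bounded_mfun g ->
  \int[mu]_(p in D) (f p + g p) = I f + I g.
Proof. by move=> /bounded_mfun_int ? /bounded_mfun_int ?; exact: RintegralD. Qed.

Lemma bounded_intB f g : bounded_mfun f -> bounded_mfun g ->
  \int[mu]_(p in D) (f p - g p) = I f - I g.
Proof. by move=> /bounded_mfun_int ? /bounded_mfun_int ?; exact: RintegralB. Qed.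

Lemma bounded_intZ (c : R) f : bounded_mfun f ->
  \int[mu]_(p in D) (c * f p) = c * I f.
Proof. by move=> /bounded_mfun_int ?; exact: RintegralZl. Qed.

Lemma eq_on_int f g : (forall p, D p -> f p = g p) -> I f = I g.
Proof. by move=> fg; apply: eq_Rintegral => p /set_mem /fg. Qed.

Lemma bounded_norm_int_le f g : bounded_mfun f -> bounded_mfun g ->
  (forall p, D p -> `|f p| <= g p) -> `|I f| <= I g.
Proof.
move=> bf bg fg.
apply: le_trans (le_normr_Rintegral mD (bounded_mfun_int bf)) _.
by apply: bounded_le => //; exact: bounded_mfun_norm.
Qed.

Lemma bounded_int_gt0 f : bounded_mfun f -> (forall p, D p -> 0 <= f p) ->
  (0 < mu (D `&` [set p | (0 < f p)%R]))%E -> 0 < I f.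
Proof.
move=> bf f0 muf; rewrite lt_neqAle Rintegral_ge0// andbT eq_sym.
apply/eqP => If0; move: muf.
have bi := bounded_mfun_int bf.
have /integrableP[mf _] := bi.
have : (\int[mu]_(p in D) `|(f p)%:E| = 0)%E.
  transitivity (\int[mu]_(p in D) (f p)%:E)%E.
    by apply: eq_integral => p /set_mem Dp; rewrite gee0_abs// lee_fin f0.
  rewrite -[LHS]fineK; last exact: integrable_fin_num.
  by rewrite -[fine _]/(I f) If0.
move=> /(ae_eq_integral_abs mu mD mf)[N [mN N0 DN]].
have mpos : measurable (D `&` [set p | 0 < f p]).
  have [mf' _] := bf; rewrite (_ : D `&` _ = D `&` f @^-1` [set` `]0%R, +oo[%R]).
    by apply: mf' => //; exact: measurable_itv.
  by apply/seteqP; split=> p [Dp /=]; rewrite in_itv/= andbT.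
have := @subset_measure0 _ _ _ mu _ _ mpos mN _ N0.
move=> ->; first by rewrite ltxx.
move=> p [Dp /= fp]; apply: DN => /= /(_ Dp) [] fp0.
by move: fp; rewrite fp0 ltxx.
Qed.

End bounded_measurable.

Lemma H2_sphere_lty (R : realType) : (H2 R (@sphere R) < +oo)%E.
Proof. exact: hausdorff2_sphere_lty. Qed.

(** * Integrals over the sphere depending on the multiplier and the parameters *)

Section sphere_integrals.
Variable R : realType.
Implicit Types (l u Q B : sym0 R) (x v : sym0 R * R) (p : R3 R).
Local Notation S := (@sphere R : set (R3 R)).
Local Notation mS := (@measurable_sphere R).
Local Notation Sfin := (@H2_sphere_lty R).
Local Notation bm := (bounded_mfun S).

Lemma sym0_coord_le l i j : `|l i j| <= `|l|.
Proof.
rewrite -(@ler_pXn2r _ 2) ?nnegrE// sym0_normE dotm_sym0 real_normK ?num_real//.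
rewrite (bigD1 i)//= (bigD1 j)//= -expr2 -addrA lerDl addr_ge0//.
  by apply: sumr_ge0 => k _; rewrite -expr2 sqr_ge0.
by apply: sumr_ge0 => k _; apply: sumr_ge0 => k' _; rewrite -expr2 sqr_ge0.
Qed.

(** The form has nine terms, each at most the norm of l. The same crude count gives 10 in
    [aff_norm_le] and 18 in [quad_diff_le]. *)
Lemma quad_norm_le l p : sphere p -> `|quad l p| <= 9 * `|l|.
Proof.
move=> Sp; have h i j : `|l i j * ((p : 'cV[R]_3) i 0 * (p : 'cV[R]_3) j 0)| <= `|l|.
  rewrite normrM -[leRHS]mulr1 ler_pM ?sym0_coord_le// normrM -[leRHS]mulr1.
  by rewrite ler_pM// coord_sphere.
rewrite quadE; apply: le_trans (ler_norm_sum _ _ _) _.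
have -> : 9 * `|l| = \sum_(i : 'I_3) \sum_(j : 'I_3) `|l|.
  by rewrite !sumr_const card_ord -mulrnA -[RHS]mulr_natl.
apply: ler_sum => i _; apply: le_trans (ler_norm_sum _ _ _) _.
by apply: ler_sum => j _.
Qed.

Lemma dotmC (A B : 'M[R]_3) : dotm A B = dotm B A.
Proof. by rewrite /dotm mxtrace_mulC. Qed.

Lemma dotmDl (A B C : 'M[R]_3) : dotm (A + B) C = dotm A C + dotm B C.
Proof. by rewrite /dotm mulmxDl mxtraceD. Qed.

Lemma dotmZl (c : R) (A B : 'M[R]_3) : dotm (c *: A) B = c * dotm A B.
Proof. by rewrite /dotm -scalemxAl mxtraceZ. Qed.

Lemma dotmBl (A B C : 'M[R]_3) : dotm (A - B) C = dotm A C - dotm B C.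
Proof. by rewrite dotmDl -scaleN1r dotmZl mulN1r. Qed.

Lemma dotmDr (A B C : 'M[R]_3) : dotm C (A + B) = dotm C A + dotm C B.
Proof. by rewrite dotmC dotmDl !(dotmC C). Qed.

Lemma dotmZr (c : R) (A B : 'M[R]_3) : dotm B (c *: A) = c * dotm B A.
Proof. by rewrite dotmC dotmZl dotmC. Qed.

Lemma dotmBr (A B C : 'M[R]_3) : dotm C (A - B) = dotm C A - dotm C B.
Proof. by rewrite dotmC dotmBl !(dotmC C). Qed.

Lemma dotm_norm_le l u : `|dotm l u| <= `|l| * `|u|.
Proof.
rewrite ler_norml dotm_sym0_le andbT lerNl.
have : dotm (- l : sym0 R) u <= `|- l| * `|u| := dotm_sym0_le (- l) u.
by rewrite normrN /= -scaleN1r dotmZl mulN1r.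
Qed.

Lemma quadD (A B : 'M[R]_3) (p : 'cV[R]_3) : quad (A + B) p = quad A p + quad B p.
Proof. by rewrite /quad mulmxDl dotvDl. Qed.

Lemma quadZ (c : R) (A : 'M[R]_3) (p : 'cV[R]_3) : quad (c *: A) p = c * quad A p.
Proof. by rewrite /quad -scalemxAl dotvZl. Qed.

Lemma quadB (A B : 'M[R]_3) (p : 'cV[R]_3) : quad (A - B) p = quad A p - quad B p.
Proof. by rewrite quadD -scaleN1r quadZ mulN1r. Qed.

(** Linear in x, so it evaluates both a parameter x = (Q, eta) and an increment v of it. *)
Definition aff x p : R := quad x.1 p - x.2.
(** The exponent centred so as to have mean zero under every density in A(Q). *)
Definition tilt l Q p : R := quad l p - dotm l Q.
(** The factor of [aff v] in the derivative of the integrand of Z in the direction v, with the slope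
    of max(t, 0) at the kink t = 0 taken to be 0. *)
Definition kern l x p : R := expR (quad l p) * \1_[set q : R3 R | 0 < aff x q] p.
Definition weight x p : R := maxr (aff x p) 0.
Definition partition_fun l x : R := \int[H2 R]_(p in S) (expR (quad l p) * weight x p).
Definition dpartition l x v : R := \int[H2 R]_(p in S) (kern l x p * aff v p).
Definition Psi l x : R := \int[H2 R]_(p in S) (expR (tilt l x.1 p) * weight x p).

Lemma affD x v p : aff (x + v) p = aff x p + aff v p.
Proof. by rewrite /aff quadD opprD addrACA. Qed.

Lemma affZ (c : R) v p : aff (c *: v) p = c * aff v p.
Proof. by rewrite /aff quadZ mulrBr. Qed.

Lemma affB x v p : aff (x - v) p = aff x p - aff v p.
Proof. by rewrite affD -scaleN1r affZ mulN1r. Qed.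

Lemma tiltD l u Q p : tilt (l + u) Q p = tilt l Q p + tilt u Q p.
Proof. by rewrite /tilt quadD dotmDl opprD addrACA. Qed.

Lemma tiltZ (c : R) u Q p : tilt (c *: u) Q p = c * tilt u Q p.
Proof. by rewrite /tilt quadZ dotmZl mulrBr. Qed.

Lemma tiltB l u Q p : tilt (l - u) Q p = tilt l Q p - tilt u Q p.
Proof. by rewrite tiltD -scaleN1r tiltZ mulN1r. Qed.

Lemma aff_norm_le v p : sphere p -> `|aff v p| <= 10 * `|v|.
Proof.
move=> Sp; have -> : 10 * `|v| = 9 * `|v| + `|v| by ring.
apply: le_trans (ler_normB _ _) _; apply: lerD.
  apply: le_trans (quad_norm_le _ Sp) _; rewrite ler_pM2l//.
  by rewrite [leRHS]prod_normE le_max lexx.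
by rewrite [leRHS]prod_normE le_max lexx orbT.
Qed.

Lemma weight_ge0 x p : 0 <= weight x p.
Proof. by rewrite /weight le_max lexx orbT. Qed.

Lemma kern_ge0 l x p : 0 <= kern l x p.
Proof. by rewrite /kern mulr_ge0 ?expR_ge0// indicE. Qed.

Lemma measurable_aff v : measurable_fun setT (aff v).
Proof. exact: measurable_funB (measurable_quad _) (measurable_cst _). Qed.

Lemma measurable_aff_gt0 v : measurable [set q : R3 R | 0 < aff v q].
Proof.
rewrite (_ : [set _ | _] = aff v @^-1` [set` `]0%R, +oo[%R]).
  by rewrite -[_ @^-1` _]setTI; apply: measurable_aff => //; exact: measurable_itv.
by apply/seteqP; split => p /=; rewrite in_itv/= andbT.
Qed.

Lemma bm_quad l : bm (fun p => quad l p).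
Proof.
split; first exact: measurable_funTS (measurable_quad _).
by exists (9 * `|l|) => p; exact: quad_norm_le.
Qed.

Lemma bm_aff v : bm (aff v).
Proof. exact: bounded_mfunB (bm_quad _) (bounded_mfun_cst _ _). Qed.

Lemma bm_tilt l Q : bm (tilt l Q).
Proof. exact: bounded_mfunB (bm_quad _) (bounded_mfun_cst _ _). Qed.

Lemma bm_weight x : bm (weight x).
Proof. exact: bounded_mfun_max (bm_aff _) (bounded_mfun_cst _ _). Qed.

Lemma bm_kern l x : bm (kern l x).
Proof.
apply: bounded_mfunM (bounded_mfun_expR (bm_quad _)) _.
exact: bounded_mfun_indic (measurable_aff_gt0 x).
Qed.

Lemma bm_dpart l x v : bm (fun p => kern l x p * aff v p).
Proof. exact: bounded_mfunM (bm_kern _ _) (bm_aff _). Qed.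

Lemma bm_part l x : bm (fun p => expR (quad l p) * weight x p).
Proof. exact: bounded_mfunM (bounded_mfun_expR (bm_quad _)) (bm_weight _). Qed.

Lemma bm_Psi l Q x : bm (fun p => expR (tilt l Q p) * weight x p).
Proof. exact: bounded_mfunM (bounded_mfun_expR (bm_tilt _ _)) (bm_weight _). Qed.

Lemma weightE x p : weight x p = \1_[set q : R3 R | 0 < aff x q] p * aff x p.
Proof.
rewrite /weight indicE; have [h|h] := ltP 0 (aff x p).
  by rewrite mem_set// mul1r.
by rewrite memNset ?mul0r// => /= h'; have := lt_le_trans h' h; rewrite ltxx.
Qed.

(** Euler's relation: Z is positively homogeneous of degree one in x. Continuity of Z thereby
    reduces to that of [dpartition]. *)
Lemma partition_funE l x : partition_fun l x = dpartition l x x.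
Proof. by apply: eq_on_int => p _; rewrite /kern weightE mulrA. Qed.

Lemma PsiE l x : Psi l x = expR (- dotm l x.1) * partition_fun l x.
Proof.
rewrite -(bounded_intZ mS Sfin _ (bm_part l x)).
by apply: eq_on_int => p _; rewrite mulrA -expRD addrC.
Qed.

Lemma dpartitionD l x v v' :
  dpartition l x (v + v') = dpartition l x v + dpartition l x v'.
Proof.
rewrite -(bounded_intD mS Sfin (bm_dpart _ _ _) (bm_dpart _ _ _)).
by apply: eq_on_int => p _; rewrite affD mulrDr.
Qed.

Lemma dpartitionZ l x (c : R) v : dpartition l x (c *: v) = c * dpartition l x v.
Proof.
rewrite -(bounded_intZ mS Sfin _ (bm_dpart _ _ _)).
by apply: eq_on_int => p _; rewrite affZ mulrCA.
Qed.

Lemma dpartitionB l x v v' :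
  dpartition l x (v - v') = dpartition l x v - dpartition l x v'.
Proof. by rewrite dpartitionD -scaleN1r dpartitionZ mulN1r. Qed.

(* t |-> max(t, 0) is convex, so partition_fun l is convex with subgradient
   dpartition l. *)
Lemma partition_fun_subgradient l x y :
  partition_fun l x + dpartition l x (y - x) <= partition_fun l y.
Proof.
rewrite -(bounded_intD mS Sfin (bm_part _ _) (bm_dpart _ _ _)).
apply: (bounded_le mS Sfin).
- exact: bounded_mfunD (bm_part _ _) (bm_dpart _ _ _).
- exact: bm_part.
move=> p _; rewrite /kern -mulrA -mulrDr ler_pM2l ?expR_gt0// affB weightE -mulrDr subrKC.
rewrite indicE; case: (_ \in _); rewrite ?mul1r ?mul0r ?weight_ge0//.
by rewrite /weight le_max lexx.
Qed.

Lemma quad_diff_le l (e : R) (p q : 'cV[R]_3) : sphere p -> sphere q -> 0 <= e ->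
  (forall i, `|q i 0 - p i 0| <= e) -> `|quad l q - quad l p| <= 18 * `|l| * e.
Proof.
move=> Sp Sq e0 h; rewrite !quadE -sumrB.
have hij i j : `|l i j * (q i 0 * q j 0) - l i j * (p i 0 * p j 0)| <= `|l| * (2 * e).
  rewrite -mulrBr normrM ler_pM ?sym0_coord_le//.
  have -> : q i 0 * q j 0 - p i 0 * p j 0 =
     (q i 0 - p i 0) * q j 0 + p i 0 * (q j 0 - p j 0) by ring.
  apply: le_trans (ler_normD _ _) _; rewrite !normrM mulr_natl mulr2n lerD//.
    by rewrite -[leRHS]mulr1 ler_pM ?coord_sphere.
  by rewrite -[leRHS]mul1r ler_pM ?coord_sphere.
apply: le_trans (ler_norm_sum _ _ _) _.
have -> : 18 * `|l| * e = \sum_(i : 'I_3) \sum_(j : 'I_3) `|l| * (2 * e).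
  by rewrite !sumr_const card_ord -mulrnA -[RHS]mulr_natl; ring.
apply: ler_sum => i _; rewrite -sumrB; apply: le_trans (ler_norm_sum _ _ _) _.
by apply: ler_sum => j _.
Qed.

(** Strict inequalities at p persist for the points of the sphere in a coordinate box around p, and
    these have positive measure. *)
Lemma pos_measure l u (c e : R) (p : 'cV[R]_3) : sphere p ->
  c < quad l p -> e < quad u p ->
  (0 < H2 R (S `&` [set q : R3 R | (c < quad l q)%R /\ (e < quad u q)%R]))%E.
Proof.
move=> Sp hl hu.
have ex (k : sym0 R) (b : R) : b < quad k p -> exists2 d, 0 < d & forall q : 'cV[R]_3, sphere q ->
    (forall i, `|q i 0 - p i 0| <= d) -> b < quad k q.
  move=> hk; have k1 : 0 < 18 * `|k| + 1 by rewrite ltr_wpDl// mulr_ge0.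
  exists ((quad k p - b) / (18 * `|k| + 1)); first by rewrite divr_gt0// subr_gt0.
  set d := _ / _ => q Sq hq.
  have d0 : 0 < d by rewrite divr_gt0// subr_gt0.
  have := quad_diff_le k Sp Sq (ltW d0) hq; rewrite ler_norml => /andP[h _].
  have : d * (18 * `|k| + 1) = quad k p - b by rewrite divfK// gt_eqF.
  by rewrite mulrDr mulr1 (mulrC d) => h'; lra.
have [d1 d10 h1] := ex _ _ hl; have [d2 d20 h2] := ex _ _ hu.
apply: (@hausdorff2_gt0_sphere_ball _ p _ (minr d1 d2)) => //.
  by rewrite lt_min d10.
by move=> q Sq hq; split; [apply: h1|apply: h2] => // i;
  apply: le_trans (hq i) _; rewrite ge_min lexx ?orbT.
Qed.

End sphere_integrals.

(** * Joint continuity in the multiplier and the parameters *)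

Section joint_continuity.
Variable R : realType.
Implicit Types (l u Q B : sym0 R) (x v : sym0 R * R) (p : R3 R).
Local Notation S := (@sphere R : set (R3 R)).
Local Notation mS := (@measurable_sphere R).
Local Notation Sfin := (@H2_sphere_lty R).
Local Notation bm := (bounded_mfun S).

Lemma expR_lip (s t K : R) : s <= K -> t <= K ->
  `|expR s - expR t| <= expR K * `|s - t|.
Proof.
wlog st : s t / t <= s => [h sK tK|sK tK].
  have [ts|/ltW st] := leP t s; first exact: h.
  by rewrite distrC (distrC s); exact: h.
rewrite !ger0_norm ?subr_ge0 ?ler_expR//.
have -> : expR s - expR t = expR s * (1 - expR (t - s)).
  by rewrite mulrBr mulr1 -expRD subrKC.
apply: ler_pM; rewrite ?expR_ge0 ?ler_expR//.
  by rewrite subr_ge0 -expR0 ler_expR subr_le0.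
by have := expR_ge1Dx (t - s); lra.
Qed.

Lemma near_pair l x (d : R) : 0 < d ->
  \forall y \near (l, x), `|l - y.1| < d /\ `|x - y.2| < d.
Proof.
move=> d0; near=> y.
have [h1 h2] : ball (l, x) d y by near: y; exact: nbhsx_ballx.
by split; [move: h1|move: h2]; rewrite -ball_normE.
Unshelve. all: by end_near. Qed.

(** The bands of half-width 1/(n + 1) decrease to the level set, which is null, and continuity from
    above applies because the sphere has finite measure. *)
Lemma level_band_small x (e : R) : x.2 < `|x.1| ^+ 2 -> 0 < e ->
  exists2 d, 0 < d & fine (H2 R (S `&` [set q : R3 R | `|aff x q| <= d])) <= e.
Proof.
move=> hx e0.
pose F n : set (R3 R) := S `&` [set q | `|aff x q| <= n.+1%:R^-1].
have mF n : measurable (F n).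
  apply: measurableI => //; first exact: mS.
  rewrite (_ : [set _ | _] = aff x @^-1` [set` `[- n.+1%:R^-1, n.+1%:R^-1]]).
    rewrite -[_ @^-1` _]setTI; apply: measurable_aff => //; exact: measurable_itv.
  by apply/seteqP; split => p; rewrite /= in_itv/= ler_norml.
have F0 : \bigcap_n F n = S `&` [set q | quad x.1 q = x.2].
  apply/seteqP; split=> p.
    move=> h; split; first by have [] := h 0%N I.
    apply/eqP; rewrite -subr_eq0 -normr_eq0 eq_le normr_ge0 andbT.
    rewrite leNgt; apply/negP => ap.
    pose n := Num.truncn `|quad x.1 p - x.2|^-1.
    have [_ /=] := h n I; rewrite leNgt => /negP; apply.
    by rewrite invf_plt ?posrE//; exact: real_truncnS_gt (num_real _).
  move=> [Sp /= qp] n _; split=> //=.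
  by rewrite /aff qp subrr normr0.
have cF : (H2 R \o F) @ \oo --> H2 R (\bigcap_n F n).
  apply: nonincreasing_cvg_mu => //.
  - apply: le_lt_trans Sfin; apply: le_measure; rewrite ?inE; [exact: mF|exact: mS|exact: subIsetl].
  - exact: bigcapT_measurable.
  - move=> n k nk; apply/subsetPset => p [Sp /= h]; split=> //=.
    by apply: le_trans h _; rewrite lef_pV2 ?posrE// ler_nat ltnS.
have {cF} : (H2 R \o F) @ \oo --> 0%E.
  have <- : H2 R (\bigcap_n F n) = 0%E by rewrite F0; exact: hausdorff2_level_eq0.
  exact: cF.
move/fine_cvgP => [_ cv].
move/cvgrPdist_le : cv => /(_ e e0)[N _ /(_ N (leqnn _))].
rewrite sub0r normrN => h; exists N.+1%:R^-1; first by rewrite invr_gt0.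
by apply: le_trans h; exact: ler_norm.
Qed.

(** Convergence in L^1. The exponential factor is Lipschitz in l, with M bounding it for all l
    within 1 of [l0]. The indicators differ only inside the band where [aff x0] is at most d in
    modulus: [aff] moves by less than d when x moves by less than d/10, so outside the band it keeps
    its sign. The band has small measure. *)
Lemma kern_continuous l0 x0 (e : R) : x0.2 < `|x0.1| ^+ 2 -> 0 < e ->
  \forall y \near (l0, x0),
    \int[H2 R]_(p in S) `|kern y.1 y.2 p - kern l0 x0 p| <= e.
Proof.
move=> hx0 e0.
pose m := fine (H2 R S); have m0 : 0 <= m by rewrite fine_ge0.
pose K := 9 * (`|l0| + 1); pose M := expR K.
have M0 : 0 < M by exact: expR_gt0.
have [|d d0 hd] := @level_band_small x0 (e / (2 * M)) hx0.
  by rewrite divr_gt0// mulr_gt0.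
pose C := M * 9 * m + 1; have C0 : 0 < C by rewrite ltr_wpDl// !mulr_ge0// ltW.
near=> y.
have [ll1 _] : `|l0 - y.1| < 1 /\ `|x0 - y.2| < 1 by near: y; exact: near_pair.
have [lle _] : `|l0 - y.1| < e / (2 * C) /\ `|x0 - y.2| < e / (2 * C).
  by near: y; apply: near_pair; rewrite divr_gt0// mulr_gt0.
have [_ xxd] : `|l0 - y.1| < d / 10 /\ `|x0 - y.2| < d / 10.
  by near: y; apply: near_pair; rewrite divr_gt0.
move: (y.1) (y.2) ll1 lle xxd => l x ll1 lle xxd.
pose Bd : set (R3 R) := [set q | `|aff x0 q| <= d].
have mB : measurable Bd.
  rewrite (_ : Bd = aff x0 @^-1` [set` `[- d, d]]).
    rewrite -[_ @^-1` _]setTI; apply: measurable_aff => //; exact: measurable_itv.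
  by apply/seteqP; split => p; rewrite /Bd /= in_itv/= ler_norml.
have bB := @bounded_mfun_indic _ _ R S Bd mB.
apply: (@le_trans _ _ (\int[H2 R]_(p in S) (M * 9 * `|l0 - l| + M * \1_Bd p))).
  apply: (bounded_le mS Sfin).
  - exact: bounded_mfun_norm (bounded_mfunB (bm_kern _ _) (bm_kern _ _)).
  - exact: bounded_mfunD (bounded_mfun_cst _ _) (bounded_mfunM (bounded_mfun_cst _ _) bB).
  move=> p Sp.
  have q0 := quad_norm_le l0 Sp; have q1 := quad_norm_le (l0 - l) Sp.
  have qE : quad (l0 - l : sym0 R) p = quad l0 p - quad l p by exact: quadB.
  rewrite qE in q1.
  have h0 : quad l0 p <= K.
    by apply: le_trans (ler_norm _) _; apply: le_trans q0 _; rewrite ler_pM2l// lerDl.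
  have h1 : quad l p <= K.
    have := le_trans (ler_norm _) q0; have : `|quad l0 p - quad l p| <= 9 by lra.
    by rewrite ler_norml /K mulrDr mulr1 => /andP[a b c]; lra.
  have eE := expR_lip h1 h0; rewrite distrC (distrC (quad l p)) in eE.
  rewrite distrC /kern.
  have -> : expR (quad l0 p) * \1_[set q : R3 R | 0 < aff x0 q] p -
            expR (quad l p) * \1_[set q : R3 R | 0 < aff x q] p =
    (expR (quad l0 p) - expR (quad l p)) * \1_[set q : R3 R | 0 < aff x q] p +
    expR (quad l0 p) * (\1_[set q : R3 R | 0 < aff x0 q] p - \1_[set q : R3 R | 0 < aff x q] p).
    by ring.
  apply: le_trans (ler_normD _ _) _; rewrite !normrM; apply: lerD.
    rewrite -[leRHS]mulr1 ler_pM//; last first.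
      by rewrite indicE; case: (_ \in _); rewrite ?normr0 ?normr1.
    by apply: le_trans eE _; rewrite -mulrA ler_pM2l.
  apply: ler_pM => //; first by rewrite ger0_norm ?expR_ge0// ler_expR.
  have [pB|pB] := pselect (Bd p).
    have -> : \1_Bd p = 1 :> R by rewrite indicE mem_set.
    rewrite !indicE.
    by do 2 case: (_ \in _); rewrite ?subrr ?subr0 ?sub0r ?normrN ?normr1 ?normr0.
  have aa := aff_norm_le (x0 - x) Sp; rewrite affB in aa.
  move: pB; rewrite /Bd /= => /negP; rewrite -ltNge => pB.
  have {aa} aa : `|aff x0 p - aff x p| < `|aff x0 p|.
    by apply: le_lt_trans aa _; apply: lt_trans pB; lra.
  rewrite !indicE (_ : (p \in _) = (p \in [set q : R3 R | 0 < aff x q])); first by rewrite subrr normr0 ler0n.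
  apply/idP/idP => /set_mem /= h; apply/mem_set => /=; move: aa.
    by rewrite (gtr0_norm h) ltr_norml => /andP[]; lra.
  move=> bb; rewrite ltNge; apply/negP => h'; move: bb.
  by rewrite (ler0_norm h') ltr_norml => /andP[]; lra.
rewrite (bounded_intD mS Sfin (bounded_mfun_cst _ _) (bounded_mfunM (bounded_mfun_cst _ _) bB)).
rewrite (bounded_intZ mS Sfin _ bB) Rintegral_cst; last exact: mS.
have -> : \int[H2 R]_(p in S) (\1_Bd p) = fine (H2 R (S `&` Bd)).
  by rewrite /Rintegral integral_indic ?(setIC Bd)//; exact: mS.
rewrite -/m.
have h1 : M * 9 * `|l0 - l| * m <= e / 2.
  have : `|l0 - l| * (2 * C) <= e by rewrite -ler_pdivlMr ?mulr_gt0// ltW.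
  have -> : `|l0 - l| * (2 * C) = 2 * (M * 9 * `|l0 - l| * m) + 2 * `|l0 - l|.
    by rewrite /C; ring.
  by have := normr_ge0 (l0 - l); lra.
have h2 : M * fine (H2 R (S `&` Bd)) <= e / 2.
  rewrite mulrC; apply: (@le_trans _ _ (e / (2 * M) * M)).
    by rewrite ler_pM2r.
  by rewrite le_eqVlt; apply/orP; left; apply/eqP; field; rewrite gt_eqF.
lra.
Unshelve. all: by end_near. Qed.

(** Uniformity in v is what continuity of the differential in operator norm requires. It follows
    from the L^1 estimate because [aff v] is bounded by 10 times the norm of v. *)
Lemma dpartition_continuous l0 x0 (e : R) : x0.2 < `|x0.1| ^+ 2 -> 0 < e ->
  \forall y \near (l0, x0), forall v,
    `|dpartition y.1 y.2 v - dpartition l0 x0 v| <= e * `|v|.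
Proof.
move=> hx0 e0; have e10 : 0 < e / 10 by rewrite divr_gt0.
near=> y => v.
have h : \int[H2 R]_(p in S) `|kern y.1 y.2 p - kern l0 x0 p| <= e / 10.
  by near: y; exact: kern_continuous.
rewrite /dpartition -(bounded_intB mS Sfin (bm_dpart _ _ _) (bm_dpart _ _ _)).
apply: (@le_trans _ _ (\int[H2 R]_(p in S) (10 * `|v| * `|kern y.1 y.2 p - kern l0 x0 p|))).
  have bk := bounded_mfun_norm (bounded_mfunB (bm_kern y.1 y.2) (bm_kern l0 x0)).
  apply: (bounded_norm_int_le mS Sfin).
  - exact: bounded_mfunB (bm_dpart _ _ _) (bm_dpart _ _ _).
  - exact: bounded_mfunM (bounded_mfun_cst _ _) bk.
  move=> p Sp; rewrite -mulrBl normrM [leLHS]mulrC.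
  by apply: ler_wpM2r => //; exact: aff_norm_le.
rewrite (bounded_intZ mS Sfin); last first.
  exact: bounded_mfun_norm (bounded_mfunB (bm_kern _ _) (bm_kern _ _)).
apply: (@le_trans _ _ (10 * `|v| * (e / 10))); first by rewrite ler_wpM2l// mulr_ge0.
by rewrite le_eqVlt; apply/orP; left; apply/eqP; field.
Unshelve. all: by end_near. Qed.

Lemma dpartition_norm_le l x v :
  `|dpartition l x v| <= 10 * `|v| * \int[H2 R]_(p in S) kern l x p.
Proof.
rewrite -(bounded_intZ mS Sfin _ (bm_kern l x)).
apply: (bounded_norm_int_le mS Sfin); first exact: bm_dpart.
  exact: bounded_mfunM (bounded_mfun_cst _ _) (bm_kern _ _).
move=> p Sp; rewrite normrM [leLHS]mulrC (ger0_norm (kern_ge0 _ _ _)).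
by apply: ler_wpM2r; [exact: kern_ge0|exact: aff_norm_le].
Qed.

Lemma partition_fun_continuous l0 x0 : x0.2 < `|x0.1| ^+ 2 ->
  partition_fun y.1 y.2 @[y --> (l0, x0)] --> partition_fun l0 x0.
Proof.
move=> hx0; apply/cvgrPdist_le => e e0.
pose I0 := \int[H2 R]_(p in S) kern l0 x0 p.
have I00 : 0 <= I0 by apply: Rintegral_ge0 => p _; exact: kern_ge0.
pose c := e / (2 * (`|x0| + 1)); have c0 : 0 < c.
  by rewrite divr_gt0// mulr_gt0// ltr_wpDl.
pose d := minr 1 (e / (2 * (10 * I0 + 1))).
have d0 : 0 < d by rewrite lt_min ltr01 divr_gt0// mulr_gt0// ltr_wpDl// mulr_ge0.
near=> y.
have /(_ y.2) h : forall v, `|dpartition y.1 y.2 v - dpartition l0 x0 v| <= c * `|v|.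
  by near: y; exact: dpartition_continuous.
have [_ xd] : `|l0 - y.1| < d /\ `|x0 - y.2| < d by near: y; exact: near_pair.
rewrite !partition_funE.
have -> : dpartition l0 x0 x0 - dpartition y.1 y.2 y.2 =
    - (dpartition y.1 y.2 y.2 - dpartition l0 x0 y.2) + dpartition l0 x0 (x0 - y.2).
  by rewrite dpartitionB; ring.
apply: le_trans (ler_normD _ _) _; rewrite normrN.
have h1 : c * `|y.2| <= e / 2.
  have : `|y.2| <= `|x0| + 1.
    have -> : y.2 = x0 - (x0 - y.2) by rewrite subKr.
    apply: le_trans (ler_normB _ _) _; rewrite lerD2l; apply: ltW.
    by apply: lt_le_trans xd _; rewrite /d ge_min lexx.
  move=> /(ler_wpM2l (ltW c0)) /le_trans; apply.
  rewrite le_eqVlt; apply/orP; left; apply/eqP; rewrite /c; field.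
  by rewrite gt_eqF// ltr_wpDl.
have h2 : 10 * `|x0 - y.2| * I0 <= e / 2.
  have : `|x0 - y.2| <= e / (2 * (10 * I0 + 1)).
    by apply: le_trans (ltW xd) _; rewrite /d ge_min lexx orbT.
  rewrite ler_pdivlMr; last by rewrite mulr_gt0// ltr_wpDl// mulr_ge0.
  have -> : `|x0 - y.2| * (2 * (10 * I0 + 1)) = 2 * (10 * `|x0 - y.2| * I0) + 2 * `|x0 - y.2|.
    by ring.
  by have := normr_ge0 (x0 - y.2); lra.
have h3 := le_trans (dpartition_norm_le l0 x0 (x0 - y.2)) h2.
by have := lerD (le_trans h h1) h3; lra.
Unshelve. all: by end_near. Qed.

Lemma dotm_continuous l0 Q0 :
  (fun y : sym0 R * sym0 R => dotm y.1 y.2) @ (l0, Q0) --> dotm l0 Q0.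
Proof.
have coord (k0 : sym0 R) i j : (k : sym0 R) i j @[k --> k0] --> k0 i j.
  apply/(@cvgrPdist_le _ _ _ (nbhs k0)) => e e0; near=> k.
  have := sym0_coord_le (k0 - k) i j; rewrite !mxE => /le_trans; apply.
  have : ball k0 e k by near: k; exact: nbhsx_ballx.
  by rewrite -ball_normE => /ltW.
have -> : (fun y : sym0 R * sym0 R => dotm y.1 y.2) =
    (fun y => \sum_i \sum_j y.1 i j * y.2 i j).
  by apply/funext => y; rewrite dotm_sym0.
rewrite dotm_sym0; apply: cvg_big => [|i _]; first exact: add_continuous.
apply: cvg_big => [|j _]; first exact: add_continuous.
apply: cvgM.
  by apply: (cvg_comp _ _ (@cvg_fst _ _ _ _ _)) (coord l0 i j).
by apply: (cvg_comp _ _ (@cvg_snd _ _ _ _ _)) (coord Q0 i j).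
Unshelve. all: by end_near. Qed.

Lemma Psi_continuous l0 x0 : x0.2 < `|x0.1| ^+ 2 ->
  Psi y.1 y.2 @[y --> (l0, x0)] --> Psi l0 x0.
Proof.
move=> hx0; rewrite PsiE.
under eq_fun do rewrite PsiE.
apply: cvgM; last exact: partition_fun_continuous.
apply: (cvg_comp (fun y : sym0 R * (sym0 R * R) => - dotm y.1 y.2.1) expR); last exact: continuous_expR.
apply: cvgN.
have h2 : (fun y : sym0 R * (sym0 R * R) => y.2.1) @ (l0, x0) --> x0.1.
  case: x0 {hx0} => Q0 e0 /=.
  by apply: (cvg_comp _ _ (@cvg_snd _ _ _ _ _)) (@cvg_fst _ _ _ _ _).
have h1 : (fun y : sym0 R * (sym0 R * R) => y.1) @ (l0, x0) --> l0 by exact: cvg_fst.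
exact: (cvg_comp _ _ (cvg_pair h1 h2) (@dotm_continuous l0 x0.1)).
Qed.

End joint_continuity.

(** * Compactness of balls and spheres of Sym_0(3) *)

Section sym0_compact.
Variable R : realType.
Implicit Types (l u : sym0 R) (A : 'M[R]_3).

(** The orthogonal projection onto Sym_0(3). As a left inverse of the inclusion it transports
    compactness from the space of all matrices. *)
Definition sym0_part_mx A : 'M[R]_3 := 2^-1 *: (A + A^T) - (3^-1 * \tr A)%:M.

Lemma sym0_part_subproof A : sym0_part_mx A \in @is_sym0 R.
Proof.
rewrite unfold_in /sym0_part_mx; apply/andP; split; apply/eqP.
  by rewrite linearB/= tr_scalar_mx linearZ/= linearD/= trmxK (addrC A^T).
rewrite linearB/= linearZ/= linearD/= mxtrace_tr mxtrace_scalar -mulr_natr.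
by field.
Qed.

Definition sym0_part A : sym0 R := Sym0 (sym0_part_subproof A).

Lemma sym0_partB A B : sym0_part (A - B) = sym0_part A - sym0_part B.
Proof.
apply: val_inj => /=; rewrite /sym0_part_mx !linearB/=.
apply/matrixP => i j; rewrite !mxE.
by case: (i == j); rewrite ?mulr1n ?mulr0n; ring.
Qed.

Lemma sym0_partK l : sym0_part l = l.
Proof.
apply: val_inj => /=; rewrite /sym0_part_mx sym0_tr sym0_tr0 mulr0 raddf0 subr0.
by apply/matrixP => i j; rewrite !mxE; field.
Qed.

(** The norm on the left is Euclidean, the one on the right is the maximum norm. Nine entries of
    modulus at most 2|A| give the factor sqrt (9 * 4) = 6. *)
Lemma sym0_part_norm_le A : `|sym0_part A| <= 6 * `|A|.
Proof.
have h i j : `|sym0_part_mx A i j| <= 2 * `|A|.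
  have en a b : `|A a b| <= `|A|.
    rewrite [leRHS]/normr/= mx_normrE.
    by apply: le_trans (le_bigmax _ _ (a, b)).
  have tr : `|3^-1 * \tr A| <= `|A|.
    rewrite normrM ger0_norm// ler_pdivrMl//; apply: le_trans (ler_norm_sum _ _ _) _.
    have -> : 3 * `|A| = \sum_(a : 'I_3) `|A| by rewrite sumr_const card_ord -[RHS]mulr_natl.
    by apply: ler_sum => a _; exact: en.
  have -> : 2 * `|A| = `|A| + `|A| by ring.
  rewrite !mxE; apply: le_trans (ler_normB _ _) _; apply: lerD.
    rewrite normrM [X in X * _]ger0_norm ?invr_ge0//.
    by have := ler_normD (A i j) (A j i); have := en i j; have := en j i; lra.
  by case: (i == j); rewrite ?mulr1n ?mulr0n ?normr0.
rewrite -(@ler_pXn2r _ 2) ?nnegrE ?mulr_ge0// sym0_normE dotm_sym0.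
have -> : (6 * `|A|) ^+ 2 = \sum_(i : 'I_3) \sum_(j : 'I_3) (2 * `|A|) ^+ 2.
  by rewrite !sumr_const card_ord -mulrnA -[RHS]mulr_natl; ring.
apply: ler_sum => i _; apply: ler_sum => j _.
by rewrite -expr2 -(real_normK (num_real _)) ler_pXn2r ?nnegrE ?mulr_ge0.
Qed.

(** The projection may carry a ball of the maximum norm outside the Euclidean ball of the same
    radius, so [K] retains only the points whose image stays inside. This is a closed condition, and
    the image of [K] is the whole ball because the maximum norm is at most the Euclidean one. *)
Lemma sym0_ball_compact (r : R) : compact [set l : sym0 R | `|l| <= r].
Proof.
pose T (v : 'rV[R]_(3 * 3)) : sym0 R := sym0_part (vec_mx v).
have vecn (v : 'rV[R]_(3 * 3)) : `|vec_mx v| <= `|v|.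
  rewrite [leLHS]/normr/= mx_normrE; apply: bigmax_le => // -[i j] _ /=.
  rewrite mxE [leRHS]/normr/= mx_normrE.
  by apply: le_trans (le_bigmax _ _ (ord0, mxvec_index i j)).
have cT : continuous T.
  move=> v; apply/(@cvgrPdist_lt _ _ _ (nbhs v)) => e e0; near=> w.
  rewrite /T -sym0_partB -linearB/=; apply: le_lt_trans (sym0_part_norm_le _) _.
  apply: (@le_lt_trans _ _ (6 * `|v - w|)); first by rewrite ler_pM2l// vecn.
  rewrite -ltr_pdivlMl//.
  have : ball v (6^-1 * e) w by near: w; apply: nbhsx_ballx; rewrite mulr_gt0.
  by rewrite -ball_normE.
pose K := [set v : 'rV[R]_(3 * 3) | `|v| <= r] `&` [set v | `|T v| <= r].
have cK : compact K.
  apply: bounded_closed_compact.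
    exists r; split; first exact: num_real.
    by move=> M rM v [/= vr _]; apply: le_trans vr (ltW rM).
  apply: closedI.
    rewrite (_ : [set v | _] = (fun v : 'rV[R]_(3 * 3) => `|v|) @^-1` [set x : R | x <= r])//.
    by apply: closed_comp => [v _|]; [exact: norm_continuous|exact: closed_le].
  rewrite (_ : [set v | _] = (normr \o T) @^-1` [set x : R | x <= r])//.
  apply: closed_comp => [v _|]; last exact: closed_le.
  by apply: continuous_comp; [exact: cT|exact: norm_continuous].
have -> : [set l : sym0 R | `|l| <= r] = T @` K.
  apply/seteqP; split=> [l /= lr|_ [v [_ vr] <-]//].
  have Tl : T (mxvec l) = l by rewrite /T mxvecK sym0_partK.
  exists (mxvec l) => //; split; rewrite /= ?Tl//.
  rewrite [leLHS]/normr/= mx_normrE; apply: bigmax_le => [|[a k] _ /=].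
    exact: le_trans lr.
  rewrite (ord1 a); case/mxvec_indexP : k => i j; rewrite mxvecE.
  exact: le_trans (sym0_coord_le _ _ _) lr.
by apply: continuous_compact cK; exact: continuous_subspaceT.
Unshelve. all: by end_near. Qed.

Lemma sym0_sphere_compact (l0 : sym0 R) (r : R) : compact [set l : sym0 R | `|l - l0| = r].
Proof.
apply: (subclosed_compact _ (@sym0_ball_compact (`|l0| + r))).
  rewrite (_ : [set l | _] = (fun l : sym0 R => `|l - l0|) @^-1` [set r])//.
  apply: closed_comp => [l _|]; last exact: closed_eq.
  apply/(@cvgrPdist_lt _ _ _ (nbhs l)) => e e0; near=> k.
  apply: le_lt_trans (ler_dist_dist _ _) _; rewrite opprB addrA subrK.
  have : ball l e k by near: k; exact: nbhsx_ballx.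
  by rewrite -ball_normE.
move=> l /= lr; rewrite -(subrKC l0 l) -lr.
exact: ler_normD.
Unshelve. all: by end_near. Qed.

End sym0_compact.

(** * The dual problem *)

Section variational.
Variable R : realType.
Implicit Types (l u Q B : sym0 R) (x v : sym0 R * R) (p : R3 R).
Local Notation S := (@sphere R : set (R3 R)).
Local Notation mS := (@measurable_sphere R).
Local Notation Sfin := (@H2_sphere_lty R).
Local Notation bm := (bounded_mfun S).
Local Notation cst_bm := (bounded_mfun_cst S).

Lemma dom_eta x : dom x -> x.2 < `|x.1| ^+ 2.
Proof. by case. Qed.

(** The source of both strict convexity and coercivity of [Psi]: every nonzero direction u raises
    the exponent on a set that the weight charges. *)
Lemma dom_measure_gt0 x u : dom x -> u != 0 ->
  (0 < H2 R (S `&` [set q : R3 R | (0 < aff x q)%R /\ (0 < tilt u x.1 q)%R]))%E.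
Proof.
case: x => Q eta hd u0; have [p [Sp Qp up]] := dom_separation u hd.
apply: lt_le_trans (pos_measure Sp Qp (up u0)) _.
apply: le_hausdorff2 => q [Sq /= [h1 h2]]; split=> //=.
by rewrite /aff /tilt !subr_gt0.
Qed.

Lemma dom_measure_gt0' x : dom x -> (0 < H2 R (S `&` [set q : R3 R | (0 < aff x q)%R]))%E.
Proof.
case: x => Q eta hd; have [p [Sp Qp _]] := dom_separation 0 hd.
apply: lt_le_trans (pos_measure Sp Qp Qp) _.
by apply: le_hausdorff2 => q [Sq /= [h1 h2]]; split=> //=; rewrite /aff subr_gt0.
Qed.

Lemma weight_gt0 x p : (0 < weight x p) = (0 < aff x p).
Proof. by rewrite /weight lt_max ltxx orbF. Qed.

Lemma partition_fun_gt0 l x : dom x -> 0 < partition_fun l x.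
Proof.
move=> hx; apply: (bounded_int_gt0 mS Sfin (bm_part _ _)).
  by move=> p _; rewrite mulr_ge0 ?expR_ge0 ?weight_ge0.
apply: lt_le_trans (dom_measure_gt0' hx) _; apply: le_hausdorff2 => q [Sq /= h].
by split=> //=; rewrite mulr_gt0 ?expR_gt0// weight_gt0.
Qed.

Lemma Psi_gt0 l x : dom x -> 0 < Psi l x.
Proof. by move=> hx; rewrite PsiE mulr_gt0 ?expR_gt0 ?partition_fun_gt0. Qed.

Lemma dual_energyE Q eta l : dom (Q, eta) -> dual_energy Q eta l = - ln (Psi l (Q, eta)).
Proof.
move=> hx; rewrite PsiE lnM ?posrE ?expR_gt0 ?partition_fun_gt0// expRK.
by rewrite opprD opprK.
Qed.

(* The convexity defect at the midpoint is (e^(s/2) - e^(t/2))^2 / 2. *)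
Lemma expR_mid (s t : R) :
  (expR s + expR t) / 2 = expR ((s + t) / 2) + (expR (s / 2) - expR (t / 2)) ^+ 2 / 2.
Proof.
have h (r : R) : expR r = expR (r / 2) ^+ 2.
  by rewrite expr2 -expRD; congr expR; field.
have -> : expR ((s + t) / 2) = expR (s / 2) * expR (t / 2) by rewrite mulrDl expRD.
by rewrite (h s) (h t); field.
Qed.

(** The integrated midpoint defect has an integrand that is positive wherever the weight is positive
    and the two tilts differ, and l - u has positive tilt on a set of positive measure within the
    support of the weight. *)
Lemma Psi_midpoint_lt l u x : dom x -> l != u ->
  Psi (2^-1 *: (l + u)) x < (Psi l x + Psi u x) / 2.
Proof.
move=> hx lu; rewrite -subr_gt0.
pose f p := (expR (tilt l x.1 p / 2) - expR (tilt u x.1 p / 2)) ^+ 2 / 2 * weight x p.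
have bf : bm f.
  apply: bounded_mfunM (bm_weight x); apply: bounded_mfunM (cst_bm _).
  have bh (k : sym0 R) : bm (fun p => expR (tilt k x.1 p / 2)).
    exact: bounded_mfun_expR (bounded_mfunM (bm_tilt _ _) (cst_bm _)).
  exact: bounded_mfunM (bounded_mfunB (bh _) (bh _)) (bounded_mfunB (bh _) (bh _)).
suff -> : (Psi l x + Psi u x) / 2 - Psi (2^-1 *: (l + u)) x = \int[H2 R]_(p in S) f p.
  apply: (bounded_int_gt0 mS Sfin bf).
    by move=> p _; apply: mulr_ge0 (weight_ge0 _ _); rewrite divr_ge0 ?sqr_ge0.
  have lu0 : l - u != 0 by rewrite subr_eq0.
  apply: lt_le_trans (dom_measure_gt0 hx lu0) _; apply: le_hausdorff2 => q [Sq /= [h1 h2]].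
  split=> //=; rewrite /f mulr_gt0 ?weight_gt0// divr_gt0//.
  rewrite lt_neqAle sqr_ge0 andbT eq_sym sqrf_eq0 subr_eq0.
  apply/eqP => /expR_inj h; move: h2; rewrite tiltB.
  by rewrite (_ : tilt l x.1 q = tilt u x.1 q) ?subrr ?ltxx//; lra.
rewrite /Psi -(bounded_intD mS Sfin (bm_Psi _ _ _) (bm_Psi _ _ _)) mulrC.
have b2 := bounded_mfunD (bm_Psi l x.1 x) (bm_Psi u x.1 x).
rewrite -(bounded_intZ mS Sfin _ b2).
have b3 := bounded_mfunM (cst_bm 2^-1) b2.
rewrite -(bounded_intB mS Sfin b3 (bm_Psi _ _ _)).
apply: eq_on_int => p _; rewrite /f -mulrDl mulrA -mulrBl tiltZ tiltD; congr (_ * _).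
by rewrite mulrC expR_mid (mulrC 2^-1 (_ + _)) addrC addKr.
Qed.

Lemma Psi_min_lt l u x : dom x -> (forall k, Psi l x <= Psi k x) -> l != u ->
  Psi l x < Psi u x.
Proof.
move=> hx hl lu; have h := Psi_midpoint_lt hx lu.
rewrite (ltr_pdivlMr _ _ (ltr0n R 2)) in h.
have := le_lt_trans (ler_wpM2r (ler0n R 2) (hl _)) h.
by rewrite mulr_natr mulr2n ltrD2l.
Qed.

(* Tangent lines of exp at the convex combination. *)
Lemma Psi_convex l u x (t : R) : 0 <= t -> t <= 1 ->
  Psi (l + t *: (u - l)) x <= (1 - t) * Psi l x + t * Psi u x.
Proof.
move=> t0 t1.
rewrite -!(bounded_intZ mS Sfin _ (bm_Psi _ _ _)).
have b (c : R) k : bm (fun p => c * (expR (tilt k x.1 p) * weight x p)).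
  exact: bounded_mfunM (cst_bm _) (bm_Psi _ _ _).
rewrite -(bounded_intD mS Sfin (b _ _) (b _ _)).
apply: (bounded_le mS Sfin (bm_Psi _ _ _)); first exact: bounded_mfunD.
move=> p _; rewrite !mulrA -mulrDl ler_wpM2r ?weight_ge0//.
rewrite tiltD tiltZ tiltB; set s := tilt l _ _; set r := tilt u _ _.
set m := s + t * (r - s).
have e (w : R) : expR m * (1 + (w - m)) <= expR w.
  have -> : expR w = expR m * expR (w - m) by rewrite -expRD subrKC.
  by rewrite ler_pM2l ?expR_gt0// expR_ge1Dx.
have es := e s; have er := e r.
apply: (@le_trans _ _ ((1 - t) * (expR m * (1 + (s - m))) + t * (expR m * (1 + (r - m))))).
  by rewrite le_eqVlt; apply/orP; left; apply/eqP; rewrite /m; ring.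
by apply: lerD; apply: ler_wpM2l => //; rewrite subr_ge0.
Qed.

Lemma tilt_norm_le u Q p : sphere p -> `|tilt u Q p| <= (9 + `|Q|) * `|u|.
Proof.
move=> Sp; apply: le_trans (ler_normB _ _) _; rewrite mulrDl lerD ?quad_norm_le//.
by rewrite mulrC dotm_norm_le.
Qed.

(* exp s >= max (s, 0), and the mean of max (tilt u, 0) is bounded below on the
   unit sphere of Sym_0(3) by compactness. *)
Lemma Psi_coercive x : dom x -> exists2 m, 0 < m & forall l, m * `|l| <= Psi l x.
Proof.
move=> hx.
pose pt u p := maxr (tilt u x.1 p) 0.
have bpt u : bm (fun p => pt u p * weight x p).
  exact: bounded_mfunM (bounded_mfun_max (bm_tilt _ _) (cst_bm _)) (bm_weight x).
pose f u := \int[H2 R]_(p in S) (pt u p * weight x p).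
have f_gt0 u : u != 0 -> 0 < f u.
  move=> u0; apply: (bounded_int_gt0 mS Sfin (bpt u)).
    by move=> p _; rewrite mulr_ge0 ?weight_ge0// /pt le_max lexx orbT.
  apply: lt_le_trans (dom_measure_gt0 hx u0) _; apply: le_hausdorff2 => q [Sq /= [h1 h2]].
  by split=> //=; rewrite mulr_gt0 ?weight_gt0// /pt lt_max h2.
pose W := \int[H2 R]_(p in S) weight x p.
have W0 : 0 <= W by apply: Rintegral_ge0 => p _; exact: weight_ge0.
have f_lip u k : `|f u - f k| <= (9 + `|x.1|) * `|u - k| * W.
  rewrite /f -(bounded_intB mS Sfin (bpt _) (bpt _)) -(bounded_intZ mS Sfin _ (bm_weight x)).
  apply: (bounded_norm_int_le mS Sfin).
  - exact: bounded_mfunB.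
  - exact: bounded_mfunM (cst_bm _) (bm_weight x).
  move=> p Sp; rewrite -mulrBl normrM [X in _ * X]ger0_norm ?weight_ge0// ler_wpM2r ?weight_ge0//.
  apply: le_trans (tilt_norm_le (u - k) x.1 Sp); rewrite tiltB /pt.
  set a := tilt u _ _; set b := tilt k _ _.
  case: (lerP a 0) => ha; case: (lerP b 0) => hb; rewrite ?subrr ?normr0//.
  - by rewrite sub0r normrN gtr0_norm// distrC ler_normr; apply/orP; left; lra.
  - by rewrite subr0 gtr0_norm// ler_normr; apply/orP; left; lra.
have C0 : 0 < (9 + `|x.1|) * W + 1 by rewrite ltr_wpDl// mulr_ge0// addr_ge0.
have cf : continuous f.
  move=> u; apply/(@cvgrPdist_lt _ _ _ (nbhs u)) => e e0; near=> k.
  apply: le_lt_trans (f_lip u k) _.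
  have : ball u (e / ((9 + `|x.1|) * W + 1)) k by near: k; apply: nbhsx_ballx; rewrite divr_gt0//.
  rewrite -ball_normE /= ltr_pdivlMr// mulrDr mulr1 => h.
  by have := normr_ge0 (u - k); rewrite mulrAC (mulrC _ `|_|); lra.
pose K := [set u : sym0 R | `|u - 0| = 1].
have [m m0 hm] : exists2 m, 0 < m & forall u, `|u| = 1 -> m <= f u.
  have [[u0 Ku0]|K0] := pselect (K !=set0); last first.
    exists 1 => // u u1; exfalso; apply: K0; exists u.
    by rewrite /K /= subr0.
  have K0 : K !=set0 by exists u0.
  have [u Ku hu] := compact_EVT_min K0 (@sym0_sphere_compact R 0 1) (continuous_subspaceT cf).
  exists (f u).
    apply: f_gt0; rewrite -normr_gt0.
    by move/set_mem : Ku; rewrite /K /= subr0 => ->.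
  by move=> k k1; apply: hu; apply/mem_set; rewrite /K /= subr0.
exists m => // l; have [->|l0] := eqVneq l 0.
  by rewrite normr0 mulr0 ltW// Psi_gt0.
have ln0 : 0 < `|l| by rewrite normr_gt0.
have nl : `|(`|l|^-1 *: l)| = 1.
  by rewrite normrZ normfV normr_id mulVf// gt_eqF.
apply: (@le_trans _ _ (`|l| * f (`|l|^-1 *: l))); first by rewrite [leLHS]mulrC ler_pM2l// hm.
rewrite /f -(bounded_intZ mS Sfin _ (bpt _)).
apply: (bounded_le mS Sfin); [|exact: bm_Psi|].
  exact: bounded_mfunM (cst_bm _) (bpt _).
move=> p _; rewrite mulrA ler_wpM2r ?weight_ge0// /pt tiltZ.
rewrite maxr_pMr; last exact: ltW.
rewrite mulr0 mulrA divff ?gt_eqF// mul1r.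
rewrite ge_max expR_ge0 andbT.
by have := expR_ge1Dx (tilt l x.1 p); lra.
Unshelve. all: by end_near. Qed.

Lemma Psi_min_exists x : dom x -> exists l, forall k, Psi l x <= Psi k x.
Proof.
move=> hx; have [m m0 hm] := Psi_coercive hx.
(* Outside the ball of radius r, coercivity already gives values above [Psi 0 x]. *)
pose r := Psi 0 x / m.
have r0 : 0 <= r by apply: divr_ge0; apply: ltW => //; exact: Psi_gt0.
pose K := [set l : sym0 R | `|l| <= r].
have cP : continuous (fun l => Psi l x).
  move=> l.
  have h1 : (fun k : sym0 R => k) @ l --> l by exact: cvg_id.
  have h2 : (fun k : sym0 R => x) @ l --> x by exact: (@cvg_cst _ x _ (nbhs l) _).
  have h := @cvg_pair _ _ _ _ _ _ (nbhs_filter l) (nbhs_filter l) (nbhs_filter x) _ _ h1 h2.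
  exact: (cvg_comp _ _ h (@Psi_continuous R l x (dom_eta hx))).
have K0 : K !=set0 by exists 0; rewrite /K /= normr0.
have [l Kl hl] := compact_EVT_min K0 (@sym0_ball_compact R r) (continuous_subspaceT cP).
exists l => k; have [kr|kr] := leP `|k| r; first by apply: hl; exact/mem_set.
have h0 : Psi l x <= Psi 0 x by apply: hl; apply/mem_set; rewrite /K /= normr0.
apply: (le_trans h0); apply: le_trans (hm k).
by move: kr; rewrite /r ltr_pdivrMr// mulrC => /ltW.
Qed.

(** From exp(-s) >= 1 - s one gets (1 - s) exp s <= 1, while (1 - s)(1 + s + 2 s^2) = 1 + s^2 (1 -
    2s) >= 1. This second-order bound yields the first-order condition without differentiating an
    integral. *)
Lemma expR_le_quadratic (s : R) : `|s| <= 2^-1 -> expR s <= 1 + s + 2 * s ^+ 2.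
Proof.
rewrite ler_norml => /andP[s1 s2].
have h := expR_ge1Dx (- s); rewrite expRN in h.
have e0 := expR_gt0 s.
have : (1 - s) * expR s <= 1.
  by rewrite -(@ler_pM2r _ (expR s)^-1) ?invr_gt0// mulfK ?gt_eqF// mul1r.
have : 1 <= (1 - s) * (1 + s + 2 * s ^+ 2).
  have -> : (1 - s) * (1 + s + 2 * s ^+ 2) = 1 + s ^+ 2 * (1 - 2 * s) by ring.
  by rewrite lerDl mulr_ge0 ?sqr_ge0//; lra.
move=> h1 h2; rewrite -(@ler_pM2l _ (1 - s)); last by lra.
exact: le_trans h2 h1.
Qed.

(** Integrating the quadratic bound at l + tB, minimality gives 0 <= t K1 + 2 t^2 K2 for all small t
    of either sign. The constant [C] dominates the tilt of B on the sphere and so makes the bound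
    applicable when |t| C <= 1/2. *)
Lemma Psi_first_order l x B : (forall k, Psi l x <= Psi k x) ->
  \int[H2 R]_(p in S) (expR (tilt l x.1 p) * weight x p * tilt B x.1 p) = 0.
Proof.
move=> hl.
pose g p := expR (tilt l x.1 p) * weight x p.
have bg : bm g := bm_Psi _ _ _.
have g0 p : 0 <= g p by rewrite mulr_ge0 ?expR_ge0 ?weight_ge0.
have b1 : bm (fun p => g p * tilt B x.1 p) := bounded_mfunM bg (bm_tilt _ _).
have b2 : bm (fun p => g p * tilt B x.1 p * tilt B x.1 p) := bounded_mfunM b1 (bm_tilt _ _).
set K1 := \int[H2 R]_(p in S) _.
pose K2 := \int[H2 R]_(p in S) (g p * tilt B x.1 p * tilt B x.1 p).
have K20 : 0 <= K2.
  by apply: Rintegral_ge0 => p _; rewrite -mulrA mulr_ge0// -expr2 sqr_ge0.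
pose C := (9 + `|x.1|) * `|B| + 1.
have C0 : 0 < C by rewrite ltr_wpDl// mulr_ge0// addr_ge0.
have key (t : R) : `|t| * C <= 2^-1 -> 0 <= t * K1 + 2 * t ^+ 2 * K2.
  move=> tC; rewrite -(lerD2l (Psi l x)) addr0; apply: le_trans (hl (l + t *: B)) _.
  rewrite addrA -(bounded_intZ mS Sfin t b1) -(bounded_intZ mS Sfin _ b2).
  rewrite -(bounded_intD mS Sfin bg (bounded_mfunM (cst_bm t) b1)).
  have b3 := bounded_mfunD bg (bounded_mfunM (cst_bm t) b1).
  have b4 := bounded_mfunM (cst_bm (2 * t ^+ 2)) b2.
  rewrite -(bounded_intD mS Sfin b3 b4).
  apply: (bounded_le mS Sfin (bm_Psi _ _ _)); first exact: bounded_mfunD.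
  move=> p Sp; rewrite tiltD tiltZ expRD.
  have -> : g p + t * (g p * tilt B x.1 p) + 2 * t ^+ 2 * (g p * tilt B x.1 p * tilt B x.1 p) =
    g p * (1 + t * tilt B x.1 p + 2 * (t * tilt B x.1 p) ^+ 2) by ring.
  rewrite mulrAC; apply: ler_wpM2l; first exact: g0.
  apply: expR_le_quadratic.
  rewrite normrM; apply: le_trans tC; rewrite ler_wpM2l//.
  by apply: le_trans (tilt_norm_le _ _ Sp) _; rewrite lerDl.
apply/eqP; apply: contraT => K10.
have K1p : 0 < `|K1| by rewrite normr_gt0.
(* The first bound makes the quadratic estimate available. The second makes 2 t K2 smaller than
   |K1|, so moving against the sign of K1 would lower [Psi]. *)
pose t := minr ((2 * C)^-1) (`|K1| / (4 * (K2 + 1))).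
have t0 : 0 < t.
  by rewrite lt_min invr_gt0 mulr_gt0//= divr_gt0// mulr_gt0// ltr_wpDl.
have tC : t * C <= 2^-1.
  rewrite -ler_pdivlMr// -invfM mulrC; first by rewrite mulrC /t ge_min lexx.
have tK : t * (4 * (K2 + 1)) <= `|K1|.
  by rewrite -ler_pdivlMr ?mulr_gt0 ?ltr_wpDl// /t ge_min lexx orbT.
have := key (- (Num.sg K1 * t)).
rewrite normrN normrM normr_sg K10 mul1r gtr0_norm// => /(_ tC).
rewrite sqrrN exprMn sqr_sg K10 mul1r.
have -> : - (Num.sg K1 * t) * K1 = - (t * `|K1|).
  by rewrite [in RHS]normrEsg; ring.
have -> : - (t * `|K1|) + 2 * t ^+ 2 * K2 = - (t * (`|K1| - 2 * t * K2)) by ring.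
rewrite oppr_ge0 pmulr_rle0// subr_le0 leNgt => /negP[].
have := mulr_ge0 (ltW t0) K20; lra.
Qed.

End variational.

(** * Optimal densities *)

Section semibounded_integral.
Context d (T : measurableType d) (R : realType).
Variables (mu : {measure set T -> \bar R}) (D : set T).
Hypothesis mD : measurable D.
Local Open Scope ereal_scope.

(** Monotonicity of the integral, with its equality case, for an extended-valued F that is only
    known to dominate an integrable k almost everywhere. This is how the free energy, possibly
    infinite, is compared with its lower bound. *)
Lemma semibounded_integral (F : T -> \bar R) (k : T -> R) :
  measurable_fun D F -> mu.-integrable D (EFin \o k) ->
  {ae mu, forall p, D p -> (k p)%:E <= F p} ->
  (\int[mu]_(p in D) k p)%R%:E <= \int[mu]_(p in D) F p /\
  (\int[mu]_(p in D) F p = (\int[mu]_(p in D) k p)%R%:E ->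
   {ae mu, forall p, D p -> F p = (k p)%:E}).
Proof.
move=> mF ik kF.
have [mk koo] := integrableP _ _ _ ik.
have kfin : \int[mu]_(p in D) (k p)%:E = (\int[mu]_(p in D) k p)%R%:E.
  by rewrite fineK//; exact: integrable_fin_num ik.
rewrite -kfin.
(* The excess of F over k, truncated so that it is nonnegative everywhere and not only almost
   everywhere. *)
pose h p := maxe (F p - (k p)%:E) 0.
have mh : measurable_fun D h.
  apply: measurable_maxe; last exact: measurable_cst.
  exact: emeasurable_funB mF mk.
have h0 p : 0 <= h p by rewrite /h le_max lexx orbT.
have Fh : {ae mu, forall p, D p -> F p = h p + (k p)%:E}.
  apply: filterS kF => p kFp Dp; rewrite /h max_l; last by rewrite sube_ge0// kFp.
  by rewrite subeK.
pose G p := h p + (k p)%:E.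
have mG : measurable_fun D G := emeasurable_funD mh mk.
have -> : \int[mu]_(p in D) F p = \int[mu]_(p in D) G p by exact: ae_eq_integral.
have [hoo|hoo] := ltP (\int[mu]_(p in D) h p) +oo.
  have ih : mu.-integrable D h.
    apply/integrableP; split=> //; apply: le_lt_trans hoo.
    by rewrite le_eqVlt; apply/orP; left; apply/eqP; apply: eq_integral => p _; rewrite gee0_abs.
  have hfin : \int[mu]_(p in D) h p \is a fin_num := integrable_fin_num mD ih.
  have -> : \int[mu]_(p in D) G p = \int[mu]_(p in D) h p + \int[mu]_(p in D) (k p)%:E.
    exact: (integralD mD ih ik).
  split; first by rewrite leeDr// integral_ge0.
  rewrite kfin -(fineK hfin) -EFinD => -[] E.
  have {}E : fine (\int[mu]_(p in D) h p) = 0%R by lra.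
  have h00 : \int[mu]_(p in D) `|h p| = 0.
    transitivity (\int[mu]_(p in D) h p).
      by apply: eq_integral => p _; rewrite gee0_abs.
    by rewrite -(fineK hfin) E.
  have := (ae_eq_integral_abs mu mD mh).1 h00.
  by apply: filterS2 Fh => p Fp hp Dp; rewrite Fp// hp// add0e.
(* Infinite excess: the negative part of [G] is at most |k|, hence has finite integral, so the
   positive part carries infinite mass. The integral is then +oo and the equality case cannot
   occur. *)
have {}hoo : \int[mu]_(p in D) h p = +oo by apply/eqP; rewrite -leye_eq.
have Gn : \int[mu]_(p in D) G^\- p < +oo.
  apply: le_lt_trans koo; apply: ge0_le_integral => //.
  - exact: measurable_funeneg.
  - exact: measurableT_comp.
  move=> p _; rewrite funenegE ge_max abse_ge0 andbT /G.
  rewrite fin_num_oppeD// -[leRHS]add0e leeD//; first by rewrite leeNl oppe0.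
  by rewrite -EFinN lee_fin -normrN ler_norm.
suff Gp : \int[mu]_(p in D) G^\+ p = +oo.
  have -> : \int[mu]_(p in D) G p = +oo.
    rewrite integralE Gp addye// eqe_oppLR/=.
    by apply/eqP => Gn'; rewrite Gn' ltxx in Gn.
  by split; [exact: leey|rewrite kfin].
apply/eqP; rewrite -leye_eq leNgt; apply/negP => Gp.
have : \int[mu]_(p in D) h p <= \int[mu]_(p in D) G^\+ p + \int[mu]_(p in D) `|(k p)%:E|.
  rewrite -ge0_integralD//; [|exact: measurable_funepos|exact: measurableT_comp].
  apply: ge0_le_integral => //.
  - by apply: emeasurable_funD; [exact: measurable_funepos|exact: measurableT_comp].
  move=> p _; apply: (@le_trans _ _ (G p + `|(k p)%:E|)).
    rewrite /G -addeA -[leLHS]adde0 leeD2l// -EFinD lee_fin.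
    by have := ler_norm (- k p)%R; rewrite normrN; lra.
  by rewrite leeD2r// funeposE le_max lexx.
rewrite hoo leye_eq => /eqP E.
by have := lte_add_pinfty Gp koo; rewrite E ltxx.
Qed.
Lemma integrable_Rintegral_sum I (s : seq I) (h : I -> T -> R) :
  (forall i, mu.-integrable D (EFin \o h i)) ->
  mu.-integrable D (EFin \o (fun p => \sum_(i <- s) h i p)%R) /\
  (\int[mu]_(p in D) (\sum_(i <- s) h i p) = \sum_(i <- s) \int[mu]_(p in D) h i p)%R.
Proof.
move=> hi; elim: s => [|a s [si IH]].
  have -> : (fun p => \sum_(i <- [::]) h i p)%R = (fun=> 0%R).
    by apply/funext => p; rewrite big_nil.
  by split; [exact: integrable0|rewrite big_nil Rintegral_cst// mul0r].
have -> : (fun p => \sum_(i <- a :: s) h i p)%R = (fun p => h a p + \sum_(i <- s) h i p)%R.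
  by apply/funext => p; rewrite big_cons.
rewrite big_cons -IH; split; last exact: RintegralD.
have -> : EFin \o (fun p => h a p + \sum_(i <- s) h i p)%R =
    (EFin \o h a) \+ (EFin \o (fun p => \sum_(i <- s) h i p)%R) by [].
exact: integrableD.
Qed.

Lemma integrable_mul_bounded (f g : T -> R) :
  mu.-integrable D (EFin \o f) -> bounded_mfun D g ->
  mu.-integrable D (EFin \o (fun p => f p * g p)%R).
Proof.
move=> fi [mg [C hC]].
have := integrableMl mD fi mg.
have -> : (EFin \o f) \* (EFin \o g) = EFin \o (fun p => f p * g p)%R.
  by apply/funext => p; rewrite /= EFinM.
apply; exists C; split; first exact: num_real.
by move=> M /ltW CM p Sp; exact: le_trans (hC p Sp) CM.
Qed.

End semibounded_integral.

(** * Gibbs' inequality at a point *)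

Section gibbs.
Variable R : realType.

(** For a, w > 0 put t = ln (g / a). The difference of the two sides is a (exp t - 1 - t), which is
    nonnegative and vanishes only at t = 0. If a = 0 the claim is -g <= 0. If w <= 0 < a then F =
    +oo and g = 0, so both equalities fail. *)
Lemma gibbs_pointwise (a w e : R) : 0 <= a ->
  let F := (a%:E * lne a%:E - a%:E * lne w%:E)%E in
  let g := expR e * maxr w 0 in
  ((a * e + a - g)%:E <= F)%E /\ (F = (a * e + a - g)%:E <-> a = g).
Proof.
move=> a0 F g.
have g0 : 0 <= g by rewrite mulr_ge0 ?expR_ge0// le_max lexx orbT.
have [aE|a_neq] := eqVneq a 0.
  have -> : F = 0%E by rewrite /F aE !mul0e sube0.
  rewrite aE mul0r !add0r; split; first by rewrite lee_fin oppr_le0.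
  by split=> [[h]|<-]; [lra|rewrite oppr0].
have ap : 0 < a by rewrite lt_neqAle eq_sym a_neq.
have la : lne a%:E = (ln a)%:E by rewrite lne_EFin.
have [w0|w0] := leP w 0.
  have -> : F = +oo%E.
    by rewrite /F la (le0_lneNy (_ : w%:E <= 0)%E)// gt0_muleNy.
  split; first exact: leey.
  by split=> // ag; move: ap; rewrite ag /g max_r// mulr0 ltxx.
have lw : lne w%:E = (ln w)%:E by rewrite lne_EFin.
have gE : g = expR e * w by rewrite /g max_l// ltW.
pose t := e + ln w - ln a.
have et : g = a * expR t.
  rewrite gE /t expRD expRN !expRD !lnK ?posrE// mulrCA mulfV ?mulr1//.
have -> : F = (a * ln a - a * ln w)%:E by rewrite /F la lw -!EFinM -EFinB.
have D : a * ln a - a * ln w = a * e + a - g + a * (expR t - (1 + t)).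
  by rewrite et /t; ring.
split; first by rewrite lee_fin D lerDl mulr_ge0// subr_ge0 expR_ge1Dx.
split=> [[]|ag].
  rewrite D => /eqP; rewrite -subr_eq0 addrC addKr mulf_eq0 (negbTE a_neq)/= => /eqP h.
  have [t0|/expR_gt1Dx] := eqVneq t 0; last by lra.
  by rewrite et t0 expR0 mulr1.
have : expR t = 1 by apply: (mulfI a_neq); rewrite mulr1 -et.
rewrite -{1}expR0 => /expR_inj t0; rewrite D t0 expR0.
by congr EFin; ring.
Qed.

End gibbs.

(** * Second moments tested against traceless matrices *)

Section duality.
Variable R : realType.
Implicit Types (l L u B : sym0 R) (x : sym0 R * R) (p : R3 R) (f : R3 R -> R).
Local Notation S := (@sphere R : set (R3 R)).
Local Notation mS := (@measurable_sphere R).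
Local Notation Sfin := (@H2_sphere_lty R).
Local Notation bm := (bounded_mfun S).
Local Notation cst_bm := (bounded_mfun_cst S).

Definition gibbs_density L x p : R := expR (quad L p) * weight x p / partition_fun L x.

Lemma bm_gibbs_density L x : bm (gibbs_density L x).
Proof. exact: bounded_mfunM (bm_part L x) (cst_bm _). Qed.

Lemma dotm_qtensor (B : 'M[R]_3) (p : 'cV[R]_3) : \tr B = 0 ->
  dotm B (qtensor p) = quad B p.
Proof.
move=> tB; rewrite /dotm /qtensor mulmxBr raddfB/= mulmxA mxtrace_mulC.
rewrite -scalemx1 -scalemxAr mulmx1 linearZ/= tB mulr0 subr0.
by rewrite /quad dotvC dotvE /mxtrace big_ord1.
Qed.

Lemma qtensor_sym0 (p : 'cV[R]_3) : sphere p -> qtensor p \in @is_sym0 R.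
Proof.
move=> /sphereP Sp; rewrite unfold_in; apply/andP; split; apply/eqP.
  by rewrite /qtensor linearB/= trmx_mul trmxK tr_scalar_mx.
rewrite /qtensor raddfB/= mxtrace_mulC mxtrace_scalar {1}/mxtrace big_ord1 -dotvE Sp.
by rewrite -[_ *+ 3]mulr_natr mulVf ?subrr.
Qed.

Lemma qtensor_entry_le (p : 'cV[R]_3) i j : sphere p -> `|qtensor p i j| <= 2.
Proof.
move=> Sp; rewrite /qtensor !mxE big_ord1 mxE.
apply: le_trans (ler_normB _ _) _; have -> : (2 : R) = 1 + 1 by [].
apply: lerD; first by rewrite normrM -[leRHS]mulr1 ler_pM ?coord_sphere.
case: (i == j); rewrite ?mulr1n ?mulr0n ?normr0//.
by rewrite ger0_norm ?invr_ge0// invf_le1// ler1n.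
Qed.

Lemma measurable_qtensor_entry i j : measurable_fun setT (fun p : R3 R => qtensor p i j).
Proof.
have -> : (fun p : R3 R => qtensor p i j) =
    (fun p : R3 R => (p : 'cV[R]_3) i 0 * (p : 'cV[R]_3) j 0 - (3%:R^-1 : R) *+ (i == j)).
  by apply/funext => p; rewrite /qtensor !mxE big_ord1 mxE.
exact: measurable_funB (measurable_funM (measurable_coord i) (measurable_coord j)) (measurable_cst _).
Qed.

Lemma bm_qtensor i j : bm (fun p => qtensor p i j).
Proof.
split; first exact: measurable_funTS (measurable_qtensor_entry i j).
by exists 2 => p; exact: qtensor_entry_le.
Qed.

Lemma dotm_mxintegral (B : 'M[R]_3) f : \tr B = 0 ->
  (H2 R).-integrable S (EFin \o f) ->
  dotm B (mxintegral S (fun p => f p *: qtensor p)) = \int[H2 R]_(p in S) (f p * quad B p).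
Proof.
move=> tB fi.
have fq i j := integrable_mul_bounded mS fi (bm_qtensor i j).
have ij i j : (H2 R).-integrable S (EFin \o (fun p => B i j * (f p * qtensor p j i))).
  exact: (integrableZl mS (B i j) (fq j i)).
transitivity (\int[H2 R]_(p in S) (\sum_i \sum_j B i j * (f p * qtensor p j i))).
  have [_ ->] := integrable_Rintegral_sum mS (index_enum 'I_3)
    (fun i => (integrable_Rintegral_sum mS (index_enum 'I_3) (ij i)).1).
  rewrite /dotm /mxtrace; apply: eq_bigr => i _.
  have [_ ->] := integrable_Rintegral_sum mS (index_enum 'I_3) (ij i).
  rewrite mxE; apply: eq_bigr => j _.
  rewrite (RintegralZl (B i j) mS (fq j i)) [X in _ * X]mxE; congr (_ * _).
  by apply: eq_on_int => p _; rewrite mxE.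
apply: eq_on_int => p Sp; rewrite -(dotm_qtensor _ tB) /dotm /mxtrace mulr_sumr.
apply: eq_bigr => i _; rewrite mxE mulr_sumr; apply: eq_bigr => j _.
by rewrite mulrCA.
Qed.

End duality.

(** * The Gibbs density is the unique minimiser of the free energy *)

Section optimal_density.
Variable R : realType.
Implicit Types (L B Q : sym0 R) (eta : R) (p : R3 R) (f : R3 R -> R).
Local Notation S := (@sphere R : set (R3 R)).
Local Notation mS := (@measurable_sphere R).
Local Notation Sfin := (@H2_sphere_lty R).
Local Notation bm := (bounded_mfun S).
Local Notation cst_bm := (bounded_mfun_cst S).

Lemma gibbs_density_ge0 L x p : dom x -> 0 <= gibbs_density L x p.
Proof.
move=> hx; rewrite divr_ge0 ?mulr_ge0 ?expR_ge0 ?weight_ge0//.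
exact: ltW (partition_fun_gt0 L hx).
Qed.

Lemma gibbs_density_int1 L x : dom x -> \int[H2 R]_(p in S) gibbs_density L x p = 1.
Proof.
move=> hx; have Z0 := partition_fun_gt0 L hx.
transitivity (\int[H2 R]_(p in S) ((partition_fun L x)^-1 * (expR (quad L p) * weight x p))).
  by apply: eq_on_int => p _; rewrite mulrC.
by rewrite (bounded_intZ mS Sfin _ (bm_part _ _)) mulVf// gt_eqF.
Qed.

(** The first-order condition in direction B says that [tilt B] has mean zero under the Gibbs
    density. The constant [c] converts the integrand of [Psi] into that density. *)
Lemma gibbs_density_moment L B x : dom x -> (forall l, Psi L x <= Psi l x) ->
  \int[H2 R]_(p in S) (gibbs_density L x p * quad B p) = dotm B x.1.
Proof.
move=> hx hL; have Z0 := partition_fun_gt0 L hx.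
pose c := (partition_fun L x)^-1 * expR (dotm L x.1).
have b1 : bm (fun p => expR (tilt L x.1 p) * weight x p * tilt B x.1 p).
  exact: bounded_mfunM (bm_Psi _ _ _) (bm_tilt _ _).
transitivity (\int[H2 R]_(p in S) (c * (expR (tilt L x.1 p) * weight x p * tilt B x.1 p) +
    dotm B x.1 * gibbs_density L x p)).
  apply: eq_on_int => p _; rewrite /gibbs_density /c.
  have -> : expR (quad L p) = expR (tilt L x.1 p) * expR (dotm L x.1).
    by rewrite -expRD subrK.
  by have -> : tilt B x.1 p = quad B p - dotm B x.1 by []; ring.
rewrite (bounded_intD mS Sfin); last 2 first.
- exact: bounded_mfunM (cst_bm c) b1.
- exact: bounded_mfunM (cst_bm _) (bm_gibbs_density L x).
rewrite (bounded_intZ mS Sfin _ b1) (bounded_intZ mS Sfin _ (bm_gibbs_density L x)).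
by rewrite (Psi_first_order B hL) mulr0 add0r gibbs_density_int1// mulr1.
Qed.

Lemma mxintegral_qtensor_sym0 f : (H2 R).-integrable S (EFin \o f) ->
  mxintegral S (fun p => f p *: qtensor p) \in @is_sym0 R.
Proof.
move=> fi; rewrite unfold_in; apply/andP; split; apply/eqP.
  apply/matrixP => i j; rewrite !mxE; apply: eq_on_int => p /qtensor_sym0.
  by rewrite unfold_in => /andP[/eqP/matrixP/(_ i j) + _]; rewrite !mxE => ->.
have fq i := integrable_mul_bounded mS fi (@bm_qtensor R i i).
have [_] := integrable_Rintegral_sum mS (index_enum 'I_3) fq => sE.
rewrite /mxtrace; transitivity (\sum_i \int[H2 R]_(p in S) (f p * qtensor p i i)).
  by apply: eq_bigr => i _; rewrite mxE; apply: eq_on_int => p _; rewrite mxE.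
rewrite -sE; transitivity (\int[H2 R]_(p in S) (0 : R)).
  apply: eq_on_int => p /qtensor_sym0; rewrite unfold_in => /andP[_ /eqP tr0].
  by rewrite -mulr_sumr -[X in _ * X]/(\tr (qtensor p)) tr0 mulr0.
by rewrite Rintegral_cst ?mul0r//; exact: mS.
Qed.

(** The moments are known only against elements of Sym_0(3), but the error N - Q is one of them;
    tested against itself it has norm zero. *)
Lemma gibbs_density_admissible L Q eta : dom (Q, eta) ->
  (forall l, Psi L (Q, eta) <= Psi l (Q, eta)) ->
  admissible Q (gibbs_density L (Q, eta)).
Proof.
move=> hx hL; have fi := bounded_mfun_int mS Sfin (bm_gibbs_density L (Q, eta)).
split.
  split; first exact: fi.
    by apply: aeW => p _; exact: gibbs_density_ge0.
  exact: gibbs_density_int1.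
pose N : sym0 R := Sym0 (mxintegral_qtensor_sym0 fi).
suff h : N - Q = 0 by exact: (congr1 (@sym0_val R) (subr0_eq h)).
apply: dotm_sym0_eq0.
have -> : dotm (N - Q : sym0 R) (N - Q : sym0 R) =
    dotm (N - Q : sym0 R) N - dotm (N - Q : sym0 R) Q.
  by rewrite -[in RHS]mulN1r -dotmZr -dotmDr scaleN1r.
have := dotm_mxintegral (sym0_tr0 (N - Q)) fi.
by rewrite (gibbs_density_moment (N - Q) hx hL) => ->; rewrite subrr.
Qed.

Lemma measurable_lne_EFin : measurable_fun setT (fun r : R => lne r%:E).
Proof.
rewrite (_ : (fun r : R => lne r%:E) = (fun r => if r <= 0 then -oo%E else (ln r)%:E))//.
apply: measurable_fun_ifT.
- by apply: (@measurable_fun_ler _ _ _ setT (fun r : R => r) (fun=> 0)) => //; exact: measurable_id.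
- exact: measurable_cst.
- by apply/measurable_EFinP; exact: measurable_ln.
Qed.

(** The pointwise inequality is applied with e = quad L - ln Z, for which g is the Gibbs density.
    The lower bound f e + f - g has the same integral L.Q - ln Z for all admissible f, since f and g
    have mass 1 and the second moments of f are prescribed. *)
Lemma free_energy_ge L Q eta f : dom (Q, eta) ->
  (forall l, Psi L (Q, eta) <= Psi l (Q, eta)) -> admissible Q f ->
  ((- ln (Psi L (Q, eta)))%:E <= free_energy Q eta f)%E /\
  (free_energy Q eta f = (- ln (Psi L (Q, eta)))%:E <->
    {ae H2 R, forall p, sphere p -> f p = gibbs_density L (Q, eta) p}).
Proof.
set x := (Q, eta) => hx hL [[fi f0 f1] fQ].
have Z0 := partition_fun_gt0 L hx; set Z := partition_fun L x in Z0.
pose F (p : R3 R) := ((f p)%:E * lne (f p)%:E - (f p)%:E * lne (quad Q p - eta)%:E)%E.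
pose e p := quad L p - ln Z.
pose k p := f p * e p + f p - gibbs_density L x p.
have gE p : expR (e p) * maxr (quad Q p - eta) 0 = gibbs_density L x p.
  by rewrite /e expRD expRN lnK ?posrE// mulrAC.
have be : bm e := bounded_mfunB (bm_quad L) (cst_bm _).
have fe := integrable_mul_bounded mS fi be.
have gi := bounded_mfun_int mS Sfin (bm_gibbs_density L x).
have fef : (H2 R).-integrable S (EFin \o (fun p => f p * e p + f p)).
  exact: (integrableD mS fe fi).
have ki : (H2 R).-integrable S (EFin \o k) := integrableB mS fef gi.
have Ik : \int[H2 R]_(p in S) k p = - ln (Psi L x).
  rewrite (RintegralB mS fef gi) (RintegralD mS fe fi) f1 (gibbs_density_int1 L hx) addrK.
  have -> : \int[H2 R]_(p in S) (f p * e p) = dotm L Q - ln Z.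
    have fq := integrable_mul_bounded mS fi (bm_quad L).
    transitivity (\int[H2 R]_(p in S) (f p * quad L p - ln Z * f p)).
      by apply: eq_on_int => p _; rewrite /e; ring.
    rewrite (RintegralB mS fq (integrableZl mS (ln Z) fi)) (RintegralZl _ mS fi) f1 mulr1.
    by rewrite -(dotm_mxintegral (sym0_tr0 L) fi) fQ.
  by rewrite PsiE lnM ?posrE ?expR_gt0// expRK opprD opprK.
have mf : measurable_fun S f.
  by apply/measurable_EFinP; exact: measurable_int fi.
have mF : measurable_fun S F.
  apply: emeasurable_funB; apply: emeasurable_funM.
  - exact/measurable_EFinP.
  - exact: measurableT_comp measurable_lne_EFin mf.
  - exact/measurable_EFinP.
  - apply: (measurableT_comp measurable_lne_EFin).
    exact: measurable_funTS (measurable_aff x).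
have FF := ae_filter_ringOfSetsType (H2 R).
have kF : {ae H2 R, forall p, S p -> ((k p)%:E <= F p)%E}.
  apply: (@filterS _ _ FF _ _ _ f0) => p f0p Sp; have [h _] := gibbs_pointwise (quad Q p - eta) (e p) (f0p Sp).
  by rewrite /k -gE.
have [h1 h2] := semibounded_integral mS mF ki kF.
rewrite Ik in h1 h2; split=> //; split=> [/h2 Fk0|fg].
  apply: (@filterS2 _ _ FF _ _ _ _ f0 Fk0) => p f0p Fk Sp.
  have [_ [h _]] := gibbs_pointwise (quad Q p - eta) (e p) (f0p Sp).
  by rewrite -gE; apply: h; rewrite gE; exact: Fk.
transitivity (\int[H2 R]_(p in S) (k p)%:E)%E; last first.
  by rewrite -Ik [RHS](fineK (integrable_fin_num mS ki)).
have Fk : ae_eq (H2 R) S F (EFin \o k).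
  apply: (@filterS2 _ _ FF _ _ _ _ f0 fg) => p f0p fgp Sp.
  have [_ [_ h]] := gibbs_pointwise (quad Q p - eta) (e p) (f0p Sp).
  by rewrite gE in h; apply: h; exact: fgp.
have [mk _] := integrableP _ _ _ ki.
exact: (@ae_eq_integral _ _ _ (H2 R) S (EFin \o k) F mS mF mk Fk).
Qed.

Lemma J_eq L Q eta : dom (Q, eta) -> (forall l, Psi L (Q, eta) <= Psi l (Q, eta)) ->
  J Q eta = (- ln (Psi L (Q, eta)))%:E.
Proof.
move=> hx hL; apply/eqP; rewrite eq_le; apply/andP; split; last first.
  by apply: le_ereal_inf_tmp => _ [f fA <-]; exact: (free_energy_ge hx hL fA).1.
apply: ereal_inf_lbound; have gA := gibbs_density_admissible hx hL.
exists (gibbs_density L (Q, eta)) => //.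
by apply/(free_energy_ge hx hL gA).2; exact: aeW.
Qed.

Lemma is_optimalP L Q eta f : dom (Q, eta) ->
  (forall l, Psi L (Q, eta) <= Psi l (Q, eta)) ->
  is_optimal Q eta f <-> admissible Q f /\
    {ae H2 R, forall p, sphere p -> f p = gibbs_density L (Q, eta) p}.
Proof.
move=> hx hL; split=> -[fA h]; split=> //.
  by apply/(free_energy_ge hx hL fA).2; rewrite h (J_eq hx hL).
by rewrite (J_eq hx hL); apply/(free_energy_ge hx hL fA).2.
Qed.

End optimal_density.

(** * Differentiability *)

Section danskin.
Variable R : realType.
Implicit Types (l L u B Q : sym0 R) (x y v : sym0 R * R) (p : R3 R).
Local Notation S := (@sphere R : set (R3 R)).
Local Notation mS := (@measurable_sphere R).
Local Notation Sfin := (@H2_sphere_lty R).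

Lemma is_dual_maximiserP Q eta L : dom (Q, eta) ->
  is_dual_maximiser Q eta L <-> forall l, Psi L (Q, eta) <= Psi l (Q, eta).
Proof.
move=> hx; have P0 l : Psi l (Q, eta) \is Num.pos by rewrite posrE Psi_gt0.
by split=> h l; move: (h l); rewrite !(dual_energyE _ hx) lerN2 (ler_ln (P0 _) (P0 _)).
Qed.

Definition opt_mult x := Lambda x.1 x.2.

Lemma opt_mult_maximiser x : dom x -> is_dual_maximiser x.1 x.2 (opt_mult x).
Proof.
case: x => Q eta hx; apply: (@getPex _ (is_dual_maximiser Q eta)).
have [L hL] := Psi_min_exists hx.
by exists L; exact: (is_dual_maximiserP L hx).2 hL.
Qed.

Lemma opt_mult_min x l : dom x -> Psi (opt_mult x) x <= Psi l x.
Proof.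
case: x => Q eta hx.
exact: (@is_dual_maximiserP Q eta (opt_mult (Q, eta)) hx).1 (opt_mult_maximiser hx) l.
Qed.

Definition Jfun x := fine (J x.1 x.2).

Lemma ln_PsiE l x : dom x -> - ln (Psi l x) = dotm l x.1 - ln (partition_fun l x).
Proof.
move=> hx; have Z0 := partition_fun_gt0 l hx.
by rewrite PsiE lnM ?posrE ?expR_gt0// expRK opprD opprK.
Qed.

Lemma JfunE x : dom x -> Jfun x = dotm (opt_mult x) x.1 - ln (partition_fun (opt_mult x) x).
Proof.
case: x => Q eta hx; rewrite /Jfun [X in fine X](J_eq hx (fun l => opt_mult_min l hx)).
exact: ln_PsiE.
Qed.

Lemma Jfun_ge x l : dom x -> dotm l x.1 - ln (partition_fun l x) <= Jfun x.
Proof.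
move=> hx; rewrite (JfunE hx) -!(ln_PsiE _ hx) lerN2.
have P0 k : Psi k x \is Num.pos by rewrite posrE Psi_gt0.
by rewrite (ler_ln (P0 _) (P0 _)); exact: opt_mult_min.
Qed.

Lemma near_norm x (d : R) : 0 < d -> \forall y \near x, `|x - y| < d.
Proof.
move=> d0; near=> y.
have : ball x d y by near: y; exact: nbhsx_ballx.
by rewrite -ball_normE.
Unshelve. all: by end_near. Qed.

Lemma dom_near x0 : dom x0 -> \forall x \near x0, dom x.
Proof.
move=> [/physicalP[c c3 hc] heta].
(* A move by d changes the form by at most 9d, half of the margin c + 1/3. With [M], the loss 2 |Q0|
   r in |Q|^2 and the gain r in eta together stay below the margin [D]. *)
pose d := (c + 3%:R^-1) / 18; have d0 : 0 < d by rewrite divr_gt0//; lra.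
pose D := `|x0.1| ^+ 2 - x0.2; have D0 : 0 < D by rewrite subr_gt0.
pose M := 2 * `|x0.1| + 2; have M0 : 0 < M by rewrite ltr_wpDl// mulr_ge0.
near=> x.
have xd : `|x0 - x| < d by near: x; exact: near_norm.
have xD : `|x0 - x| < D / M by near: x; apply: near_norm; rewrite divr_gt0.
have n1 : `|x0.1 - x.1| <= `|x0 - x| by rewrite [leRHS]prod_normE le_max lexx.
have n2 : `|x0.2 - x.2| <= `|x0 - x| by rewrite [leRHS]prod_normE le_max lexx orbT.
split.
  apply/physicalP; exists (c - 9 * d); first by rewrite /d; lra.
  move=> p Sp; have := quad_norm_le (x0.1 - x.1) Sp; rewrite quadB => h.
  have := hc p Sp; have := le_trans (ler_norm _) h.
  by have := le_lt_trans n1 xd; lra.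
have xDM : `|x0 - x| * M < D by rewrite -ltr_pdivlMr.
have tri : `|x0.1| <= `|x.1| + `|x0.1 - x.1|.
  by rewrite -{1}(subrKC x.1 x0.1); exact: ler_normD.
have h2 : x.2 <= x0.2 + `|x0 - x|.
  by have := le_trans (ler_norm (- (x0.2 - x.2))); rewrite normrN => /(_ _ n2); lra.
have N0 := normr_ge0 (x0 - x); have N1 := normr_ge0 x0.1; have N2 := normr_ge0 x.1.
have h3 : `|x0.1| ^+ 2 - 2 * `|x0.1| * `|x0 - x| <= `|x.1| ^+ 2.
  have [ge|lt] := leP `|x0 - x| `|x0.1|; last by nra.
  have : (`|x0.1| - `|x0 - x|) ^+ 2 <= `|x.1| ^+ 2.
    by rewrite ler_pXn2r ?nnegrE ?subr_ge0//; lra.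
  by nra.
move: xDM; rewrite /M /D; nra.
Unshelve. all: by end_near. Qed.

(** On the sphere [K] around [L0], [Psi] at [x0] exceeds its minimum strictly; compactness and joint
    continuity preserve Psi L0 x < Psi l x on [K] for x near [x0]. A minimiser L for x lying beyond
    [K] would contradict this, because the segment from [L0] to L meets [K] and convexity bounds
    [Psi] there by Psi L0 x. *)
Lemma opt_mult_near x0 (e : R) : dom x0 -> 0 < e ->
  \forall x \near x0, `|opt_mult x0 - opt_mult x| < e.
Proof.
move=> hx0 e0; set L0 := opt_mult x0.
pose r := e / 2; have r0 : 0 < r by rewrite divr_gt0.
pose K := [set l : sym0 R | `|l - L0| = r].
have cov : \forall x \near x0, K `<=` [set l | Psi L0 x < Psi l x].
  have nc := (compact_near_coveringP K).1 (@sym0_sphere_compact R L0 r).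
  apply: (nc _ (nbhs x0) (fun x l => Psi L0 x < Psi l x) (nbhs_filter x0)) => l Kl.
  have lL : L0 != l.
    apply/eqP => E; move: Kl; rewrite /K /= -E subrr normr0 => /eqP.
    by rewrite eq_sym gt_eqF.
  have lt := Psi_min_lt hx0 (fun k => opt_mult_min k hx0) lL.
  pose c := (Psi L0 x0 + Psi l x0) / 2.
  have c1 : Psi L0 x0 < c by rewrite /c ltr_pdivlMr// mulr_natr mulr2n ltrD2l.
  have c2 : c < Psi l x0 by rewrite /c ltr_pdivrMr// mulr_natr mulr2n ltrD2r.
  have [[U1 U2] /= [lU1 xU2] U12] := cvgr_gt _ (@Psi_continuous R l x0 (dom_eta hx0)) _ c2.
  have [[V1 V2] /= [lV1 xV2] V12] := cvgr_lt _ (@Psi_continuous R L0 x0 (dom_eta hx0)) _ c1.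
  exists (U1, U2 `&` V2) => /=.
    by split=> //; exact: filterI.
  move=> [l' x] /= [U1l [U2x V2x]].
  apply: (@lt_trans _ _ c).
    by apply: (V12 (L0, x)); split=> //=; exact: nbhs_singleton lV1.
  by apply: (U12 (l', x)).
have dn := dom_near hx0.
near=> x.
have hx : dom x by near: x.
have hK : K `<=` [set l | Psi L0 x < Psi l x] by near: x.
set L := opt_mult x.
rewrite distrC ltNge; apply/negP => eL.
have n0 : 0 < `|L - L0| by exact: lt_le_trans e0 eL.
pose t := r / `|L - L0|.
have t0 : 0 <= t by rewrite divr_ge0// ltW.
have t1 : t <= 1 by rewrite ler_pdivrMr// mul1r; apply: le_trans eL; rewrite /r; lra.
have /hK /= : K (L0 + t *: (L - L0)).
  by rewrite /K /= addrC addKr normrZ ger0_norm// divfK// gt_eqF.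
rewrite ltNge => /negP; apply; apply: le_trans (Psi_convex L0 L x t0 t1) _.
have := ler_wpM2l t0 (opt_mult_min L0 hx); rewrite -/L => h.
apply: (@le_trans _ _ ((1 - t) * Psi L0 x + t * Psi L0 x)); first by rewrite lerD2l.
by rewrite -mulrDl subrK mul1r.
Unshelve. all: by end_near. Qed.

(** The differential in x of l.Q - ln Z(l, x) when c = 1/Z. Multiplier, base point and factor are
    independent arguments because the squeeze evaluates them at different parameters. *)
Definition grad l y (c : R) v : R := dotm l v.1 - c * dpartition l y v.

Definition dJ x v : R := grad (opt_mult x) x (partition_fun (opt_mult x) x)^-1 v.

Lemma grad_close l0 x0 (c0 e : R) : x0.2 < `|x0.1| ^+ 2 -> 0 < e ->
  exists2 d, 0 < d & \forall y \near (l0, x0), forall c, `|c0 - c| < d -> forall v,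
    `|grad y.1 y.2 c v - grad l0 x0 c0 v| <= e * `|v|.
Proof.
move=> hx0 e0.
pose C0 := 10 * \int[H2 R]_(p in S) kern l0 x0 p.
have C00 : 0 <= C0 by rewrite mulr_ge0//; apply: Rintegral_ge0 => p _; exact: kern_ge0.
pose d := minr 1 (e / (3 * (C0 + 1))).
have C1 : 0 < 3 * (C0 + 1) by rewrite mulr_gt0// ltr_wpDl.
have d0 : 0 < d by rewrite lt_min ltr01 divr_gt0.
exists d => //.
pose e1 := e / (3 * (`|c0| + 1)).
have c01 : 0 < 3 * (`|c0| + 1) by rewrite mulr_gt0// ltr_wpDl.
have e10 : 0 < e1 by rewrite divr_gt0.
have e3 : 0 < e / 3 by rewrite divr_gt0.
near=> y.
have [yl _] : `|l0 - y.1| < e / 3 /\ `|x0 - y.2| < e / 3 by near: y; exact: near_pair.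
have yG : forall v, `|dpartition y.1 y.2 v - dpartition l0 x0 v| <= e1 * `|v|.
  by near: y; exact: dpartition_continuous.
move=> c cd v; rewrite /grad.
have -> : dotm y.1 v.1 - c * dpartition y.1 y.2 v - (dotm l0 v.1 - c0 * dpartition l0 x0 v) =
    - dotm (l0 - y.1 : sym0 R) v.1 - c * (dpartition y.1 y.2 v - dpartition l0 x0 v) +
    (c0 - c) * dpartition l0 x0 v by rewrite /= dotmBl; ring.
have v1 : `|v.1| <= `|v| by rewrite [leRHS]prod_normE le_max lexx.
have h1 : `|dotm (l0 - y.1 : sym0 R) v.1| <= e / 3 * `|v|.
  by apply: le_trans (dotm_norm_le _ _) _; apply: ler_pM => //; exact: ltW.
have cn : `|c| <= `|c0| + 1.
  rewrite -(subKr c0 c); apply: le_trans (ler_normB _ _) _; rewrite lerD2l.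
  by apply: ltW; apply: lt_le_trans cd _; rewrite /d ge_min lexx.
have h2 : `|c * (dpartition y.1 y.2 v - dpartition l0 x0 v)| <= e / 3 * `|v|.
  rewrite normrM; apply: (@le_trans _ _ ((`|c0| + 1) * (e1 * `|v|))).
    by apply: ler_pM.
  rewrite mulrA le_eqVlt; apply/orP; left; apply/eqP; congr (_ * _).
  by rewrite /e1; field; rewrite gt_eqF// ltr_wpDl.
have h3 : `|(c0 - c) * dpartition l0 x0 v| <= e / 3 * `|v|.
  rewrite normrM; apply: (@le_trans _ _ (e / (3 * (C0 + 1)) * (C0 * `|v|))).
    apply: ler_pM => //.
      by apply: ltW; apply: lt_le_trans cd _; rewrite /d ge_min lexx orbT.
    by apply: le_trans (dpartition_norm_le _ _ _) _; rewrite /C0 mulrAC.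
  rewrite mulrA ler_wpM2r// -[leRHS]mulr1.
  have -> : e / (3 * (C0 + 1)) * C0 = e / 3 * (C0 / (C0 + 1)).
    by field; rewrite gt_eqF// ltr_wpDl.
  apply: ler_wpM2l; first exact: ltW.
  by rewrite ler_pdivrMr ?ltr_wpDl// mul1r lerDl.
apply: le_trans (ler_normD _ _) _; apply: le_trans (lerD (ler_normB _ _) (lexx _)) _.
rewrite normrN (_ : e * `|v| = e / 3 * `|v| + e / 3 * `|v| + e / 3 * `|v|); last by field.
exact: lerD (lerD h1 h2) h3.
Unshelve. all: by end_near. Qed.

Lemma opt_mult_cvg x0 : dom x0 -> (fun x => (opt_mult x, x)) @ x0 --> (opt_mult x0, x0).
Proof.
move=> hx0.
have h1 : opt_mult x @[x --> x0] --> opt_mult x0.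
  by apply/(@cvgrPdist_lt _ _ _ (nbhs x0)) => e e0; exact: opt_mult_near.
have h2 : x @[x --> x0] --> x0 by exact: cvg_id.
exact: (@cvg_pair _ _ _ _ _ _ (nbhs_filter x0) (nbhs_filter _) (nbhs_filter x0) _ _ h1 h2).
Qed.

Lemma opt_partition_near x0 (d : R) : dom x0 -> 0 < d -> \forall x \near x0,
  `|(partition_fun (opt_mult x0) x0)^-1 - (partition_fun (opt_mult x) x)^-1| < d.
Proof.
move=> hx0 d0.
have h := cvg_comp _ _ (opt_mult_cvg hx0) (@partition_fun_continuous R _ _ (dom_eta hx0)).
have Z0 : partition_fun (opt_mult x0) x0 != 0 by rewrite gt_eqF// partition_fun_gt0.
have h' := cvg_comp _ _ h (inv_continuous Z0).
exact: (@cvgrPdist_lt _ _ _ (nbhs x0) _ _ _).1 h' d d0.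
Qed.

Lemma dJ_near x0 (e : R) : dom x0 -> 0 < e ->
  \forall x \near x0, forall v, `|dJ x v - dJ x0 v| <= e * `|v|.
Proof.
move=> hx0 e0.
have [d d0 hd] := @grad_close (opt_mult x0) x0 (partition_fun (opt_mult x0) x0)^-1 e (dom_eta hx0) e0.
have h1 := opt_mult_cvg hx0 hd.
have h2 := opt_partition_near hx0 d0.
near=> x => v; rewrite /dJ.
have H1 : forall c : R, `|(partition_fun (opt_mult x0) x0)^-1 - c| < d -> forall v,
    `|grad (opt_mult x) x c v -
      grad (opt_mult x0) x0 (partition_fun (opt_mult x0) x0)^-1 v| <= e * `|v|.
  by near: x; exact: h1.
by apply: H1; near: x; exact: h2.
Unshelve. all: by end_near. Qed.

Lemma ln_le_sub1 (t : R) : 0 < t -> ln t <= t - 1.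
Proof. by move=> t0; have := expR_ge1Dx (ln t); rewrite lnK ?posrE//; lra. Qed.

Lemma ln_diff_le (s t : R) : 0 < s -> 0 < t -> ln t - ln s <= s^-1 * (t - s).
Proof.
move=> s0 t0; rewrite -ln_div ?posrE//; apply: le_trans (ln_le_sub1 _) _.
  exact: divr_gt0.
by rewrite mulrBr mulVf ?gt_eqF// mulrC.
Qed.

Lemma squeeze_norm (a b m t k : R) : a <= t -> t <= b ->
  `|a - m| <= k -> `|b - m| <= k -> `|t - m| <= k.
Proof. by rewrite !ler_norml => at' tb /andP[a1 a2] /andP[b1 b2]; apply/andP; split; lra. Qed.

(* Danskin: J is a maximum over multipliers of functions whose x-increment is
   controlled on both sides by subgradients of the convex map partition_fun l. *)
Lemma Jfun_diff x0 (e : R) : dom x0 -> 0 < e -> \forall x \near x0,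
  `|Jfun x - Jfun x0 - dJ x0 (x - x0)| <= e * `|x - x0|.
Proof.
move=> hx0 e0; set L0 := opt_mult x0; set c0 := (partition_fun L0 x0)^-1.
have [d d0 hd] := @grad_close L0 x0 c0 e (dom_eta hx0) e0.
have k1 : L0 @[x --> x0] --> L0 by exact: (@cvg_cst _ L0 _ (nbhs x0) _).
have k2 : x @[x --> x0] --> x0 by exact: cvg_id.
have k3 : x0 @[x --> x0] --> x0 by exact: (@cvg_cst _ x0 _ (nbhs x0) _).
have k4 : opt_mult x @[x --> x0] --> L0.
  by apply/(@cvgrPdist_lt _ _ _ (nbhs x0)) => a a0; exact: opt_mult_near.
have h1 := @cvg_pair _ _ _ _ _ _ (nbhs_filter x0) (nbhs_filter _) (nbhs_filter x0) _ _ k1 k2 _ hd.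
have h2 := @cvg_pair _ _ _ _ _ _ (nbhs_filter x0) (nbhs_filter _) (nbhs_filter x0) _ _ k4 k3 _ hd.
have h3 := opt_partition_near hx0 d0.
have h4 := dom_near hx0.
near=> x.
have hx : dom x by near: x.
have H1 : forall c, `|c0 - c| < d -> forall v, `|grad L0 x c v - grad L0 x0 c0 v| <= e * `|v|.
  by near: x; exact: h1.
have H2 : forall c, `|c0 - c| < d -> forall v,
    `|grad (opt_mult x) x0 c v - grad L0 x0 c0 v| <= e * `|v|.
  by near: x; exact: h2.
have H3 : `|c0 - (partition_fun (opt_mult x) x)^-1| < d by near: x; exact: h3.
move: H2 H3; set L := opt_mult x; set c := (partition_fun L x)^-1 => H2 H3.
set v := x - x0.
have Zp l y : dom y -> 0 < partition_fun l y by move=> hy; exact: partition_fun_gt0.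
have c0p : 0 <= c0 by rewrite invr_ge0 ltW// Zp.
have cp : 0 <= c by rewrite invr_ge0 ltW// Zp.
have vE l : dotm l x.1 - dotm l x0.1 = dotm l v.1.
  by rewrite /v /= dotmBr.
(* [L0] competes at x. The logarithm is linearised at [x0], while the subgradient is taken at x, so
   that convexity bounds the increment of Z from above. *)
have low : grad L0 x c0 v <= Jfun x - Jfun x0.
  have := Jfun_ge L0 hx; rewrite (JfunE hx0) -/L0 => h.
  have l1 := ln_diff_le (Zp L0 _ hx0) (Zp L0 _ hx).
  have s1 := partition_fun_subgradient L0 x x0.
  have -> : grad L0 x c0 v = dotm L0 v.1 - c0 * dpartition L0 x v by [].
  have s2 : c0 * (partition_fun L0 x - partition_fun L0 x0) <= c0 * dpartition L0 x v.
    apply: ler_wpM2l => //; move: s1; rewrite /v -[x0 - x]opprB -scaleN1r dpartitionZ mulN1r.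
    by clear; lra.
  by move: h l1 s2; rewrite -/c0 -vE; clear; lra.
(* The mirror image: the optimal multiplier for x competes at [x0], with the logarithm linearised at
   x and the subgradient taken at [x0]. *)
have upp : Jfun x - Jfun x0 <= grad L x0 c v.
  have := Jfun_ge L hx0; rewrite (JfunE hx) -/L => h.
  have l1 := ln_diff_le (Zp L _ hx) (Zp L _ hx0).
  have s1 := partition_fun_subgradient L x0 x.
  have -> : grad L x0 c v = dotm L v.1 - c * dpartition L x0 v by [].
  have s2 : c * (partition_fun L x0 - partition_fun L x) <= - (c * dpartition L x0 v).
    rewrite -mulrN; apply: ler_wpM2l => //; move: s1; rewrite -/v; clear; lra.
  by move: h l1 s2; rewrite -/c -vE; clear; lra.
have n1 := H1 c0 _ v; have n2 := H2 c H3 v.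
have {}n1 : `|grad L0 x c0 v - grad L0 x0 c0 v| <= e * `|v|.
  by apply: n1; rewrite subrr normr0.
exact: squeeze_norm low upp n1 n2.
Unshelve. all: by end_near. Qed.

Lemma grad_linear l y c (a : R) v v' : grad l y c (a *: v + v') = a * grad l y c v + grad l y c v'.
Proof.
rewrite /grad dpartitionD dpartitionZ /= dotmDr dotmZr; ring.
Qed.

Lemma grad_bounded l y c : exists2 C, 0 < C & forall v, `|grad l y c v| <= C * `|v|.
Proof.
pose C0 := 10 * \int[H2 R]_(p in S) kern l y p.
have C00 : 0 <= C0 by rewrite mulr_ge0//; apply: Rintegral_ge0 => p _; exact: kern_ge0.
exists (`|l| + `|c| * C0 + 1); first by rewrite ltr_wpDl// addr_ge0// mulr_ge0.
move=> v; apply: le_trans (ler_normB _ _) _.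
have h1 : `|dotm l v.1| <= `|l| * `|v|.
  apply: le_trans (dotm_norm_le _ _) _; apply: ler_wpM2l => //.
  by rewrite [leRHS]prod_normE le_max lexx.
have h2 : `|c * dpartition l y v| <= `|c| * C0 * `|v|.
  rewrite normrM -mulrA; apply: ler_wpM2l => //.
  by apply: le_trans (dpartition_norm_le _ _ _) _; rewrite /C0 mulrAC.
by have := normr_ge0 v; rewrite !mulrDl mul1r; lra.
Qed.

End danskin.

(** * From an epsilon estimate to the differential *)

Section diff_estimate.
Variables (R : realType) (V : normedModType R).

(** The candidate [df] is a bare function. Linearity and the norm bound promote it to a continuous
    linear map, and the estimate is then the small-o expansion that determines the differential. *)
Lemma is_diff_estimate (f df : V -> R) (x0 : V) :
  (forall (a : R) u v, df (a *: u + v) = a * df u + df v) ->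
  (exists2 C, 0 < C & forall v, `|df v| <= C * `|v|) ->
  (forall e : R, 0 < e -> \forall x \near x0,
     `|f x - f x0 - df (x - x0)| <= e * `|x - x0|) ->
  is_diff x0 f df.
Proof.
move=> lin [C C0 dfC] est.
pose dfl : {linear V -> R} := HB.pack df (GRing.isLinear.Build R V R *:%R df lin).
have cdf : continuous dfl.
  move=> v; apply/(@cvgrPdist_lt _ _ _ (nbhs v)) => e e0; near=> w.
  rewrite -linearB; apply: le_lt_trans (dfC _) _.
  rewrite -ltr_pdivlMl//.
  have : ball v (C^-1 * e) w by near: w; apply: nbhsx_ballx; rewrite mulr_gt0 ?invr_gt0.
  by rewrite -ball_normE.
have fo : f \o shift x0 = cst (f x0) + dfl +o_ 0 id.
  apply/eqaddoP => e e0.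
  have /nbhs_ballP[d d0 dP] := est e e0.
  near=> h.
  have hd : `|h| < d.
    have : ball (0 : V) d h by near: h; exact: nbhsx_ballx.
    by rewrite -ball_normE /= sub0r normrN.
  have := dP (h + x0); rewrite addrK => H.
  have {}H := H _; rewrite /= !fctE /= opprD addrA; apply: H.
  by rewrite -ball_normE /= opprD addrCA subrr addr0 normrN.
have E : 'd f x0 = dfl :> (V -> R) := diff_unique cdf fo.
apply: DiffDef; last exact: E.
by apply/diff_locallyP; rewrite E.
Unshelve. all: by end_near. Qed.

End diff_estimate.

(** * Identification of the partial derivatives *)

Section conclusion.
Variable R : realType.
Implicit Types (l L u B Q : sym0 R) (eta : R) (x y v : sym0 R * R) (p : R3 R).
Local Notation S := (@sphere R : set (R3 R)).
Local Notation mS := (@measurable_sphere R).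
Local Notation Sfin := (@H2_sphere_lty R).
Local Notation bm := (bounded_mfun S).
Local Notation cst_bm := (bounded_mfun_cst S).

(** The quotient f_Q / (Qp.p - eta) after cancellation of the weight, extended by 0 outside E_Q. *)
Definition opt_ratio x p : R := kern (opt_mult x) x p / partition_fun (opt_mult x) x.

Lemma bm_opt_ratio x : bm (opt_ratio x).
Proof. exact: bounded_mfunM (bm_kern _ _) (cst_bm _). Qed.

Lemma f_opt_optimal Q eta : dom (Q, eta) -> is_optimal Q eta (f_opt Q eta).
Proof.
move=> hx; have hL l := opt_mult_min l hx.
apply: (@getPex _ (is_optimal Q eta)).
exists (gibbs_density (opt_mult (Q, eta)) (Q, eta)).
apply: (is_optimalP _ hx hL).2; split; first exact: gibbs_density_admissible.
exact: aeW.
Qed.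

(** [f_opt] is a chosen minimiser and agrees with the Gibbs density only almost everywhere, so the
    quotient can be replaced by [opt_ratio] only under the integral. *)
Lemma integral_E_f_opt Q eta (g : R3 R -> R) : dom (Q, eta) -> bm g ->
  \int[H2 R]_(p in E_ Q eta) (f_opt Q eta p / (quad Q p - eta) * g p) =
  \int[H2 R]_(p in S) (opt_ratio (Q, eta) p * g p).
Proof.
move=> hx [mg _]; set x := (Q, eta); set L := opt_mult x; set Z := partition_fun L x.
have [[[fi _ _] _] fae] := (is_optimalP _ hx (fun l => opt_mult_min l hx)).1 (f_opt_optimal hx).
pose P : set (R3 R) := [set q | 0 < aff x q].
have mP : measurable P := measurable_aff_gt0 x.
have EE : E_ Q eta = S `&` P.
  by apply/seteqP; split=> p [Sp /= h]; split=> //=; move: h; rewrite /P /aff /= subr_gt0.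
have mE : measurable (S `&` P) := measurableI _ _ mS mP.
have mf : measurable_fun (S `&` P) (f_opt Q eta).
  apply: measurable_funS mS (@subIsetl _ _ _) _.
  by apply/measurable_EFinP; exact: measurable_int fi.
have mgE : measurable_fun (S `&` P) g := measurable_funS mS (@subIsetl _ _ _) mg.
(* The denominator is positive here, so its inverse is exp(-ln), a composition of measurable
   functions. *)
have ma : measurable_fun (S `&` P) (fun p => (quad Q p - eta)^-1).
  apply: (@eq_measurable_fun _ _ _ _ _ (fun p => expR (- ln (aff x p)))).
    by move=> p /set_mem [_ ap]; rewrite expRN lnK.
  apply: (measurableT_comp (@measurable_expR R)).
  apply: measurable_funN; apply: (measurableT_comp (@measurable_ln R)).
  exact: measurable_funTS (measurable_aff x).
pose h1 p := f_opt Q eta p / (quad Q p - eta) * g p.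
pose h2 p := expR (quad L p) / Z * g p.
have m1 : measurable_fun (S `&` P) (EFin \o h1).
  by apply/measurable_EFinP; exact: measurable_funM (measurable_funM mf ma) mgE.
have m2 : measurable_fun (S `&` P) (EFin \o h2).
  apply/measurable_EFinP; apply: measurable_funM mgE.
  apply: measurable_funM; last exact: measurable_cst.
  exact: measurableT_comp (@measurable_expR R) (measurable_funTS (measurable_quad _)).
have h12 : ae_eq (H2 R) (S `&` P) (EFin \o h1) (EFin \o h2).
  apply: (@filterS _ _ (ae_filter_ringOfSetsType (H2 R)) _ _ _ fae) => p fp [Sp Pp].
  rewrite /= /h1 (fp Sp) /gibbs_density -/L -/Z; congr EFin; congr (_ * _).
  have ap : aff x p != 0 by rewrite gt_eqF.
  have Z0 : Z != 0 by rewrite gt_eqF// partition_fun_gt0.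
  rewrite /weight max_l; last exact: ltW.
  by rewrite -[quad Q p - eta]/(aff x p); field; rewrite Z0 ap.
rewrite EE; transitivity (\int[H2 R]_(p in S `&` P) h2 p).
  by congr fine; exact: (@ae_eq_integral _ _ _ (H2 R) (S `&` P) (EFin \o h2) (EFin \o h1) mE m1 m2 h12).
rewrite Rintegral_mkcondr; apply: eq_on_int => p Sp.
rewrite /opt_ratio /kern -/L -/Z patchE indicE.
by case: ifPn => _; rewrite ?mulr1 ?mulr0 ?mul0r.
Qed.

Lemma integral_opt_ratio x B : dom x ->
  \int[H2 R]_(p in S) (opt_ratio x p * quad B p) =
  (partition_fun (opt_mult x) x)^-1 * dpartition (opt_mult x) x (B, 0).
Proof.
move=> hx; rewrite -(bounded_intZ mS Sfin _ (bm_dpart _ _ _)).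
apply: eq_on_int => p _; rewrite /opt_ratio /aff /= subr0.
by rewrite (mulrC (kern _ _ _)) mulrA.
Qed.

Lemma mxintegral_E_f_opt Q eta : dom (Q, eta) ->
  mxintegral (E_ Q eta) (fun p => (f_opt Q eta p / (quad Q p - eta)) *: qtensor p) =
  mxintegral S (fun p => opt_ratio (Q, eta) p *: qtensor p).
Proof.
move=> hx; apply/matrixP => i j; rewrite !mxE.
transitivity (\int[H2 R]_(p in S) (opt_ratio (Q, eta) p * qtensor p i j)).
  rewrite -(integral_E_f_opt hx (@bm_qtensor R i j)).
  by apply: eq_on_int => p _; rewrite [LHS]mxE.
by apply: eq_on_int => p _; rewrite [RHS]mxE.
Qed.

Definition gradQ Q eta : 'M[R]_3 := (Lambda Q eta : 'M[R]_3) - mxintegral (E_ Q eta)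
  (fun p => (f_opt Q eta p / (quad Q p - eta)) *: qtensor p).

Lemma gradQ_sym0 Q eta : dom (Q, eta) -> gradQ Q eta \in @is_sym0 R.
Proof.
move=> hx; rewrite /gradQ (mxintegral_E_f_opt hx) rpredB//; first exact: valP.
exact: mxintegral_qtensor_sym0 (bounded_mfun_int mS Sfin (bm_opt_ratio _)).
Qed.

Lemma dJ_Q Q eta B : dom (Q, eta) -> dJ (Q, eta) (B, 0) = dotm (gradQ Q eta) B.
Proof.
move=> hx; rewrite /gradQ (mxintegral_E_f_opt hx) dotmBl.
have oi := bounded_mfun_int mS Sfin (bm_opt_ratio (Q, eta)).
rewrite (dotmC (mxintegral _ _)) (dotm_mxintegral (sym0_tr0 B) oi).
by rewrite integral_opt_ratio.
Qed.

(** The minus sign in [grad] cancels that of aff (0, h) = -h, which is why the derivative in eta is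
    a positive integral. *)
Lemma dJ_eta Q eta (h : R) : dom (Q, eta) -> dJ (Q, eta) (0, h) =
  h * \int[H2 R]_(p in E_ Q eta) (f_opt Q eta p / (quad Q p - eta)).
Proof.
move=> hx.
have -> : \int[H2 R]_(p in E_ Q eta) (f_opt Q eta p / (quad Q p - eta)) =
    \int[H2 R]_(p in S) (opt_ratio (Q, eta) p * 1).
  rewrite -(integral_E_f_opt hx (cst_bm 1)).
  by apply: eq_on_int => p _; rewrite mulr1.
have b1 := bounded_mfunM (bm_opt_ratio (Q, eta)) (cst_bm 1).
rewrite -(bounded_intZ mS Sfin _ b1) /dJ /grad.
have -> : dotm (opt_mult (Q, eta)) ((0, h) : sym0 R * R).1 = 0.
  by rewrite /dotm mulmx0 raddf0.
rewrite sub0r -mulNr -(bounded_intZ mS Sfin _ (bm_dpart _ _ _)).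
apply: eq_on_int => p _; rewrite /opt_ratio /aff /=.
have -> : quad 0 p = 0.
  by rewrite /quad mul0mx /dotv big1// => i _; rewrite mxE mul0r.
by rewrite sub0r; ring.
Qed.

Lemma Jfun_is_diff x : dom x -> is_diff x (@Jfun R) (dJ x).
Proof.
move=> hx; apply: is_diff_estimate => [a u v||e e0].
- exact: grad_linear.
- exact: grad_bounded.
- exact: Jfun_diff.
Qed.

Lemma J_C1 : C1_on (@dom R) (@Jfun R).
Proof.
split=> [x hx|x hx e e0]; first by have [] := Jfun_is_diff hx.
rewrite near_withinE; have h := dJ_near hx e0.
near=> y => hy v.
have hv : forall v, `|dJ y v - dJ x v| <= e * `|v| by near: y; exact: h.
have dE z : dom z -> 'd (@Jfun R) z v = dJ z v.
  by move=> hz; have [_ E] := Jfun_is_diff hz; exact: (congr1 (fun g => g v) E).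
by have := hv v; rewrite -(dE y hy) -(dE x hx).
Unshelve. all: by end_near. Qed.

(** Restriction of the joint estimate to the slice of constant eta; in the maximum norm of the
    product, (B, 0) has the norm of B. *)
Lemma J_gradient Q eta : dom (Q, eta) ->
  is_gradient (fun Q' : sym0 R => fine (J Q' eta)) Q (gradQ Q eta).
Proof.
move=> hx; split; first exact: gradQ_sym0.
have nE B : `|((B, 0) : sym0 R * R)| = `|B|.
  by rewrite prod_normE /= normr0 max_l.
apply: is_diff_estimate => [a u v||e e0].
- by rewrite /= dotmDr dotmZr.
- have [C C0 hC] := grad_bounded (opt_mult (Q, eta)) (Q, eta) (partition_fun (opt_mult (Q, eta)) (Q, eta))^-1.
  by exists C => // B; rewrite -dJ_Q// -nE; exact: hC.
have /nbhs_ballP[d d0 dP] := Jfun_diff hx e0.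
near=> Q'.
have h : ball (Q, eta) d (Q', eta).
  by split; [near: Q'; exact: nbhsx_ballx|exact: ballxx].
have := dP _ h.
have -> : (Q', eta) - (Q, eta) = (Q' - Q, 0) by rewrite -[RHS]/(Q' - Q, _) -(subrr eta).
by rewrite nE dJ_Q.
Unshelve. all: by end_near. Qed.

Lemma J_eta_derive Q eta : dom (Q, eta) ->
  is_derive eta 1 (fun eta' : R => fine (J Q eta'))
    (\int[H2 R]_(p in E_ Q eta) (f_opt Q eta p / (quad Q p - eta))).
Proof.
move=> hx; set c := \int[_]_(_ in _) _.
have nE (h : R) : `|((0, h) : sym0 R * R)| = `|h|.
  by rewrite prod_normE /= normr0 max_r.
have D : is_diff eta (fun eta' : R => fine (J Q eta')) (fun h : R => h * c).
  apply: is_diff_estimate => [a u v||e e0].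
  - by rewrite mulrDl -mulrA.
  - exists (`|c| + 1); first by rewrite ltr_wpDl.
    by move=> h; rewrite normrM mulrC ler_wpM2r// lerDl.
  have /nbhs_ballP[d d0 dP] := Jfun_diff hx e0.
  near=> t.
  have h : ball (Q, eta) d (Q, t).
    by split; [exact: ballxx|near: t; exact: nbhsx_ballx].
  have := dP _ h.
  have -> : (Q, t) - (Q, eta) = (0, t - eta) by rewrite -[RHS]/(_, t - eta) -(subrr Q).
  by rewrite nE dJ_eta.
have [df dE] := D.
apply: DeriveDef; first exact: diff_derivable.
by rewrite deriveE// dE mul1r.
Unshelve. all: by end_near. Qed.

End conclusion.

Theorem proposition3p18 (R : realType) :
  [/\ (forall (Q : sym0 R) (eta : R), dom (Q, eta) -> J Q eta \is a fin_num),
      C1_on (@dom R) (fun x : sym0 R * R => fine (J x.1 x.2)) &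
      forall (Q : sym0 R) (eta : R), dom (Q, eta) ->
        [/\ is_optimal Q eta (f_opt Q eta),
            is_dual_maximiser Q eta (Lambda Q eta),
            is_gradient (fun Q' : sym0 R => fine (J Q' eta)) Q
              ((Lambda Q eta : 'M[R]_3) - mxintegral (E_ Q eta)
                 (fun p => (f_opt Q eta p / (quad Q p - eta)) *: qtensor p)) &
            is_derive eta 1 (fun eta' : R => fine (J Q eta'))
              (\int[H2 R]_(p in E_ Q eta)
                 (f_opt Q eta p / (quad Q p - eta)))]].
Proof.
split=> [Q eta hx||Q eta hx].
- by rewrite [J Q eta](J_eq hx (fun l => opt_mult_min l hx)).
- exact: J_C1.
- split.
  + exact: f_opt_optimal.
  + exact: (opt_mult_maximiser hx).
  + exact: J_gradient.
  + exact: J_eta_derive.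
Qed.
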